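(* Let $G$ be a finite simple planar graph, let $\Delta=\Delta(G)$ be its maximum degree, and let $\Delta_2=\Delta_2(G)$ be its maximum co-degree. Then $$q_B(G)\leq \Delta+\max\{\Delta_2,38\}.$$
   Context: All graphs are finite and simple. A B-coloring of a graph $G$ is a coloring of the edges of $G$ in which every copy (as a not necessarily induced subgraph) of $K_{1,2}$ and every copy of $K_{2,2}=C_4$ in $G$ is totally multicolored, i.e. all edges of the copy receive pairwise distinct colors. Equivalently, it is a proper edge coloring in which the four edges of every $4$-cycle receive four distinct colors. The B-coloring number $q_B(G)$ is the minimum number of colors sufficient for a B-coloring of $G$. The maximum co-degree $\Delta_2(G)$ is the maximum $t$ such that $G$ has a (not necessarily induced) subgraph isomorphic to $K_{2,t}$; that is, it is the maximum of $|N(u)\cap N(w)|$ over pairs of distinct vertices $u,w$ of $G$, where $N(u)$ denotes the neighborhood of $u$ (with $\Delta_2(G)=0$ if $G$ has fewer than two vertices). *)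

(* Defs.v *)
From HB Require Import structures.
From mathcomp Require Import all_boot all_order all_algebra.
From mathcomp Require Import all_classical all_reals all_analysis.

Set Implicit Arguments.
Unset Strict Implicit.
Unset Printing Implicit Defensive.

Import Order.TTheory GRing.Theory Num.Theory.
Import numFieldNormedType.Exports.

(* A finite simple graph is a symmetric irreflexive relation [e] on a finite  *)
(* type [T] of vertices; edges are the two-element sets of adjacent vertices. *)

Definition nbhd (T : finType) (e : rel T) (x : T) : {set T} :=
  [set y | e x y].

Definition edges (T : finType) (e : rel T) : {set {set T}} :=
  [set [set z.1; z.2] | z in [set z : T * T | e z.1 z.2]].

Definition max_degree (T : finType) (e : rel T) : nat :=
  (\max_(x : T) #|nbhd e x|)%N.

Definition max_codegree (T : finType) (e : rel T) : nat :=
  (\max_(u : T) \max_(w : T | w != u) #|nbhd e u :&: nbhd e w|)%N.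

(* [A] and [B] are the two sides of a not necessarily induced subgraph of [e] *)
(* isomorphic to the complete bipartite graph K_{#|A|,#|B|}.                  *)
Definition biclique (T : finType) (e : rel T) (A B : {set T}) : bool :=
  [disjoint A & B] && [forall a in A, forall b in B, e a b].

Definition biclique_edges (T : finType) (A B : {set T}) : {set {set T}} :=
  [set [set a; b] | a in A, b in B].

(* Only the values of [c] on [edges e] matter: the edges of a copy of K_{1,2} *)
(* or K_{2,2} in [e] belong to [edges e].                                     *)
Definition B_coloring (T : finType) (e : rel T) (c : {set T} -> nat) : Prop :=
  forall A B : {set T}, biclique e A B ->
    (#|A| = 1 /\ #|B| = 2) \/ (#|A| = 2 /\ #|B| = 2) ->
    {in biclique_edges A B &, injective c}.

Definition B_colorable (T : finType) (e : rel T) (k : nat) : Prop :=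
  exists c : {set T} -> nat,
    B_coloring e c /\ (forall f, f \in edges e -> (c f < k)%N).

Lemma B_colorable_ex (T : finType) (e : rel T) :
  exists k, `[< B_colorable e k >].
Proof.
exists #|{: {set T}}|; apply/asboolP; exists (fun f : {set T} => nat_of_ord (enum_rank f)); split.
  by move=> A B _ _ f g _ _ /val_inj/enum_rank_inj.
by move=> f _; apply: ltn_ord.
Qed.

(* The B-coloring number; it is 0 for a graph without edges. *)
Definition B_coloring_number (T : finType) (e : rel T) : nat :=
  ex_minn (B_colorable_ex e).

Local Open Scope ring_scope.

(* [p] places the vertices and [g f] parametrizes the arc that draws the edge *)
(* [f]; the values of [g f] outside the unit interval are irrelevant.         *)
Record plane_drawing (R : realType) (T : finType) (e : rel T)
    (p : T -> R * R) (g : {set T} -> R -> R * R) : Prop := PlaneDrawing {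
  drawing_vertices : injective p;
  drawing_continuous : forall f, f \in edges e ->
    ({within `[0, 1], continuous (g f)})%classic;
  drawing_injective : forall f, f \in edges e ->
    {in `[0, 1] &, injective (g f)};
  drawing_ends : forall f, f \in edges e ->
    exists x y : T, [/\ f = [set x; y], g f 0 = p x & g f 1 = p y];
  drawing_avoids_vertices : forall f x t, f \in edges e -> t \in `]0, 1[ ->
    g f t <> p x;
  drawing_no_crossing : forall f f' s t, f \in edges e -> f' \in edges e ->
    f != f' -> s \in `]0, 1[ -> t \in `]0, 1[ -> g f s <> g f' t
}.

Definition planar (R : realType) (T : finType) (e : rel T) : Prop :=
  exists (p : T -> R * R) (g : {set T} -> R -> R * R), plane_drawing e p g.

(* Main.v *)
Require Import Defs.
From mathcomp Require Import all_boot zify.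
From Stdlib Require Import Ring.

(* A drawing yields, by sampling its arcs, an identity modulo 2 for every pair *)
(* of independent edges.  The existence of such identities passes to minors    *)
(* and fails for K_5 and K_{3,3}, which gives the linear bounds on the number  *)
(* of edges of planar and of bipartite planar graphs.                          *)
(* In a vertex-minimal counterexample every vertex is incident with a heavy    *)
(* edge, one which conflicts with at least as many edges as there are colors,  *)
(* and if it has at most two heavy edges, then there are many heavy edges      *)
(* opposite to them.  The other end of a heavy edge at a vertex of small       *)
(* degree has large degree.  Euler's formula and discharging then lead to a    *)
(* contradiction.  The vertices of degree at most 5 with three neighbours of   *)
(* degree at least 12 are few by the bipartite bound; most others are reduced  *)
(* to this case by adding a dominating set whose members have private          *)
(* neighbours; each of the rest is joined to two adjacent vertices of degree   *)
(* at least 31, many of whose neighbours do not need any charge from them.     *)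

(** A B-coloring is a proper coloring of the conflict relation, in which two edges conflict when
    they share a vertex or are opposite in a 4-cycle. Put K = D + m, where D is the maximum degree
    and m = max(Delta_2, 38), and take a counterexample with the fewest non-isolated vertices. An
    edge is heavy if it has at least K conflicts. Light edges can be colored last, greedily, and the
    heavy edges that avoid a given non-isolated vertex v inherit a coloring from G - v. So v has a
    heavy edge, and if va is the only one, then more than m heavy edges are opposite to va, since
    only these and the at most D - 1 other edges at a can block colors for va ([reducible0],
    [reducible1], [reducible2]).

    By planarity few edges join N(u) to N(v) ([cross_edges_bound]), so a heavy edge uv satisfies D +
    46 <= 3 d(u) + 2 d(v) ([heavy_degree_sum]). Hence a heavy edge at a vertex of degree at most 5,
    8 or 11 leads to a vertex of degree at least 31, 27 or 22 ([hv_thr]).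

    Give every non-isolated vertex the charge d - 6. By Euler's formula the total is negative, and
    only the degrees 3, 4 and 5 lack charge. A vertex pays 6, 7, 6 and 6 units for reaching the
    degrees 12, 22, 27 and 31, in all 25 = 31 - 6. The first 6 units serve the vertices with three
    neighbours of degree at least 12 or in a dominating set C ([card_triples]). One unit at degree
    22 serves those with a single big neighbour ([card_one_big]). Six units at each of 22, 27 and 31
    lift the members of C to the level of degree 12 ([rich_domination]). What exceeds 31, with the
    charge of some neighbours, serves the remaining vertices ([poor_structure], [double_rest]). The
    total is thus nonnegative, a contradiction ([count_contradiction]).

    Planarity enters only through a parity identity which holds for drawings ([planar_z2_planar])
    and passes to minors ([z2_planar_minor]); excluding K_5 and K_{3,3} then yields [euler_bound]
    and [bipartite_bound]. *)

Set Implicit Arguments.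
Unset Strict Implicit.
Unset Printing Implicit Defensive.

(** * Planarity modulo 2 *)

(* In a drawing, [r x y z] is the parity of the crossings of the arc [x y]    *)
(* with the horizontal ray from [z], and [n x z] compares [x] and [z] in the  *)
(* lexicographic order of the plane.  For disjoint arcs the identity computes *)
(* the parity of a winding number.                                            *)
Definition z2_planar (T : finType) (e : rel T) : Prop :=
  exists (n : T -> T -> bool) (r : T -> T -> T -> bool),
    (forall x y, x != y -> n y x = ~~ n x y) /\
    (forall x y z w, uniq [:: x; y; z; w] -> e x y -> e z w ->
       r x y z (+) r x y w (+) (r z w x (+) r z w y)
       = n x z (+) n x w (+) (n y z (+) n y w)).

Section Z2Planar.
Variables (T : finType) (e : rel T).
Hypothesis e_irr : irreflexive e.

Fixpoint walk_sum (r : T -> T -> T -> bool) (x : T) (s : seq T) (k : T) : bool :=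
  if s is y :: s' then r x y k (+) walk_sum r y s' k else false.

(** The identity is additive: keep [n], sum [r] along the walks, and the terms at interior vertices
    cancel. Only walks of independent edges have to be disjoint; those of edges with a common end
    may overlap, which covers contractions. *)
Lemma z2_planar_minor (f : rel T) (w : T -> T -> seq T) :
    z2_planar e ->
    (forall x y, f x y -> path e x (w x y) /\ last x (w x y) = y) ->
    (forall x y z u, uniq [:: x; y; z; u] -> f x y -> f z u ->
       forall a, a \in x :: w x y -> a \notin z :: w z u) ->
  z2_planar f.
Proof.
move=> [n [r [nC rE]]] wP wdisj; exists n, (fun x y k => walk_sum r x (w x y) k).
split=> // x y z u Uxyzu fxy fzu.
have step x1 y1 z1 t : e x1 y1 -> path e z1 t ->
    x1 \notin z1 :: t -> y1 \notin z1 :: t ->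
    r x1 y1 z1 (+) r x1 y1 (last z1 t) (+)
      (walk_sum r z1 t x1 (+) walk_sum r z1 t y1)
    = n x1 z1 (+) n x1 (last z1 t) (+) (n y1 z1 (+) n y1 (last z1 t)).
  move=> exy; elim: t z1 => [|z2 t IH] z1 /=; first by rewrite !addbb.
  move=> /andP[ez pt]; rewrite !inE !negb_or => /and3P[x1z1 x1z2 x1t].
  move=> /and3P[y1z1 y1z2 y1t].
  have /= := IH z2 pt; rewrite !inE !negb_or x1z2 x1t y1z2 y1t.
  move=> /(_ isT isT) IH'.
  have U4 : uniq [:: x1; y1; z1; z2].
    rewrite /= !inE !negb_or x1z1 x1z2 y1z1 y1z2 /= !andbT.
    apply/andP; split; first by apply: contraTneq exy => ->; rewrite e_irr.
    by apply: contraTneq ez => ->; rewrite e_irr.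
  have E := rE _ _ _ _ U4 exy ez.
  (* The term [r x1 y1 z2] occurs twice and cancels. *)
  transitivity ((r x1 y1 z1 (+) r x1 y1 z2 (+) (r z1 z2 x1 (+) r z1 z2 y1)) (+)
    (r x1 y1 z2 (+) r x1 y1 (last z2 t) (+)
      (walk_sum r z2 t x1 (+) walk_sum r z2 t y1))).
    move: (r x1 y1 z1) (r x1 y1 z2) (r z1 z2 x1) (r z1 z2 y1) (r x1 y1 (last z2 t))
      (walk_sum r z2 t x1) (walk_sum r z2 t y1).
    by do 7!case.
  rewrite E IH'.
  move: (n x1 z1) (n x1 z2) (n y1 z1) (n y1 z2) (n x1 (last z2 t)) (n y1 (last z2 t)).
  by do 6!case.
have walks x1 s z1 t : path e x1 s -> path e z1 t ->
    (forall a, a \in x1 :: s -> a \notin z1 :: t) ->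
    walk_sum r x1 s z1 (+) walk_sum r x1 s (last z1 t) (+)
      (walk_sum r z1 t x1 (+) walk_sum r z1 t (last x1 s))
    = n x1 z1 (+) n x1 (last z1 t) (+) (n (last x1 s) z1 (+) n (last x1 s) (last z1 t)).
  elim: s x1 => [|x2 s IH] x1 /=; first by move=> _ _ _; rewrite !addbb.
  move=> /andP[ex ps] pt D.
  have D2 a : a \in x2 :: s -> a \notin z1 :: t.
    by move=> ain; apply: D; rewrite inE ain orbT.
  have E := IH x2 ps pt D2.
  have F := step x1 x2 z1 t ex pt (D _ (mem_head _ _)) (D2 _ (mem_head _ _)).
  transitivity ((r x1 x2 z1 (+) r x1 x2 (last z1 t) (+)
      (walk_sum r z1 t x1 (+) walk_sum r z1 t x2)) (+)
    (walk_sum r x2 s z1 (+) walk_sum r x2 s (last z1 t) (+)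
        (walk_sum r z1 t x2 (+) walk_sum r z1 t (last x2 s)))).
    move: (r x1 x2 z1) (r x1 x2 (last z1 t)) (walk_sum r x2 s z1)
      (walk_sum r x2 s (last z1 t)) (walk_sum r z1 t x1) (walk_sum r z1 t x2)
      (walk_sum r z1 t (last x2 s)).
    by do 7!case.
  rewrite E F.
  move: (n x1 z1) (n x1 (last z1 t)) (n x2 z1) (n x2 (last z1 t))
    (n (last x2 s) z1) (n (last x2 s) (last z1 t)).
  by do 6!case.
have [pxy lxy] := wP _ _ fxy; have [pzu lzu] := wP _ _ fzu.
by have := walks _ _ _ _ pxy pzu (wdisj _ _ _ _ Uxyzu fxy fzu); rewrite lxy lzu.
Qed.

Lemma sub_z2_planar (f : rel T) : subrel f e -> z2_planar e -> z2_planar f.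
Proof.
move=> sfe [n [r [nC rE]]]; exists n, r; split=> // x y z w U fxy fzw.
by apply: rE => //; apply: sfe.
Qed.
End Z2Planar.

(** * Exclusion of K_5 and K_{3,3} *)

Section Kuratowski.
Variables (T : finType) (e : rel T).
Hypothesis e_planar : z2_planar e.

(* Adding up the identities of all independent pairs of edges, every [r] term *)
(* occurs an even number of times; the [n] terms leave the parity of the      *)
(* crossings of a convex drawing, which is odd.                               *)
Lemma z2_planar_K5 (a b c d f : T) : uniq [:: a; b; c; d; f] ->
  e a b -> e a c -> e a d -> e a f -> e b c -> e b d -> e b f -> e c d ->
  e c f -> e d f -> False.
Proof.
case: e_planar => n [r [nC rE]] U ab ac ad af bc bd bf cd cf df.
(* Restated with [xorb], the addition of the Boolean ring, for which [ring] is available. *)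
have {}rE x y z w : uniq [:: x; y; z; w] -> e x y -> e z w ->
    xorb (xorb (xorb (r x y z) (r x y w)) (xorb (r z w x) (r z w y)))
     (xorb (xorb (n x z) (n x w)) (xorb (n y z) (n y w))) = false.
  move=> H1 H2 H3; have /= := rE _ _ _ _ H1 H2 H3.
  by move: (r x y z) (r x y w) (r z w x) (r z w y) (n x z) (n x w) (n y z) (n y w); do 8!case.
have {}nC x y : x != y -> n y x = xorb true (n x y).
  by move/nC=> ->; case: (n x y).
move: U; rewrite /= !inE !negb_or !andbT => /and4P[/and4P[Uab Uac Uad Uaf] /and3P[Ubc Ubd Ubf] /andP[Ucd Ucf] Udf].
have U x y z w : x != y -> x != z -> x != w -> y != z -> y != w -> z != w -> uniq [:: x; y; z; w].
  by rewrite /= !inE !negb_or => -> -> -> -> -> ->.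
have E1 := rE a b c d ltac:(by apply: U; rewrite // eq_sym) ab cd.
have E2 := rE a b c f ltac:(by apply: U; rewrite // eq_sym) ab cf.
have E3 := rE a b d f ltac:(by apply: U; rewrite // eq_sym) ab df.
have E4 := rE a c b d ltac:(by apply: U; rewrite // eq_sym) ac bd.
have E5 := rE a c b f ltac:(by apply: U; rewrite // eq_sym) ac bf.
have E6 := rE a c d f ltac:(by apply: U; rewrite // eq_sym) ac df.
have E7 := rE a d b c ltac:(by apply: U; rewrite // eq_sym) ad bc.
have E8 := rE a d b f ltac:(by apply: U; rewrite // eq_sym) ad bf.
have E9 := rE a d c f ltac:(by apply: U; rewrite // eq_sym) ad cf.
have E10 := rE a f b c ltac:(by apply: U; rewrite // eq_sym) af bc.
have E11 := rE a f b d ltac:(by apply: U; rewrite // eq_sym) af bd.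
have E12 := rE a f c d ltac:(by apply: U; rewrite // eq_sym) af cd.
have E13 := rE b c d f ltac:(by apply: U; rewrite // eq_sym) bc df.
have E14 := rE b d c f ltac:(by apply: U; rewrite // eq_sym) bd cf.
have E15 := rE b f c d ltac:(by apply: U; rewrite // eq_sym) bf cd.
have S x y : x = false -> y = false -> xorb x y = false by move=> -> ->.
have := S _ _ E1 (S _ _ E2 (S _ _ E3 (S _ _ E4 (S _ _ E5 (S _ _ E6 (S _ _ E7
  (S _ _ E8 (S _ _ E9 (S _ _ E10 (S _ _ E11 (S _ _ E12 (S _ _ E13 (S _ _ E14 E15))))))))))))).
rewrite ?(nC _ _ Uab) ?(nC _ _ Uac) ?(nC _ _ Uad) ?(nC _ _ Uaf) ?(nC _ _ Ubc)
  ?(nC _ _ Ubd) ?(nC _ _ Ubf) ?(nC _ _ Ucd) ?(nC _ _ Ucf) ?(nC _ _ Udf).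
match goal with |- ?l = false -> False => have -> : l = true by ring end.
by [].
Qed.

(** There are 18 independent pairs of edges. Each [r] term occurs in exactly two of the identities,
    while the comparisons [n], each written in one order, sum to 1. *)
Lemma z2_planar_K33 (a b c x y z : T) : uniq [:: a; b; c; x; y; z] ->
  e a x -> e a y -> e a z -> e b x -> e b y -> e b z -> e c x -> e c y ->
  e c z -> False.
Proof.
case: e_planar => n [r [nC rE]] U ax ay az bx by_ bz cx cy cz.
have {}rE s t u v : uniq [:: s; t; u; v] -> e s t -> e u v ->
    xorb (xorb (xorb (r s t u) (r s t v)) (xorb (r u v s) (r u v t)))
     (xorb (xorb (n s u) (n s v)) (xorb (n t u) (n t v))) = false.
  move=> H1 H2 H3; have /= := rE _ _ _ _ H1 H2 H3.
  move: (r s t u) (r s t v) (r u v s) (r u v t) (n s u) (n s v) (n t u) (n t v).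
  by do 8!case.
have {}nC s t : s != t -> n t s = xorb true (n s t).
  by move/nC=> ->; case: (n s t).
move: U; rewrite /= !inE !negb_or !andbT.
move=> /and5P[/and5P[Uab Uac Uax Uay Uaz] /and4P[Ubc Ubx Uby Ubz] /and3P[Ucx Ucy Ucz] /andP[Uxy Uxz] Uyz].
have U s t u v : s != t -> s != u -> s != v -> t != u -> t != v -> u != v ->
    uniq [:: s; t; u; v].
  by rewrite /= !inE !negb_or => -> -> -> -> -> ->.
have E1 := rE a x b y ltac:(by apply: U; rewrite // eq_sym) ax by_.
have E2 := rE a x b z ltac:(by apply: U; rewrite // eq_sym) ax bz.
have E3 := rE a y b x ltac:(by apply: U; rewrite // eq_sym) ay bx.
have E4 := rE a y b z ltac:(by apply: U; rewrite // eq_sym) ay bz.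
have E5 := rE a z b x ltac:(by apply: U; rewrite // eq_sym) az bx.
have E6 := rE a z b y ltac:(by apply: U; rewrite // eq_sym) az by_.
have E7 := rE a x c y ltac:(by apply: U; rewrite // eq_sym) ax cy.
have E8 := rE a x c z ltac:(by apply: U; rewrite // eq_sym) ax cz.
have E9 := rE a y c x ltac:(by apply: U; rewrite // eq_sym) ay cx.
have E10 := rE a y c z ltac:(by apply: U; rewrite // eq_sym) ay cz.
have E11 := rE a z c x ltac:(by apply: U; rewrite // eq_sym) az cx.
have E12 := rE a z c y ltac:(by apply: U; rewrite // eq_sym) az cy.
have E13 := rE b x c y ltac:(by apply: U; rewrite // eq_sym) bx cy.
have E14 := rE b x c z ltac:(by apply: U; rewrite // eq_sym) bx cz.
have E15 := rE b y c x ltac:(by apply: U; rewrite // eq_sym) by_ cx.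
have E16 := rE b y c z ltac:(by apply: U; rewrite // eq_sym) by_ cz.
have E17 := rE b z c x ltac:(by apply: U; rewrite // eq_sym) bz cx.
have E18 := rE b z c y ltac:(by apply: U; rewrite // eq_sym) bz cy.
have S s t : s = false -> t = false -> xorb s t = false by move=> -> ->.
have := S _ _ E1 (S _ _ E2 (S _ _ E3 (S _ _ E4 (S _ _ E5 (S _ _ E6 (S _ _ E7
  (S _ _ E8 (S _ _ E9 (S _ _ E10 (S _ _ E11 (S _ _ E12 (S _ _ E13 (S _ _ E14
  (S _ _ E15 (S _ _ E16 (S _ _ E17 E18)))))))))))))))).
rewrite ?(nC _ _ Uab) ?(nC _ _ Uac) ?(nC _ _ Uax) ?(nC _ _ Uay) ?(nC _ _ Uaz)
  ?(nC _ _ Ubc) ?(nC _ _ Ubx) ?(nC _ _ Uby) ?(nC _ _ Ubz) ?(nC _ _ Ucx) ?(nC _ _ Ucy)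
  ?(nC _ _ Ucz) ?(nC _ _ Uxy) ?(nC _ _ Uxz) ?(nC _ _ Uyz).
match goal with |- ?l = false -> False => have -> : l = true by ring end.
by [].
Qed.
End Kuratowski.

(** * Edge bounds for planar graphs *)

Section Degrees.
Variable T : finType.
Implicit Types (e f : rel T) (U : {set T}).

Definition nbr e U x : {set T} := [set y in U | e x y].

Definition degsum e U : nat := \sum_(x in U) #|nbr e U x|.

Lemma in_nbr e U x y : (y \in nbr e U x) = (y \in U) && e x y.
Proof. by rewrite inE. Qed.

(** Removing an edge inside [U] lowers [degsum], twice the number of edges, by two. So a graph
    violating an edge bound can be made to violate it only barely. *)
Lemma trim_edges e U k : symmetric e -> irreflexive e -> k <= degsum e U ->
  exists f, [/\ symmetric f, irreflexive f, subrel f e & k <= degsum f U <= k.+1].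
Proof.
move: {2}(degsum e U) (leqnn (degsum e U)) => n.
elim: n e => [|n IH] e en e_sym e_irr ke.
  by exists e; split=> //; lia.
have [le_ek|lt_ke] := leqP (degsum e U) k.+1; first by exists e; split=> //; lia.
have /exists_inP[a aU /existsP[b]] : [exists a in U, exists b, b \in nbr e U a].
  apply: contraTT lt_ke; rewrite negb_exists_in => /forall_inP H.
  rewrite -leqNgt /degsum big1 // => x xU; apply/eqP; rewrite cards_eq0.
  by apply/eqP/setP => y; have := H _ xU; rewrite negb_exists => /forallP/(_ y)/negPf->; rewrite inE.
rewrite in_nbr => /andP[bU eab].
have ab : a != b by apply: contraTneq eab => ->; rewrite e_irr.
pose f x y := e x y && ~~ ((x == a) && (y == b) || (x == b) && (y == a)).
have fsub : subrel f e by move=> x y /andP[].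
have fsym : symmetric f by move=> x y; rewrite /f e_sym orbC ![(y == _) && _]andbC.
have dfe : degsum e U = (degsum f U).+2.
  rewrite /degsum (bigD1 a) //= (bigD1 b) /=; last by rewrite bU eq_sym.
  rewrite [in RHS](bigD1 a) //= [in RHS](bigD1 b) /=; last by rewrite bU eq_sym.
  have -> : nbr e U a = b |: nbr f U a.
    apply/setP => y; rewrite !inE /f eqxx.
    by case: (eqVneq y b) => [->|]; rewrite ?bU ?eab ?(negPf ab) ?andbT.
  have -> : nbr e U b = a |: nbr f U b.
    apply/setP => y; rewrite !inE /f eqxx [b == a]eq_sym.
    by case: (eqVneq y a) => [->|]; rewrite ?aU ?(e_sym b) ?eab ?(negPf ab) ?andbT.
  rewrite !cardsU1 !inE /f !eqxx !andbF /= orbT !andbF /= !add1n.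
  rewrite (eq_bigr (fun x => #|nbr f U x|)); first by rewrite addSn addnS.
  move=> x /andP[/andP[_ /negPf xa] /negPf xb]; congr #|pred_of_set _|.
  by apply/setP => y; rewrite !inE /f xa xb andbT.
have [g [gsym girr gsub kg]] : exists g, [/\ symmetric g, irreflexive g, subrel g f & k <= degsum g U <= k.+1].
  by apply: IH => //; try lia; move=> x; apply: contraFF (e_irr x) => /fsub.
by exists g; split=> // x y /gsub/fsub.
Qed.

Lemma degsumD1 e U v : symmetric e -> irreflexive e -> v \in U ->
  degsum e U = degsum e (U :\ v) + 2 * #|nbr e U v|.
Proof.
move=> e_sym e_irr vU; rewrite /degsum (big_setD1 v vU) /=.
have -> : \sum_(x in U :\ v) #|nbr e U x| =
    \sum_(x in U :\ v) #|nbr e (U :\ v) x| + \sum_(x in U :\ v) (e v x : nat).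
  rewrite -big_split /=; apply: eq_bigr => x; rewrite !inE => /andP[xv xU].
  have -> : nbr e (U :\ v) x = nbr e U x :\ v by apply/setP => y; rewrite !inE andbA.
  by rewrite (cardsD1 v (nbr e U x)) in_nbr vU e_sym addnC.
suff -> : \sum_(x in U :\ v) (e v x : nat) = #|nbr e U v| by lia.
rewrite -sum1_card big_mkcond /= [RHS]big_mkcond /=.
apply: eq_bigr => x _; rewrite !inE.
by case: eqVneq => [->|_]; rewrite ?e_irr ?andbF //=; case: (x \in U) => //=; case: (e v x).
Qed.

(** [v] is merged into [u]; the vertex type is kept and [v] becomes isolated. *)
Definition contract e u v : rel T := fun x y =>
  [&& x != v, y != v, x != y & [|| e x y, (x == u) && e v y | (y == u) && e v x]].

Lemma contract_sym e u v : symmetric e -> symmetric (contract e u v).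
Proof.
move=> e_sym x y; rewrite /contract (e_sym x y) (eq_sym x y).
by case: (x != v); case: (y != v) => //=; rewrite [X in _ && (_ || X)]orbC.
Qed.

Lemma contract_irr e u v : irreflexive (contract e u v).
Proof. by move=> x; rewrite /contract eqxx !andbF. Qed.

(** An edge of the contraction that is not in [e] ends at [u] and stands for a walk through [v]. Two
    independent edges do not both end at [u], so their walks are disjoint. *)
Lemma z2_planar_contract e u v : symmetric e -> irreflexive e -> e u v ->
  z2_planar e -> z2_planar (contract e u v).
Proof.
move=> e_sym e_irr euv e_planar.
pose w x y := if e x y then [:: y] else [:: v; y].
apply: (z2_planar_minor e_irr (w := w)) e_planar _ _.
  move=> x y /and4P[xv yv xy]; rewrite /w; case: ifP => [exy _|nexy /=].
    by rewrite /= exy.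
  case/orP=> /andP[/eqP-> ev]; first by rewrite /= euv ev.
  by rewrite /= e_sym ev e_sym euv.
move=> x y z t /= U fxy fzt a.
have wv x1 y1 : contract e u v x1 y1 -> v \in x1 :: w x1 y1 -> (u == x1) || (u == y1).
  move=> /and4P[xv yv _ +]; rewrite /w; case: ifP => [_ _|_ /=].
    by rewrite !inE ![v == _]eq_sym (negPf xv) (negPf yv).
  by case/orP=> /andP[/eqP-> _] _; rewrite eqxx ?orbT.
have wE x1 y1 b : b \in x1 :: w x1 y1 -> [|| b == x1, b == y1 | b == v].
  by rewrite /w; case: ifP => _; rewrite !inE; case: (b == x1); case: (b == y1); case: (b == v).
have U4 c : ((c == x) || (c == y)) -> ((c == z) || (c == t)) -> False.
  move: U; rewrite !inE !negb_or => /and4P[/and3P[_ xz xt] /andP[yz yt] _ _].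
  by move=> /orP[]/eqP-> /orP[]/eqP Ec; move: xz xt yz yt; rewrite -?Ec ?eqxx.
move: (fxy) (fzt) => /and4P[xv yv _ _] /and4P[zv tv _ _].
move=> /[dup] axy /wE aE; apply/negP => /[dup] azt /wE aE'.
case: (eqVneq a v) aE aE' axy azt => [->|av]; last first.
  by rewrite !orbF => h1 h2; case: (U4 a).
by move=> _ _ /(wv _ _ fxy) h1 /(wv _ _ fzt) h2; case: (U4 u).
Qed.

(** Merging loses the edge itself and, for each common neighbour, one of its two edges. *)
Lemma degsum_contract e U u v : symmetric e -> irreflexive e ->
    u \in U -> v \in U -> e u v ->
  degsum e U <= degsum (contract e u v) (U :\ v) + 2 + 2 * #|nbr e U u :&: nbr e U v|.
Proof.
move=> e_sym e_irr uU vU euv; set t := #|_|; set f := contract e u v.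
have uv : u != v by apply: contraTneq euv => ->; rewrite e_irr.
have uU' : u \in U :\ v by rewrite !inE uv.
rewrite /degsum (big_setD1 v vU) /= (big_setD1 u uU') /= [X in _ <= X + _ + _](big_setD1 u uU') /=.
set U' := U :\ v :\ u.
have H1 : #|nbr e U u| + #|nbr e U v| <= #|nbr f (U :\ v) u| + 2 + t.
  rewrite -cardsUI -/t leq_add2r.
  apply: leq_trans (_ : #|nbr f (U :\ v) u :|: [set u; v]| <= _).
    apply: subset_leq_card; apply/subsetP => y; rewrite !inE /f /contract eqxx uv /=.
    case: (eqVneq y u) => [->|yu]; rewrite ?orbT //=.
    case: (eqVneq y v) => [->|yv]; rewrite ?orbT //= orbF.
    by case: (y \in U) => //=; rewrite orbF.
  by rewrite (leq_trans (leq_card_setU _ _)) // leq_add2l cards2; case: (_ != _).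
have H2 : \sum_(x in U') #|nbr e U x| <= \sum_(x in U') #|nbr f (U :\ v) x| + t.
  have -> : t = \sum_(x in U') (e u x && e v x : nat).
    rewrite /t -sum1_card big_mkcond /= [RHS]big_mkcond /=; apply: eq_bigr => x _.
    rewrite !inE; case: (eqVneq x u) => [->|]; first by rewrite e_irr andbF.
    case: (eqVneq x v) => [->|]; first by rewrite e_irr !andbF.
    by case: (x \in U) => //= _ _; case: (e u x && e v x).
  rewrite -big_split /=; apply: leq_sum => x; rewrite !inE => /and3P[xu xv xU].
  have := cardsD1 v (nbr e U x); have := cardsD1 u (nbr e U x :\ v); rewrite !inE uv uU vU /= => -> ->.
  have : (nbr e U x :\ v :\ u) \subset nbr f (U :\ v) x :\ u.
    apply/subsetP => y; rewrite !inE /f /contract xv => /and4P[-> -> -> exy] /=.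
    by rewrite exy /= andbT; apply: contraTneq exy => ->; rewrite e_irr.
  move=> /subset_leq_card; have := cardsD1 u (nbr f (U :\ v) x).
  rewrite !inE uU uv /= /f /contract xv uv xu eqxx (negPf xu) /= (e_sym x u) (e_sym x v).
  by case: (e u x); case: (e v x) => /=; lia.
by lia.
Qed.
End Degrees.

(** * At most 3n - 6 edges in a planar graph *)

Section Euler.
Variable T : finType.
Implicit Types (e f : rel T) (U W : {set T}).

Lemma set_seqP W k : #|W| = k -> exists s, [/\ size s = k, uniq s & W =i s].
Proof. by move=> Wk; exists (enum W); rewrite -cardE enum_uniq; split=> // x; rewrite mem_enum. Qed.

(* Four or five vertices, each of which has at least three neighbours among   *)
(* the others, form a graph with a K_4 minor.                                 *)
Lemma wheel_minor_K5 e U v : symmetric e -> irreflexive e -> z2_planar e ->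
    4 <= #|nbr e U v| <= 5 ->
    (forall x, x \in nbr e U v -> 3 <= #|nbr e U v :&: nbr e U x|) -> False.
Proof.
move=> e_sym e_irr e_planar /andP[W4 W5] HW; set W := nbr e U v in W4 W5 HW.
have vW x : x \in W -> e v x by rewrite inE => /andP[].
have vx x : x \in W -> v != x by move/vW; apply: contraTneq => ->; rewrite e_irr.
have nW x (S : {set T}) : x \in W -> S \subset W :\ x -> (forall y, y \in S -> ~~ e x y) ->
    #|S| + 4 <= #|W|.
  move=> xW SW nS; have H3 := HW x xW; rewrite (cardsD1 x W) xW.
  have : (W :&: nbr e U x) \subset (W :\ x) :\: S.
    apply/subsetP => y; rewrite in_setI in_setD in_setD1 in_nbr.
    move=> /andP[-> /andP[_ exy]]; rewrite (contraL (nS y)) //= andbT.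
    by apply: contraTneq exy => ->; rewrite e_irr.
  by move=> /subset_leq_card; rewrite cardsD (setIidPr SW); have := subset_leq_card SW; lia.
have [E4|E5] : #|W| = 4 \/ #|W| = 5 by lia.
  have [s [sz s_uniq Ws]] := set_seqP E4.
  case: s sz s_uniq Ws => [|a [|b [|c [|d [|? ?]]]]] // _ s_uniq Ws.
  have adj x y : x \in W -> y \in W -> x != y -> e x y.
    move=> xW yW xy; apply/negPn/negP => nxy.
    have sub : [set y] \subset W :\ x by rewrite sub1set in_setD1 eq_sym xy yW.
    have : forall z, z \in [set y] -> ~~ e x z by move=> z; rewrite inE => /eqP->.
    by move=> /(nW x _ xW sub); rewrite cards1 E4.
  have inW x : x \in [:: a; b; c; d] -> x \in W by rewrite Ws.
  move: (s_uniq); rewrite /= !inE !negb_or !andbT => /and3P[/and3P[ab ac ad] /andP[bc bd] cd].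
  have [aW bW cW dW] : [/\ a \in W, b \in W, c \in W & d \in W].
    by split; apply: inW; rewrite !inE eqxx ?orbT.
  apply: (@z2_planar_K5 _ _ e_planar v a b c d); rewrite ?vW ?adj //.
  by rewrite cons_uniq s_uniq !inE !negb_or !vx.
have adj x y z : x \in W -> y \in W -> z \in W -> uniq [:: x; y; z] -> e x y || e x z.
  move=> xW yW zW; rewrite /= !inE !negb_or andbT => /andP[/andP[xy xz] yz].
  apply/negPn/negP; rewrite negb_or => /andP[nxy nxz].
  have sub : [set y; z] \subset W :\ x.
    by rewrite subUset !sub1set !in_setD1 ![_ == x]eq_sym xy xz yW zW.
  have : forall t, t \in [set y; z] -> ~~ e x t by move=> t; rewrite !inE => /orP[]/eqP->.
  by move=> /(nW x _ xW sub); rewrite cards2 yz E5.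
(* With five neighbours each misses at most one other. If [p q] and [r s] are both missing,
   contracting [p r] makes [v], [p], [q], [s], [t] a K_5. *)
have core p q r s t : uniq [:: p; q; r; s; t] -> {subset [:: p; q; r; s; t] <= W} ->
    ~~ e p q -> ~~ e r s -> False.
  move=> U5 sW npq nrs.
  have [pW qW rW sW' tW] : [/\ p \in W, q \in W, r \in W, s \in W & t \in W].
    by split; apply: sW; rewrite !inE eqxx ?orbT.
  move: (U5); rewrite /= !inE !negb_or !andbT.
  move=> /and4P[/and4P[pq pr ps pt] /and3P[qr qs qt] /andP[rs rt] st].
  have E x y z : x \in W -> y \in W -> z \in W -> ~~ e x y -> x != y -> x != z -> y != z -> e x z.
    move=> xW yW zW nxy xy xz yz; have := @adj x y z xW yW zW.
    by rewrite /= !inE !negb_or xy xz yz (negPf nxy); apply.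
  have nqp : ~~ e q p by rewrite e_sym.
  have nsr : ~~ e s r by rewrite e_sym.
  have epr : e p r by apply: (E p q r).
  have ctr x y : x != r -> y != r -> x != y -> [|| e x y, (x == p) && e r y | (y == p) && e r x] ->
    contract e p r x y by rewrite /contract => -> -> ->.
  have [qr' tr sr] : [/\ q != r, t != r & s != r] by rewrite ![_ == r]eq_sym rs rt eq_sym.
  have vr := vx r rW.
  apply: (@z2_planar_K5 _ (contract e p r) _ v p q s t); rewrite ?ctr ?vx ?vW ?eqxx //.
  - exact: z2_planar_contract.
  - move: U5; rewrite /= !inE !negb_or !vx //= => /andP[/and4P[-> _ -> ->]] /andP[/and3P[_ -> ->]].
    by move=> /andP[_ ->].
  - by rewrite (E r s q) ?orbT // eq_sym.
  - by rewrite (E p q s).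
  - by rewrite (E p q t).
  - by rewrite (E q p s) // eq_sym.
  - by rewrite (E q p t) // eq_sym.
  - by rewrite (E s r t) // eq_sym.
have [s [sz U5 Ws]] := set_seqP E5.
case: s sz U5 Ws => [|a [|b [|c [|d [|f [|? ?]]]]]] // _ U5 Ws.
have sub5 s : size s = 5 -> {subset [:: a; b; c; d; f] <= s} -> uniq s.
  by move=> s5 ss; apply: leq_size_uniq U5 ss _; rewrite s5.
have inW : [/\ a \in W, b \in W, c \in W, d \in W & f \in W].
  by split; rewrite Ws !inE eqxx ?orbT.
have perm p q r s t p' q' r' s' t' : {subset [:: p; q; r; s; t] <= [:: p'; q'; r'; s'; t']} ->
    {subset [:: a; b; c; d; f] <= [:: p; q; r; s; t]} ->
    {subset [:: a; b; c; d; f] <= [:: p'; q'; r'; s'; t']}.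
  by move=> H1 H2 x /H2/H1.
have sub_in p q r s t : {subset [:: a; b; c; d; f] <= [:: p; q; r; s; t]} ->
    uniq [:: p; q; r; s; t] /\ {subset [:: p; q; r; s; t] <= W}.
  move=> H; split; first exact: sub5.
  move=> x; have [_ E] := uniq_min_size U5 H isT; by rewrite -E Ws.
have swap x p q r s t : (x \in [:: p; q; r; s; t]) = (x \in [:: p; q; s; t; r]).
  by rewrite !inE; do 5!case: (x == _).
have core' p q r s t : {subset [:: a; b; c; d; f] <= [:: p; q; r; s; t]} ->
    ~~ e p q -> e r s.
  move=> /sub_in[U' sW] npq; apply/negPn/negP; exact: (core p q r s t U' sW npq).
(* If [p q] is missing, then by [core] no edge among [r], [s], [t] is, and [v], [p], [r], [s], [t]
   form a K_5. *)
have O p q r s t : {subset [:: a; b; c; d; f] <= [:: p; q; r; s; t]} -> e p q.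
  move=> H; apply/negPn/negP => npq; have [U' sW] := sub_in _ _ _ _ _ H.
  have [pW qW rW sW' tW] : [/\ p \in W, q \in W, r \in W, s \in W & t \in W].
    by split; apply: sW; rewrite !inE eqxx ?orbT.
  move: (U'); rewrite /= !inE !negb_or !andbT.
  move=> /and4P[/and4P[pq pr ps pt] /and3P[qr qs qt] /andP[rs rt] st].
  have E z : z \in W -> p != z -> q != z -> e p z.
    move=> zW pz qz; have := @adj p q z pW qW zW.
    by rewrite /= !inE !negb_or pq pz qz (negPf npq); apply.
  have ers := core' _ _ _ _ _ H npq.
  have est : e s t by apply: (core' p q s t r) npq; apply: perm H => x; rewrite swap.
  have etr : e t r.
    by apply: (core' p q t r s) npq; apply: perm H => x; rewrite -swap.
  apply: (@z2_planar_K5 _ _ e_planar v p r s t); rewrite ?vW ?E // 1?e_sym //.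
  by rewrite /= !inE !negb_or !vx // pr ps pt rs rt st.
apply: (@z2_planar_K5 _ _ e_planar v a b c d); case: inW => aW bW cW dW fW; rewrite ?vW //.
  rewrite cons_uniq !inE !negb_or !vx //=.
  by move: U5; rewrite -[[:: a; b; c; d; f]]/([:: a; b; c; d] ++ [:: f]) cat_uniq => /andP[].
- exact: (O a b c d f).
- by apply: (O a c b d f) => x; rewrite !inE; do 5!case: (x == _).
- by apply: (O a d b c f) => x; rewrite !inE; do 5!case: (x == _).
- by apply: (O b c a d f) => x; rewrite !inE; do 5!case: (x == _).
- by apply: (O b d a c f) => x; rewrite !inE; do 5!case: (x == _).
- by apply: (O c d a b f) => x; rewrite !inE; do 5!case: (x == _).
Qed.

(** A smallest counterexample is trimmed to barely too many edges. By induction, deleting a vertex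
    or contracting an edge then destroys at least four edges: all degrees are at least 4, and
    adjacent vertices have at least three common neighbours. Some vertex has degree at most 5, and
    [wheel_minor_K5] applies to it. *)
Lemma euler_bound e U : symmetric e -> irreflexive e -> z2_planar e ->
  3 <= #|U| -> degsum e U + 12 <= 6 * #|U|.
Proof.
move: {2}#|U| (leqnn #|U|) => n; elim: n e U => [|n IH] e U Un e_sym e_irr e_planar U3.
  lia.
have [/eqP U3'|U4] := leqP #|U| 3.
  have : degsum e U <= \sum_(x in U) 2.
    apply: leq_sum => x xU; have := cardsD1 x U; rewrite xU.
    have : nbr e U x \subset U :\ x.
      apply/subsetP => y; rewrite !inE => /andP[-> exy]; rewrite andbT.
      by apply: contraTneq exy => ->; rewrite e_irr.
    by move=> /subset_leq_card; lia.
  by rewrite sum_nat_const; lia.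
rewrite leqNgt; apply/negP => big.
have [f [f_sym f_irr fe /andP[lo hi]]] := @trim_edges T e U (6 * #|U| - 11) e_sym e_irr ltac:(lia).
have f_planar := sub_z2_planar fe e_planar.
have cardU v : v \in U -> #|U :\ v| = #|U|.-1.
  by move=> vU; have := cardsD1 v U; rewrite vU; lia.
have deg4 v : v \in U -> 4 <= #|nbr f U v|.
  move=> vU; have := IH f (U :\ v); rewrite cardU // => IHv.
  have := degsumD1 f_sym f_irr vU; have := IHv ltac:(lia) f_sym f_irr f_planar ltac:(lia).
  by lia.
have tri u v : u \in U -> v \in U -> f u v -> 3 <= #|nbr f U u :&: nbr f U v|.
  move=> uU vU fuv; have := IH (contract f u v) (U :\ v).
  rewrite cardU // => /(_ ltac:(lia) (contract_sym _ _ f_sym) (@contract_irr _ _ _ _)).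
  move=> /(_ (z2_planar_contract f_sym f_irr fuv f_planar) ltac:(lia)).
  by have := degsum_contract f_sym f_irr uU vU fuv; lia.
have [v vU v5] : exists2 v, v \in U & #|nbr f U v| <= 5.
  apply/exists_inP; apply: contraTT hi => /exists_inPn H.
  rewrite -ltnNge; apply: leq_trans (_ : \sum_(x in U) 6 <= _).
    by rewrite sum_nat_const; lia.
  by apply: leq_sum => x /H; rewrite -ltnNge.
apply: (@wheel_minor_K5 f U v) => //; first by rewrite deg4.
by move=> x; rewrite in_nbr => /andP[xU fvx]; apply: tri.
Qed.
End Euler.

Ltac nat_fact P :=
  lazymatch P with
  | is_true (leq _ _) => idtac
  | is_true (andb (leq _ _) (leq _ _)) => idtac
  | @eq nat _ _ => idtac
  | ~ (@eq nat _ _) => idtac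
  | or (@eq nat _ _) _ => idtac
  end.

(* [lia] diverges in contexts full of boolean hypotheses, and it does not     *)
(* identify cardinals which are only convertible.                             *)
Ltac slia :=
  repeat match goal with
  | H : ?P |- _ => lazymatch type of P with
                   | Prop => tryif nat_fact P then revert H else clear H
                   end
  end;
  repeat (let n := fresh "n" in set n := #|_|; clearbody n);
  lia.

(** The edges at the sixth vertex [r] of a K_{3,3} are replaced by walks. These may meet one
    another, because two edges at [r] are never independent. *)
Lemma z2_planar_K33_paths (T : finType) (e : rel T) (a b c x y r : T) (sa sb sc : seq T) :
    irreflexive e -> z2_planar e -> uniq [:: a; b; c; x; y] ->
    e a x -> e a y -> e b x -> e b y -> e c x -> e c y ->
    path e a sa -> last a sa = r -> path e b sb -> last b sb = r ->
    path e c sc -> last c sc = r ->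
    (forall z, z \in r :: sa ++ sb ++ sc -> z \notin [:: a; b; c; x; y]) -> False.
Proof.
move=> e_irr e_planar U5 ax ay bx by_ cx cy pa la pb lb pc lc out.
have rout := out r (mem_head _ _).
pose f u v := (u \in [:: a; b; c]) && (v \in [:: x; y; r]).
pose s u := if u == a then sa else if u == b then sb else sc.
pose w u v := if v == r then s u else [:: v].
have sub_s u z : z \in s u -> z \in r :: sa ++ sb ++ sc.
  by rewrite inE !mem_cat /s; case: ifP => _; [|case: ifP => _] => ->; rewrite ?orbT.
have U6 : uniq [:: a; b; c; x; y; r].
  by rewrite -[[:: a; b; c; x; y; r]]/(rcons [:: a; b; c; x; y] r) rcons_uniq rout.
apply: (@z2_planar_K33 T f _ a b c x y r) => //; rewrite /f ?inE ?eqxx ?orbT //.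
have sP u : u \in [:: a; b; c] -> path e u (s u) /\ last u (s u) = r.
  rewrite /s; case: eqVneq => [->|ua] //; case: eqVneq => [->|ub] //.
  by rewrite !inE (negPf ua) (negPf ub) /= => /eqP->.
have abc u : u \in [:: a; b; c] -> u \in [:: a; b; c; x; y].
  by rewrite !inE; do 3!case: (u == _).
have xyr v : v \in [:: x; y; r] -> v != r -> v \in [:: a; b; c; x; y].
  by rewrite !inE; do 3!case: (v == _); rewrite ?orbT.
apply: (@z2_planar_minor T e e_irr f w) => //.
  move=> u v /andP[/[dup] uabc /sP[pu lu]]; rewrite /w; case: eqVneq => [-> //|vr] vxyr.
  have {}vxyr : v \in [:: x; y] by move: vxyr; rewrite !inE (negPf vr) orbF.
  split=> //=; rewrite andbT.
  move: uabc vxyr; rewrite !inE.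
  by move=> /or3P[]/eqP-> /orP[]/eqP->.
move=> u v u' v' /= U4 /andP[uabc vxyr] /andP[u'abc v'xyr] z.
have /and4P[uu' [uv' [vu' vv']]] : [&& u != u', u != v', v != u' & v != v'].
  by move: U4; rewrite !inE !negb_or => /and4P[/and3P[_ -> ->] /andP[-> ->] _ _].
rewrite !inE /w; case: (eqVneq v r) => [vr|vr]; case: (eqVneq v' r) => [v'r|v'r].
- by rewrite vr v'r eqxx in vv'.
- rewrite mem_seq1 => /orP[/eqP->|/sub_s/out zout]; first by rewrite negb_or uu' uv'.
  rewrite negb_or; apply/andP; split; apply: contraNneq zout => ->; [exact: abc|exact: xyr].
- rewrite mem_seq1 => /orP[]/eqP->; rewrite negb_or ?uu' ?vu' /=; apply/negP => /sub_s/out.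
    by rewrite abc.
  by rewrite xyr.
- by rewrite !mem_seq1 => /orP[]/eqP->; rewrite negb_or ?uu' ?vu' ?uv' ?vv'.
Qed.

(** * At most 2n - 4 edges in a bipartite planar graph *)

Section Bipartite.
Variables (T : finType) (f : rel T) (A U : {set T}).
Hypotheses (f_sym : symmetric f) (f_planar : z2_planar f).
Hypothesis f_bip : forall x y, f x y -> (x \in A) != (y \in A).
Let f_irr : irreflexive f.
Proof. by move=> x; apply/negP => /f_bip; rewrite eqxx. Qed.

Hypothesis f_supp : forall x y, f x y -> y \in U.
Local Notation N := (nbr f U).

Let NE x y : (y \in N x) = f x y.
Proof. by rewrite in_nbr; case fxy: (f x y); rewrite ?andbF // (f_supp fxy). Qed.

Let side x y z : f x z -> f y z -> (x \in A) = (y \in A).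
Proof. by move=> /f_bip + /f_bip; case: (x \in A); case: (y \in A); case: (z \in A). Qed.

Let notri x y z : f x y -> f y z -> f x z -> False.
Proof.
move=> /f_bip + /f_bip + /f_bip; case: (x \in A); case: (y \in A); by case: (z \in A).
Qed.

Let neq x y z : f x z -> ~~ f y z -> x != y.
Proof. by move=> h; apply: contraNneq => <-. Qed.

Let adj_neq x y : f x y -> x != y.
Proof. by apply: contraTneq => ->; rewrite f_irr. Qed.

Let tri_neq x y z w : f x y -> f x z -> f w y -> w != z.
Proof.
move=> xy xz wy; apply/eqP => Ewz; rewrite Ewz in wy.
by apply: (notri xz wy).
Qed.

Lemma card_set3 (S : {set T}) x y z : S \subset [set x; y; z] -> 3 <= #|S| -> S = [set x; y; z].
Proof.
move=> sS S3; apply/eqP; rewrite eqEcard sS (leq_trans _ S3) //.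
rewrite (leq_trans (leq_card_setU _ _)) // cards1 cards2 addn1 ltnS.
by case: (_ != _).
Qed.

Let uniq5 a b c x y : uniq [:: a; b; c] -> x != y ->
  f a x -> f a y -> f b x -> f c x -> uniq [:: a; b; c; x; y].
Proof.
move=> Uabc xy ax ay bx cx; rewrite -[[:: a; b; c; x; y]]/([:: a; b; c] ++ [:: x; y]).
rewrite cat_uniq Uabc /= mem_seq1 xy /= orbF andbT negb_or.
have sa u v : u \in [:: a; b; c] -> v \in [:: x; y] -> v != u.
  move=> uabc vxy; apply/eqP => Euv; have := f_bip ax.
  have -> : (a \in A) = (u \in A).
    by move: uabc; rewrite !inE => /or3P[]/eqP-> //; apply: (side (z := x)).
  have -> : (x \in A) = (v \in A).
    by move: vxy; rewrite !inE => /orP[]/eqP-> //; apply: (side (z := a)); rewrite f_sym.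
  by rewrite Euv eqxx.
by apply/andP; split; apply/negP => /sa; [move=> /(_ x)|move=> /(_ y)]; rewrite !inE !eqxx ?orbT => /(_ isT).
Qed.

Let K33_paths a b c x y r sa sb sc : uniq [:: a; b; c] -> x != y ->
    f a x -> f a y -> f b x -> f b y -> f c x -> f c y ->
    path f a sa -> last a sa = r -> path f b sb -> last b sb = r ->
    path f c sc -> last c sc = r ->
    (forall z, z \in r :: sa ++ sb ++ sc -> z \notin [:: a; b; c; x; y]) -> False.
Proof.
move=> Uabc xy ax ay bx by_ cx cy.
by apply: (@z2_planar_K33_paths T f a b c x y) => //; apply: uniq5.
Qed.

Lemma codeg3_False a b c : uniq [:: a; b; c] -> 3 <= #|N a :&: N b :&: N c| -> False.
Proof.
move=> Uabc; set S := _ :&: _ => S3.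
have [x xS] : exists x, x \in S by apply/card_gt0P; apply: leq_trans S3.
have [y] : exists y, y \in S :\ x by apply/card_gt0P; have := cardsD1 x S; rewrite xS; slia.
rewrite in_setD1 => /andP[yx yS].
have [z] : exists z, z \in S :\ x :\ y.
  apply/card_gt0P; have := cardsD1 x S; have := cardsD1 y (S :\ x).
  by rewrite in_setD1 xS yx yS; slia.
rewrite !in_setD1 => /and3P[zy zx zS].
have adj u : u \in S -> [/\ f a u, f b u & f c u] by rewrite !in_setI !NE => /andP[/andP[]].
have [ax bx cx] := adj _ xS; have [ay by_ cy] := adj _ yS; have [az bz cz] := adj _ zS.
apply: (@K33_paths a b c x y z [:: z] [:: z] [:: z]); rewrite /= ?az ?bz ?cz // 1?eq_sym //.
have := uniq5 Uabc (_ : y != z); rewrite eq_sym => /(_ zy ay az by_ cy).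
rewrite /= !inE !negb_or !andbT => /and4P[/and4P[_ _ _ az'] /and3P[_ _ bz'] /andP[_ cz'] yz].
move=> u; rewrite !inE !orbb => /eqP->; rewrite !negb_or ![z == _]eq_sym az' bz' cz' yz.
by rewrite eq_sym zx.
Qed.

Lemma deg3P t a : #|N t| = 3 -> f t a ->
  exists p q, uniq [:: a; p; q] /\ N t = [set a; p; q].
Proof.
move=> t3; rewrite -NE => ta; have := cardsD1 a (N t); rewrite ta t3 => t2.
have /eqP/cards2P[p [q [pq E]]] : #|N t :\ a| = 2 by slia.
exists p, q.
have pE z : (z \in N t :\ a) = (z == p) || (z == q) by rewrite E !inE.
have := pE p; have := pE q; rewrite !in_setD1 !eqxx orbT => /andP[qa _] /andP[pa _].
rewrite /= !inE !negb_or ![a == _]eq_sym pa qa pq; split=> //.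
apply/setP => z; have := pE z; rewrite in_setD1 !in_setU !in_set1 -orbA => <-.
by case: eqVneq => [->|_].
Qed.

Hypothesis min_deg : forall x, x \in U -> 3 <= #|N x|.
(** Deleting [t] and merging [a] with [b] loses [#|N t| + #|N a :&: N b| - 1] edges; in a smallest
    too dense graph this must be at least five. *)
Hypothesis no_contraction : forall t a b, f t a -> f t b -> a != b ->
  6 <= #|N t| + #|N a :&: N b|.

Let missed a b c : uniq [:: a; b; c] -> #|N a| = 4 ->
    3 <= #|N a :&: N b| -> 3 <= #|N a :&: N c| ->
  exists z, [/\ f a z, f c z & ~~ f b z].
Proof.
move=> Uabc a4 ab ac; have [/subsetP sab|] := boolP (N a :&: N c \subset N b).
  case: (codeg3_False Uabc); apply: leq_trans ac _; apply: subset_leq_card.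
  apply/subsetP => z zac; move: (zac) (sab _ zac); rewrite !in_setI.
  by move=> /andP[-> ->] ->.
by case/subsetPn => z; rewrite in_setI !NE => /andP[az cz] bz; exists z.
Qed.

(** Let N(t) = {a, p, q}. By [no_contraction], [a] shares three neighbours with [p] and three with
    [q]. If d(a) = 3, these are all of N(a), which gives a K_{3,3}. If d(a) = 4, there are x
    adjacent to a and p, z adjacent to a and q, and y other than t adjacent to all three; a common
    neighbour w of x and z gives a K_{3,3} with sides a, p, q and t, y, w, where w is reached
    through x and z. *)
Lemma deg3_nbr_ge5 t a : #|N t| = 3 -> f t a -> 5 <= #|N a|.
Proof.
move=> t3 ta; have [p [q [Uapq Nt]]] := deg3P t3 ta.
have ntE x : f t x = [|| x == a, x == p | x == q] by rewrite -NE Nt !inE orbA.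
have [tp tq] : f t p /\ f t q by rewrite !ntE !eqxx !orbT.
move: (Uapq); rewrite /= !inE !negb_or !andbT => /andP[/andP[ap aq] pq].
have cap := no_contraction ta tp ap; have caq := no_contraction ta tq aq.
rewrite t3 in cap caq; have {}cap : 3 <= #|N a :&: N p| by slia.
have {}caq : 3 <= #|N a :&: N q| by slia.
have aU := f_supp ta; rewrite leqNgt; apply/negP; rewrite ltnS => a4.
have le_pq : #|N a :&: N p :&: N q| <= 2.
  by rewrite leqNgt; apply/negP => /(codeg3_False Uapq).
have [a3|a4'] : #|N a| = 3 \/ #|N a| = 4 by have := min_deg aU; slia.
  have sub b : 3 <= #|N a :&: N b| -> N a \subset N b.
    move=> h; apply/setIidPl/eqP; rewrite eqEcard subsetIl a3 //.
  move: le_pq; rewrite (setIidPl (sub p cap)) (setIidPl (sub q caq)); slia.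
have [z [az qz pz]] := missed Uapq a4' cap caq.
have [x [ax px qx]] : exists z, [/\ f a z, f p z & ~~ f q z].
  by apply: missed => //; rewrite /= !inE !negb_or aq ap eq_sym pq.
have [y [ay py qy yt]] : exists y, [/\ f a y, f p y, f q y & y != t].
  have : 2 <= #|N a :&: N p :&: N q|.
    have : N a :&: N p :\ x \subset N a :&: N p :&: N q.
      apply/subsetP => y; rewrite in_setD1 !in_setI !NE => /and3P[yx ay py].
      rewrite ay py /=; apply/negPn/negP => qy.
      have : [set x; y] \subset N a :\: (N a :&: N q).
        rewrite subUset !sub1set !in_setD !in_setI !NE ax ay (negPf qx) (negPf qy) //.
      have := cardsID (N q) (N a) => E /subset_leq_card.
      rewrite cards2 (eq_sym x) yx setDIr setDv set0U; slia.
    move=> /subset_leq_card; have := cardsD1 x (N a :&: N p).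
    by rewrite in_setI !NE ax px; slia.
  have := cardsD1 t (N a :&: N p :&: N q); rewrite !in_setI !NE ![f _ t]f_sym ta tp tq /= => E h.
  have /card_gt0P[y] : 0 < #|N a :&: N p :&: N q :\ t| by slia.
  by rewrite !in_setD1 !in_setI !NE => /and3P[yt /andP[ay py] qy]; exists y.
have xz : x != z by apply: contraTneq px => ->.
(* The hypothesis is now used around [a], to get the common neighbour [w] of [x] and [z]. *)
have := no_contraction ax az xz; rewrite a4' => xz2.
have /card_gt0P[w] : 0 < #|(N x :&: N z) :\ a|.
  by have := cardsD1 a (N x :&: N z); rewrite in_setI !NE ![f _ a]f_sym ax az /=; slia.
rewrite in_setD1 in_setI !NE => /and3P[wa xw zw].
apply: (@K33_paths a p q t y w [:: x; w] [:: x; w] [:: z; w]) => //=;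
  rewrite ?ax ?px ?az ?qz ?xw ?zw ?[f _ t]f_sym //; first by rewrite eq_sym.
have wp : w != p by apply: contraTneq zw => ->; rewrite f_sym.
have wq : w != q by apply: contraTneq xw => ->; rewrite f_sym.
have xt : x != t by apply: contraTneq qx => ->; rewrite negbK f_sym.
have zt : z != t by apply: contraTneq pz => ->; rewrite negbK f_sym.
have xy : x != y by apply: contraTneq qx => ->; rewrite negbK.
have zy : z != y by apply: contraTneq pz => ->; rewrite negbK.
have xa : x != a by rewrite eq_sym adj_neq.
have za : z != a by rewrite eq_sym adj_neq.
have xp : x != p by rewrite eq_sym adj_neq.
have zq : z != q by rewrite eq_sym adj_neq.
have xq : x != q by apply: (tri_neq ta tq); rewrite f_sym.
have zp : z != p by apply: (tri_neq ta tp); rewrite f_sym.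
have wt : w != t by apply: (tri_neq (y := x) ax); rewrite f_sym.
have wy : w != y by apply: (tri_neq (y := x) ax); rewrite // f_sym.
move=> u; rewrite !inE => hu.
have {hu} /or3P[] : [|| u == w, u == x | u == z] by move: hu; do 3!case: (u == _).
all: move=> /eqP->; rewrite !negb_or.
- by rewrite wa wp wq wt wy.
- by rewrite xa xp xq xt xy.
by rewrite za zp zq zt zy.
Qed.

Lemma deg3P2 t a p : #|N t| = 3 -> f t a -> f t p -> a != p ->
  exists q, uniq [:: a; p; q] /\ N t = [set a; p; q].
Proof.
move=> t3 ta tp ap; have [x [y [Uaxy Nt]]] := deg3P t3 ta.
move: tp; rewrite -NE Nt !inE eq_sym (negPf ap) /= => /orP[]/eqP Ep.
  by exists y; rewrite Ep.
exists x; rewrite Ep; split; last by rewrite setUAC.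
by move: Uaxy; rewrite /= !inE !negb_or !andbT (eq_sym y) => /andP[/andP[-> ->] ->].
Qed.

Section Degree5.
Variable a : T.
Hypotheses (a5 : #|N a| = 5) (aD : 4 <= #|[set x in N a | #|N x| == 3]|).

Let mostly3 x y : f a x -> f a y -> x != y -> #|N x| != 3 -> #|N y| = 3.
Proof.
move=> ax ay xy x3; apply/eqP/negPn/negP => y3.
have : [set x in N a | #|N x| == 3] \subset N a :\ x :\ y.
  apply/subsetP => z; rewrite inE !in_setD1 => /andP[-> z3]; rewrite andbT.
  by apply/andP; split; apply: contraTneq z3 => ->.
move=> /subset_leq_card; have := cardsD1 x (N a); have := cardsD1 y (N a :\ x).
by rewrite in_setD1 !NE eq_sym xy ax ay a5 /=; slia.
Qed.

Let codeg_ge3 t p : #|N t| = 3 -> f t a -> f t p -> a != p -> 3 <= #|N a :&: N p|.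
Proof. by move=> t3 ta tp ap; have := no_contraction ta tp ap; rewrite t3; slia. Qed.

(** A K_{3,3} arises with sides [a], [p], [q] and [t1], [t2], [r], where [r] is the third neighbour
    of [s]. From [q] it is reached through [s'], either directly or by a detour. *)
Let codeg2_False p q t1 t2 s s' : uniq [:: a; p; q] -> N t1 = [set a; p; q] ->
  t1 != t2 -> f a t2 -> f p t2 -> f q t2 ->
  f a s -> f p s -> ~~ f q s -> #|N s| = 3 ->
  f a s' -> f q s' -> ~~ f p s' -> False.
Proof.
move=> Uapq Nt1 t12 at2 pt2 qt2 as_ ps qs s3 as' qs' ps'.
have nt1 x : f x t1 = [|| x == a, x == p | x == q].
  by rewrite f_sym -NE Nt1 !in_setU !in_set1 orbA.
have [at1 pt1 qt1] : [/\ f a t1, f p t1 & f q t1] by rewrite !nt1 !eqxx !orbT.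
move: (Uapq); rewrite /= !inE !negb_or !andbT => /andP[/andP[ap aq] pq].
have [r [Uapr Ns]] : exists r, uniq [:: a; p; r] /\ N s = [set a; p; r].
  by apply: deg3P2; rewrite // f_sym.
have ns x : f x s = [|| x == a, x == p | x == r].
  by rewrite f_sym -NE Ns !in_setU !in_set1 orbA.
have rs : f r s by rewrite ns eqxx !orbT.
move: Uapr; rewrite /= !inE !negb_or !andbT => /andP[/andP[_ ar] pr].
have rq : r != q by apply: neq rs qs.
have rt1 : ~~ f r t1 by rewrite nt1 !negb_or eq_sym ar eq_sym pr rq.
have Nr : 3 <= #|N a :&: N r| by apply: (codeg_ge3 s3); rewrite // f_sym.
have st1 : s != t1 by apply: contraNneq qs => ->.
have st2 : s != t2 by apply: contraNneq qs => ->.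
have s't1 : s' != t1 by apply: contraNneq ps' => ->.
have s't2 : s' != t2 by apply: contraNneq ps' => ->.
have ss' : s != s' by apply: contraNneq qs => ->.
have opp x y : f a x -> f y t1 || f y s -> x != y.
  move=> ax /orP[] h; [apply: contraTneq ax => ->|apply: contraTneq ax => ->].
    by apply/negP => ay; apply: (notri ay h at1).
  by apply/negP => ay; apply: (notri ay h as_).
have out x : f a x -> x \notin [:: t1; t2] -> x \notin [:: a; p; q; t1; t2].
  move=> ax; rewrite !inE !negb_or => /andP[-> ->].
  by rewrite !opp ?at1 ?pt1 ?qt1.
have out' x : f x s || f x s' -> x \notin [:: a; p; q] -> x \notin [:: a; p; q; t1; t2].
  move=> xs; rewrite !inE !negb_or => /and3P[-> -> ->] /=.
  rewrite ![x == _]eq_sym; case/orP: xs => xs.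
    by rewrite !opp ?xs ?orbT.
  by apply/andP; split; apply: (@tri_neq s' a); rewrite // f_sym.
have rout : r \notin [:: a; p; q; t1; t2].
  by apply: out'; rewrite ?rs // !inE !negb_or eq_sym ar eq_sym pr rq.
have sout : s \notin [:: a; p; q; t1; t2] by apply: out; rewrite // !inE negb_or st1 st2.
have s'out : s' \notin [:: a; p; q; t1; t2] by apply: out; rewrite // !inE negb_or s't1 s't2.
have [rs'|rs'] := boolP (f r s').
  apply: (@K33_paths a p q t1 t2 r [:: s; r] [:: s; r] [:: s'; r]) => //=;
    rewrite ?as_ ?ps ?qs' ?(f_sym s) ?(f_sym s') ?rs ?rs' //.
  move=> z hz.
  have {hz} : [|| z == r, z == s | z == s'].
    by move: hz; rewrite !inE; do 3!case: (z == _).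
  by case/or3P=> /eqP->.
(* Now [s'] misses [r]. The fifth neighbour [u] of [a] supplies the detour [s'], [r'], [u], [r]:
   both [r] and the third neighbour [r'] of [s'] share three neighbours with [a], which forces them
   to see [u]. *)
have [u Nau] : exists u, N a :\ t1 :\ t2 :\ s :\ s' = [set u].
  apply/cards1P; have := cardsD1 t1 (N a); have := cardsD1 t2 (N a :\ t1).
  have := cardsD1 s (N a :\ t1 :\ t2); have := cardsD1 s' (N a :\ t1 :\ t2 :\ s).
  rewrite !in_setD1 !NE at1 at2 as_ as' a5 (eq_sym s' s) ss' s't2 s't1 st2 st1 (eq_sym t2) t12 /=.
  by move=> *; apply/eqP; slia.
have uE x : f a x = [|| x == t1, x == t2, x == s, x == s' | x == u].
  have := erefl (x \in [set u]); rewrite -{1}Nau !in_setD1 NE in_set1 => <-.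
  case: (eqVneq x t1) => [->|_] /=; first by rewrite at1.
  case: (eqVneq x t2) => [->|_] /=; first by rewrite at2.
  case: (eqVneq x s) => [->|_] /=; first by rewrite as_.
  by case: (eqVneq x s') => [->|_] /=; first by rewrite as'.
have : u \in [set u] by rewrite inE.
rewrite -Nau !in_setD1 NE => /and5P[us' us ut2 ut1 au].
have sub_r x : ~~ f x t1 -> ~~ f x s' -> N a :&: N x \subset [set t2; s; u].
  move=> xt1 xs'; apply/subsetP => z; rewrite in_setI !NE uE !in_setU !in_set1 => /andP[].
  move=> /or4P[/eqP->|->|->|/orP[/eqP->|->]]; rewrite ?orbT //.
    by rewrite (negPf xt1).
  by rewrite (negPf xs').
have [rt2 ru] : f r t2 /\ f r u.
  have E := card_set3 (sub_r r rt1 rs') Nr.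
  have : t2 \in N a :&: N r by rewrite E !inE eqxx.
  have : u \in N a :&: N r by rewrite E !inE eqxx orbT.
  by rewrite !in_setI !NE => /andP[_ ->] /andP[_ ->].
have t2n3 : #|N t2| != 3.
  rewrite neq_ltn; apply/orP; right.
  have /card_uniqP c4 : uniq [:: a; p; q; r].
    by rewrite /= !inE !negb_or ap aq ar pq pr eq_sym rq.
  rewrite -[4]/(size [:: a; p; q; r]) -c4; apply: subset_leq_card.
  apply/subsetP => x; rewrite NE f_sym !inE.
  by case/or4P=> /eqP->.
have s'3 : #|N s'| = 3 by apply: (mostly3 at2 as') t2n3; rewrite eq_sym.
have [r' [Uaqr' Ns']] : exists r', uniq [:: a; q; r'] /\ N s' = [set a; q; r'].
  by apply: deg3P2; rewrite // f_sym.
have ns' x : f x s' = [|| x == a, x == q | x == r'].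
  by rewrite f_sym -NE Ns' !in_setU !in_set1 orbA.
have r's' : f r' s' by rewrite ns' eqxx !orbT.
move: Uaqr'; rewrite /= !inE !negb_or !andbT => /andP[/andP[_ ar'] qr'].
have r'p : r' != p by apply: neq r's' ps'.
have r'r : r' != r by apply: neq r's' rs'.
have r't1 : ~~ f r' t1 by rewrite nt1 !negb_or eq_sym ar' r'p eq_sym qr'.
have r's : ~~ f r' s by rewrite ns !negb_or eq_sym ar' r'p r'r.
have Nr' : 3 <= #|N a :&: N r'| by apply: (codeg_ge3 s'3); rewrite // f_sym.
have r'u : f r' u.
  have sub : N a :&: N r' \subset [set t2; s'; u].
    apply/subsetP => z; rewrite in_setI !NE uE !in_setU !in_set1 => /andP[].
    move=> /or4P[/eqP->|->|/eqP->|/orP[->|->]]; rewrite ?orbT //.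
      by rewrite (negPf r't1).
    by rewrite (negPf r's).
  have : u \in N a :&: N r' by rewrite (card_set3 sub Nr') !inE eqxx orbT.
  by rewrite in_setI !NE => /andP[].
have r'out : r' \notin [:: a; p; q; t1; t2].
  by apply: out'; rewrite ?r's' ?orbT // !inE !negb_or eq_sym ar' r'p eq_sym qr'.
have uout : u \notin [:: a; p; q; t1; t2] by apply: out; rewrite // !inE negb_or ut1 ut2.
apply: (@K33_paths a p q t1 t2 r [:: s; r] [:: s; r] [:: s'; r'; u; r]) => //=;
  rewrite ?as_ ?ps ?qs' ?(f_sym s) ?(f_sym s') ?(f_sym u) ?rs ?r's' ?ru ?r'u //.
move=> z hz.
have {hz} : [|| z == r, z == s, z == s', z == r' | z == u].
  by move: hz; rewrite !inE; do 5!case: (z == _).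
by move=> /or4P[|||/orP[]] /eqP->.
Qed.

(** Otherwise [a] has neighbours [s] seeing only [p] and [s'] seeing only [q]. One of them has
    degree 3, as at most one neighbour of [a] does not, and [codeg2_False] applies. *)
Let codeg_le1 t p q : #|N t| = 3 -> f t a -> uniq [:: a; p; q] -> N t = [set a; p; q] ->
  #|N a :&: N p :&: N q| <= 1.
Proof.
move=> t3 ta Uapq Nt; rewrite leqNgt; apply/negP => c2.
have nt x : f x t = [|| x == a, x == p | x == q].
  by rewrite f_sym -NE Nt !in_setU !in_set1 orbA.
have [at_ pt qt] : [/\ f a t, f p t & f q t] by rewrite !nt !eqxx !orbT.
move: (Uapq); rewrite /= !inE !negb_or !andbT => /andP[/andP[ap aq] pq].
have c2' : #|N a :&: N p :&: N q| <= 2 by rewrite leqNgt; apply/negP/codeg3_False.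
have cp : 3 <= #|N a :&: N p| by apply: (codeg_ge3 t3); rewrite // f_sym.
have cq : 3 <= #|N a :&: N q| by apply: (codeg_ge3 t3); rewrite // f_sym.
have /card_gt0P[t2] : 0 < #|N a :&: N p :&: N q :\ t|.
  by have := cardsD1 t (N a :&: N p :&: N q); rewrite !in_setI !NE at_ pt qt /=; slia.
rewrite in_setD1 !in_setI !NE => /and3P[t2t /andP[at2 pt2] qt2].
have pick x y : 3 <= #|N a :&: N x| -> #|N a :&: N x :&: N y| <= 2 ->
    exists s, [/\ f a s, f x s & ~~ f y s].
  move=> h1 h2; have : ~~ (N a :&: N x \subset N y).
    apply/negP => /setIidPl E; rewrite E in h2; slia.
  by case/subsetPn => s; rewrite in_setI !NE => /andP[as_ xs] ys; exists s.
have [s [as_ ps qs]] := pick p q cp c2'.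
have [s' [as' qs' ps']] : exists s, [/\ f a s, f q s & ~~ f p s].
  by apply: pick => //; rewrite setIAC.
have [s3|s3] := eqVneq #|N s| 3.
  by apply: (@codeg2_False p q t t2 s s') => //; rewrite eq_sym.
have s'3 : #|N s'| = 3.
  by apply: (mostly3 as_ as') => //; apply: contraNneq qs => ->.
apply: (@codeg2_False q p t t2 s' s) => //; try by rewrite eq_sym.
  by rewrite /= !inE !negb_or aq ap eq_sym pq.
by rewrite Nt setUAC.
Qed.

(** Besides [t] and two more common neighbours [x], [y] of [a] and [p], only two neighbours of [a]
    are left. Both have to see [q] and the third neighbour [r] of [x], and one of them has degree 3,
    against [codeg_le1]. *)
Let side3_False t p q : #|N t| = 3 -> f t a -> uniq [:: a; p; q] -> N t = [set a; p; q] ->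
  (forall x, x \in N a :&: N p -> #|N x| = 3) -> False.
Proof.
move=> t3 ta Uapq Nt p3.
have nt x : f x t = [|| x == a, x == p | x == q].
  by rewrite f_sym -NE Nt !in_setU !in_set1 orbA.
have [at_ pt qt] : [/\ f a t, f p t & f q t] by rewrite !nt !eqxx !orbT.
move: (Uapq); rewrite /= !inE !negb_or !andbT => /andP[/andP[ap aq] pq].
have cp : 3 <= #|N a :&: N p| by apply: (codeg_ge3 t3); rewrite // f_sym.
have cq : 3 <= #|N a :&: N q| by apply: (codeg_ge3 t3); rewrite // f_sym.
have cpq := codeg_le1 t3 ta Uapq Nt.
have pqt x : f a x -> f p x -> f q x -> x = t.
  move=> ax px qx; apply/eqP/negPn/negP => xt.
  have : [set x; t] \subset N a :&: N p :&: N q.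
    by rewrite subUset !sub1set !in_setI !NE ax px qx at_ pt qt.
  by move=> /subset_leq_card; rewrite cards2 xt; slia.
have /card_gt1P[x [y [xP yP xy]]] : 1 < #|N a :&: N p :\ t|.
  by have := cardsD1 t (N a :&: N p); rewrite in_setI !NE at_ pt /=; slia.
move: xP yP; rewrite !in_setD1 !in_setI !NE => /and3P[xt ax px] /and3P[yt ay py].
have x3 : #|N x| = 3 by apply: p3; rewrite in_setI !NE ax.
have xa : f x a by rewrite f_sym.
have [r [Uapr Nx]] : exists r, uniq [:: a; p; r] /\ N x = [set a; p; r].
  by apply: deg3P2; rewrite // f_sym.
have nx z : f z x = [|| z == a, z == p | z == r].
  by rewrite f_sym -NE Nx !in_setU !in_set1 orbA.
have rx : f r x by rewrite nx eqxx !orbT.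
move: (Uapr); rewrite /= !inE !negb_or !andbT => /andP[/andP[_ ar] pr].
have rq : r != q by apply: contraNneq xt => Erq; rewrite Erq in rx; rewrite (pqt x).
have rt : ~~ f r t by rewrite nt !negb_or eq_sym ar eq_sym pr rq.
have cr : 3 <= #|N a :&: N r| by apply: (codeg_ge3 x3); rewrite // f_sym.
have cpr := codeg_le1 x3 xa Uapr Nx.
have ry : ~~ f r y.
  apply/negP => ry; have : [set x; y] \subset N a :&: N p :&: N r.
    by rewrite subUset !sub1set !in_setI !NE ax px rx ay py ry.
  by move=> /subset_leq_card; rewrite cards2 xy; slia.
pose S := N a :\ t :\ x :\ y.
have S2 : #|S| = 2.
  have := cardsD1 t (N a); have := cardsD1 x (N a :\ t); have := cardsD1 y (N a :\ t :\ x).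
  by rewrite !in_setD1 !NE at_ ax ay xt yt (eq_sym y) xy a5 /S /=; slia.
have qS : N a :&: N q :\ t = S.
  apply/eqP; rewrite eqEcard S2; apply/andP; split; last first.
    by have := cardsD1 t (N a :&: N q); rewrite in_setI !NE at_ qt /=; slia.
  apply/subsetP => z; rewrite !in_setD1 in_setI !NE => /and3P[zt az qz]; rewrite zt az !andbT.
  by apply/andP; split; apply: contraNneq zt => Ez; rewrite Ez in qz *; rewrite (pqt _ _ _ qz).
have rS : N a :&: N r :\ x = S.
  apply/eqP; rewrite eqEcard S2; apply/andP; split; last first.
    by have := cardsD1 x (N a :&: N r); rewrite in_setI !NE ax rx /=; slia.
  apply/subsetP => z; rewrite !in_setD1 in_setI !NE => /and3P[zx az rz]; rewrite zx az /= andbT.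
  by apply/andP; split; [apply: contraTneq rz => ->|apply: contraTneq rz => ->].
have SE z : z \in S -> [/\ f a z, f q z & f r z].
  move=> zS; move: (zS); rewrite -qS in_setD1 in_setI !NE => /and3P[_ -> ->].
  by move: zS; rewrite -rS in_setD1 in_setI !NE => /and3P[_ _ ->].
have /card_gt1P[u [v [uS vS uv]]] : 1 < #|S| by rewrite S2.
have [au qu ru] := SE _ uS; have [av qv rv] := SE _ vS.
have Uaqr : uniq [:: a; q; r] by rewrite /= !inE !negb_or aq ar eq_sym rq.
have fin z : f a z -> f q z -> f r z -> #|N z| = 3 -> False.
  move=> az qz rz z3; have := @codeg_le1 z q r z3 _ Uaqr _.
  rewrite f_sym az => /(_ isT) H.
  have /H : N z = [set a; q; r].
    apply/esym/eqP; rewrite eqEcard z3; apply/andP; split.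
      by apply/subsetP => w; rewrite !in_setU !in_set1 NE f_sym => /orP[/orP[]|]/eqP->.
    have /card_uniqP c3 := Uaqr; rewrite -[3]/(size [:: a; q; r]) -c3.
    by apply: subset_leq_card; apply/subsetP => w; rewrite !inE orbA.
  have : [set u; v] \subset N a :&: N q :&: N r.
    by rewrite subUset !sub1set !in_setI !NE au qu ru av qv rv.
  by move=> /subset_leq_card; rewrite cards2 uv; slia.
have [u3|u3] := eqVneq #|N u| 3; first exact: (fin u).
by apply: (fin v) => //; apply: (mostly3 au av uv u3).
Qed.

(** At most one neighbour of [a] has degree other than 3. By [codeg_le1] it misses [p] or [q], and
    [side3_False] applies on that side. *)
Lemma deg5_False : False.
Proof.
have /card_gt0P[t] : 0 < #|[set x in N a | #|N x| == 3]| by slia.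
rewrite inE NE => /andP[at_ /eqP t3].
have ta : f t a by rewrite f_sym.
have [p [q [Uapq Nt]]] := deg3P t3 ta.
have [/forall_inP p3|] := boolP [forall x in N a :&: N p, #|N x| == 3].
  by apply: (side3_False t3 ta Uapq Nt) => x /p3/eqP.
case/forall_inPn => x; rewrite in_setI !NE => /andP[ax px] x3.
apply: (@side3_False t q p t3 ta).
- by move: Uapq; rewrite /= !inE !negb_or !andbT (eq_sym p) => /andP[/andP[-> ->] ->].
- by rewrite Nt setUAC.
move=> y; rewrite in_setI !NE => /andP[ay qy].
apply: (mostly3 ax ay) => //; apply: contraNneq x3 => Exy; rewrite -Exy in qy.
suff -> : x = t by rewrite t3.
have [tp tq] : f t p /\ f t q by rewrite -!NE Nt !inE !eqxx !orbT.
have := codeg_le1 t3 ta Uapq Nt; rewrite leqNgt => /negP c1.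
apply/eqP/negPn/negP => xt; apply: c1; apply/card_gt1P; exists x, t.
by rewrite !in_setI !NE ax px qy (f_sym a) (f_sym p) (f_sym q) ta tp tq.
Qed.
End Degree5.

(** Discharging towards degree 4, scaled by 3: every vertex of degree 3 receives 1/3 from each
    neighbour. A giver has degree at least 5; from degree 6 on d/3 <= d - 4, and a giver of degree 5
    gives at most three times by [deg5_False]. *)
Lemma bipartite_dense : 4 * #|U| <= degsum f U.
Proof.
pose D := [set x in U | #|N x| == 3].
have D3 x : x \in D -> #|N x| = 3 by rewrite inE => /andP[_ /eqP].
have loc x : x \in U -> 12 + #|D :&: N x| <= 3 * #|N x| + 3 * (x \in D).
  move=> xU; have dx := min_deg xU.
  have nbrD : D :&: N x != set0 -> 5 <= #|N x|.
    case/set0Pn => t; rewrite in_setI NE => /andP[/D3 t3 xt].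
    by apply: (deg3_nbr_ge5 t3); rewrite f_sym.
  have le : #|D :&: N x| <= #|N x| by rewrite subset_leq_card ?subsetIr.
  have [E0|/nbrD d5] := eqVneq (D :&: N x) set0.
    rewrite E0 cards0; have [//|xD] := boolP (x \in D); first by slia.
    have : #|N x| != 3 by apply: contra xD => d3; rewrite inE xU.
    by slia.
  have [d6|] := leqP 6 #|N x|; first by slia.
  rewrite ltnS => d5'; have {d5 d5'} d5 : #|N x| = 5 by slia.
  suff : #|D :&: N x| <= 3 by slia.
  rewrite leqNgt; apply/negP => c4; apply: (deg5_False d5).
  apply: leq_trans c4 (subset_leq_card _); apply/subsetP => t.
  by rewrite in_setI [in X in _ -> X]inE => /andP[/D3 -> ->].
have : \sum_(x in U) (12 + #|D :&: N x|) <= \sum_(x in U) (3 * #|N x| + 3 * (x \in D)).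
  exact: leq_sum.
rewrite !big_split /= sum_nat_const -/(degsum f U) big1_eq addn0.
have -> : \sum_(x in U) (x \in D : nat) = #|D|.
  rewrite -sum1_card big_mkcond [RHS]big_mkcond /=; apply: eq_bigr => x _.
  by rewrite inE; case: (x \in U) => //=; case: (_ == _).
suff -> : \sum_(x in U) #|D :&: N x| = 3 * #|D| by slia.
rewrite (eq_bigr (fun x => \sum_(t in D) (f x t : nat))); last first.
  move=> x _; rewrite -sum1_card big_mkcond [RHS]big_mkcond /=; apply: eq_bigr => t _.
  by rewrite in_setI NE; case: (t \in D) => //=; case: (f x t).
rewrite exchange_big /= mulnC -sum_nat_const; apply: eq_bigr => t tD.
rewrite -(D3 _ tD) -sum1_card big_mkcond [RHS]big_mkcond /=; apply: eq_bigr => x _.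
by rewrite inE f_sym; case: (x \in U) => //=; case: (f t x).
Qed.
End Bipartite.

Section BipartiteBound.
Variable T : finType.
Implicit Types (e f : rel T) (A B U : {set T}).

(** Delete [t] and merge [b] into [a], which lies on the same side. A new edge at [a] stands for a
    walk through [t] and [b]. Lost are the edges at [t] and one edge for each common neighbour of
    [a] and [b] other than [t]. *)
Lemma bipartite_contraction f A U t a b :
    symmetric f -> z2_planar f -> (forall x y, f x y -> (x \in A) != (y \in A)) ->
    t \in U -> a \in U -> b \in U -> f t a -> f t b -> a != b ->
  exists f', [/\ symmetric f', z2_planar f',
    (forall x y, f' x y -> (x \in A) != (y \in A)) &
    degsum f U + 2 <= degsum f' (U :\ t :\ b) +
       2 * (#|nbr f U t| + #|nbr f U a :&: nbr f U b|)].
Proof.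
move=> f_sym f_planar f_bip tU aU bU ta tb ab.
have f_irr : irreflexive f by move=> x; apply/negP => /f_bip; rewrite eqxx.
have sameA : (b \in A) = (a \in A).
  by move: (f_bip _ _ ta) (f_bip _ _ tb); case: (t \in A); case: (a \in A); case: (b \in A).
have nab x : f a x -> x != b by move=> /f_bip; apply: contraNneq => ->; rewrite sameA eqxx.
have nba x : f b x -> x != a by move=> /f_bip; apply: contraNneq => ->; rewrite sameA eqxx.
have at_ : a != t by apply: contraTneq ta => ->; rewrite f_irr.
have bt : b != t by apply: contraTneq tb => ->; rewrite f_irr.
pose f' x y := [&& x != b, y != b, x != t, y != t &
  [|| f x y, (x == a) && f b y | (y == a) && f b x]].
have f'_bip x y : f' x y -> (x \in A) != (y \in A).
  case/and5P=> _ _ _ _ /or3P[/f_bip //|/andP[/eqP-> /f_bip]|/andP[/eqP-> /f_bip]].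
    by rewrite sameA.
  by rewrite sameA eq_sym.
have f'_irr : irreflexive f' by move=> x; apply/negP => /f'_bip; rewrite eqxx.
exists f'; split=> //.
- move=> x y; rewrite /f' (f_sym x y).
  by do 4!case: (_ != _) => //=; rewrite [X in _ || X]orbC.
- pose w x y := if f x y then [:: y] else if x == a then [:: t; b; y] else [:: b; t; y].
  apply: (z2_planar_minor f_irr (w := w)) f_planar _ _.
    move=> x y /and5P[_ _ _ _]; rewrite /w; case: ifP => [fxy _|_ /=].
      by rewrite /= fxy.
    case: eqVneq => [->|xa] /= h.
      rewrite (f_sym a) ta tb; case/orP: h => [->//|/andP[/eqP-> /nba]].
      by rewrite eqxx.
    by case/andP: h => /eqP-> bx; rewrite f_sym bx (f_sym b) tb ta.
  move=> x y z u /= U4 fxy fzu v.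
  have wv x1 y1 c : f' x1 y1 -> c \in x1 :: w x1 y1 ->
      [|| c == x1, c == y1 | ((c == b) || (c == t)) && ((a == x1) || (a == y1))].
    move=> /and5P[_ _ _ _ +]; rewrite /w; case: ifP => [_ _|_ /=].
      by rewrite !inE orbA => ->.
    case: (eqVneq x1 a) => [->|xa] /= h.
      by rewrite !inE ?eqxx /= ?andbT; do 4!case: (c == _).
    by case/andP: h => /eqP-> _; rewrite !inE ?eqxx ?orbT /= ?andbT; do 4!case: (c == _).
  move: (fxy) (fzu) => /and5P[xb yb xt yt _] /and5P[zb ub zt ut _].
  move=> /(wv _ _ _ fxy) h1; apply/negP => /(wv _ _ _ fzu) h2.
  move: U4; rewrite !inE !negb_or => /and4P[/and3P[_ xz xu] /andP[yz yu] _ _].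
  case/or3P: h1 => [/eqP Ev|/eqP Ev|/andP[vbt axy]]; case/or3P: h2 => [/eqP Ev'|/eqP Ev'|/andP[vbt' azu]].
  all: try by move: xz xu yz yu; rewrite -Ev -Ev' eqxx.
  all: try by move: vbt'; rewrite Ev ?(negPf xb) ?(negPf xt) ?(negPf yb) ?(negPf yt).
  all: try by move: vbt; rewrite Ev' ?(negPf zb) ?(negPf zt) ?(negPf ub) ?(negPf ut).
  by case/orP: axy => /eqP Ea; case/orP: azu => /eqP Ea'; move: xz xu yz yu; rewrite -Ea -Ea' eqxx.
set c := #|_ :&: _|; set U' := U :\ t :\ b.
have aU' : a \in U' by rewrite !in_setD1 ab at_.
have bUt : b \in U :\ t by rewrite in_setD1 bt.
rewrite /degsum (big_setD1 t tU) /= (big_setD1 b bUt) /= (big_setD1 a aU') /=.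
rewrite [X in _ <= X + _](big_setD1 a aU') /=; set U'' := U' :\ a.
have H1 : #|nbr f U a| + #|nbr f U b| <= #|nbr f' U' a| + 1 + c.
  rewrite -cardsUI -/c leq_add2r.
  apply: leq_trans (_ : #|nbr f' U' a :|: [set t]| <= _).
    apply: subset_leq_card; apply/subsetP => y; rewrite in_setU !in_nbr => hy.
    have yb : y != b by case/orP: hy => /andP[_]; [exact: nab|apply: contraTneq => ->; rewrite f_irr].
    move: hy; rewrite !inE /f' ab at_ yb eqxx /=; case: (y == t); rewrite ?orbT //=.
    by case: (y \in U) => //=; rewrite orbF orbA => ->.
  by rewrite (leq_trans (leq_card_setU _ _)) // cards1.
have H2 : \sum_(x in U'') #|nbr f U x| <= \sum_(x in U'') #|nbr f' U' x| +
    (\sum_(x in U'') (f t x : nat) + \sum_(x in U'') (f a x && f b x : nat)).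
  rewrite -!big_split /=; apply: leq_sum => x; rewrite !in_setD1 => /and4P[xa xb xt xU].
  have := cardsD1 t (nbr f U x); have := cardsD1 b (nbr f U x :\ t).
  have := cardsD1 a (nbr f U x :\ t :\ b).
  rewrite !in_setD1 !in_nbr ab at_ bt tU aU bU /= (f_sym x t) (f_sym x a) (f_sym x b) => E1 E2 E3.
  have sub : nbr f U x :\ t :\ b :\ a \subset nbr f' U' x :\ a.
    apply/subsetP => y; rewrite !in_setD1 !in_nbr => /and5P[ya yb yt yU fxy].
    by rewrite ya !in_setD1 yb yt yU /f' xb yb xt yt fxy.
  have := subset_leq_card sub; have := cardsD1 a (nbr f' U' x).
  rewrite in_nbr aU' /f' xb ab xt at_ (negPf xa) eqxx /= (f_sym x a) {}E1 in E2 *.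
  by move: E2 E3; case: (f t x); case: (f a x); case: (f b x) => /=; slia.
have H3 : \sum_(x in U'') (f t x : nat) + 2 <= #|nbr f U t|.
  have := cardsD1 a (nbr f U t); have := cardsD1 b (nbr f U t :\ a).
  rewrite !in_setD1 !in_nbr aU bU ta tb (eq_sym b) ab /=.
  suff -> : \sum_(x in U'') (f t x : nat) = #|nbr f U t :\ a :\ b| by slia.
  rewrite -sum1_card big_mkcond [RHS]big_mkcond /=; apply: eq_bigr => x _.
  rewrite !in_setD1 !in_nbr.
  case: (eqVneq x t) => [->|_]; first by rewrite f_irr !andbF.
  by case: (x == a); case: (x == b); case: (x \in U) => //=; case: (f t x).
have H4 : \sum_(x in U'') (f a x && f b x : nat) + 1 <= c.
  have := cardsD1 t (nbr f U a :&: nbr f U b); rewrite in_setI !in_nbr tU !(f_sym _ t) ta tb /= -/c.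
  suff -> : \sum_(x in U'') (f a x && f b x : nat) = #|(nbr f U a :&: nbr f U b) :\ t| by slia.
  rewrite -sum1_card big_mkcond [RHS]big_mkcond /=; apply: eq_bigr => x _.
  rewrite !in_setD1 in_setI !in_nbr.
  case: (eqVneq x a) => [->|_]; first by rewrite f_irr !andbF.
  case: (eqVneq x b) => [->|_]; first by rewrite f_irr !andbF.
  by case: (x == t); case: (x \in U) => //=; case: (f a x); case: (f b x).
by slia.
Qed.

(** A smallest counterexample, trimmed to barely too many edges, satisfies the hypotheses of
    [bipartite_dense] and would have at least 2n edges, more than trimming leaves. *)
Lemma bipartite_degsum f A U : symmetric f -> z2_planar f ->
  (forall x y, f x y -> (x \in A) != (y \in A)) -> 3 <= #|U| ->
  degsum f U + 8 <= 4 * #|U|.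
Proof.
move: {2}#|U| (leqnn #|U|) => n; elim: n f U => [|n IH] f U Un f_sym f_planar f_bip U3.
  slia.
have f_irr : irreflexive f by move=> x; apply/negP => /f_bip; rewrite eqxx.
have [/eqP U3'|U4] := leqP #|U| 3.
  have d1 x : x \in U :&: A -> #|nbr f U x| <= #|U :\: A|.
    rewrite in_setI => /andP[_ xA]; apply: subset_leq_card; apply/subsetP => y.
    by rewrite in_nbr in_setD => /andP[-> /f_bip]; rewrite xA eq_sym eqb_id => ->.
  have d2 x : x \in U :\: A -> #|nbr f U x| <= #|U :&: A|.
    rewrite in_setD => /andP[xA _]; apply: subset_leq_card; apply/subsetP => y.
    by rewrite in_nbr in_setI => /andP[-> /f_bip]; rewrite (negPf xA); case: (y \in A).
  have := cardsID A U; rewrite /degsum (big_setID A) /= => UA.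
  have := leq_sum (index_enum T) d1; have := leq_sum (index_enum T) d2.
  rewrite !sum_nat_const; move: UA U3'.
  case: #|U :&: A| => [|[|[|[|k]]]] UA U3'; nia.
rewrite leqNgt; apply/negP => big.
have [g [g_sym g_irr gf /andP[lo hi]]] := @trim_edges T f U (4 * #|U| - 7) f_sym f_irr ltac:(lia).
pose h x y := [&& x \in U, y \in U & g x y].
have hf : subrel h f by move=> x y /and3P[_ _ /gf].
have h_sym : symmetric h by move=> x y; rewrite /h g_sym andbCA.
have h_planar := sub_z2_planar hf f_planar.
have h_bip x y : h x y -> (x \in A) != (y \in A) by move/hf/f_bip.
have h_irr : irreflexive h by move=> x; apply/negP => /h_bip; rewrite eqxx.
have h_supp x y : h x y -> y \in U by case/and3P.
have dE : degsum h U = degsum g U.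
  apply: eq_bigr => x xU; congr #|pred_of_set _|; apply/setP => y.
  by rewrite !in_nbr /h xU; case: (y \in U).
rewrite -dE in lo hi.
have cardU v : v \in U -> #|U :\ v| = #|U|.-1.
  by move=> vU; have := cardsD1 v U; rewrite vU; slia.
have deg3 v : v \in U -> 3 <= #|nbr h U v|.
  move=> vU; have := degsumD1 h_sym h_irr vU.
  by have := IH h (U :\ v); rewrite cardU // => /(_ ltac:(lia) h_sym h_planar h_bip ltac:(lia)); slia.
suff : 4 * #|U| <= degsum h U by slia.
apply: (@bipartite_dense T h A U) => // t a b ta tb ab.
have [tU aU bU] : [/\ t \in U, a \in U & b \in U] by case/and3P: ta => -> ->; case/and3P: tb.
(* Ensures that enough vertices remain in [U :\ t :\ b] for the induction: adjacent vertices have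
   disjoint neighbourhoods of size at least 3. *)
have U6 : 6 <= #|U|.
  have : nbr h U t :|: nbr h U a \subset U.
    by rewrite subUset; apply/andP; split; apply/subsetP => y; rewrite in_nbr => /andP[].
  move=> /subset_leq_card; rewrite cardsU.
  have -> : nbr h U t :&: nbr h U a = set0.
    apply/setP => y; rewrite in_setI !in_nbr in_set0; apply/negP.
    move=> /andP[/andP[_ /h_bip h1] /andP[_ /h_bip]]; have := h_bip _ _ ta; move: h1.
    by case: (t \in A); case: (a \in A); case: (y \in A).
  by rewrite cards0; have := deg3 t tU; have := deg3 a aU; slia.
have [f' [f'_sym f'_planar f'_bip le]] := bipartite_contraction h_sym h_planar h_bip tU aU bU ta tb ab.
have tb' : t != b by apply: contraTneq tb => ->; rewrite h_irr.
have cU : #|U :\ t :\ b| = #|U|.-2.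
  by have := cardsD1 b (U :\ t); rewrite in_setD1 bU eq_sym tb' cardU //=; slia.
have := IH f' (U :\ t :\ b); rewrite cU => /(_ ltac:(lia) f'_sym f'_planar f'_bip ltac:(lia)).
by slia.
Qed.

Lemma bipartite_bound e A B : symmetric e -> z2_planar e -> [disjoint A & B] ->
  3 <= #|A| + #|B| -> \sum_(x in A) #|nbr e B x| + 4 <= 2 * (#|A| + #|B|).
Proof.
move=> e_sym e_planar dAB AB3.
pose f x y := e x y && ((x \in A) && (y \in B) || (x \in B) && (y \in A)).
have f_sym : symmetric f.
  by move=> x y; rewrite /f e_sym orbC ![(y \in _) && _]andbC.
have f_planar : z2_planar f by apply: sub_z2_planar e_planar => x y /andP[].
have f_bip x y : f x y -> (x \in A) != (y \in A).
  case/andP=> _ /orP[]/andP[h1 h2]; first by rewrite h1 (disjointFl dAB h2).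
  by rewrite h2 (disjointFl dAB h1).
have cU : #|A :|: B| = #|A| + #|B|.
  by rewrite cardsU (disjoint_setI0 dAB) cards0 subn0.
have := bipartite_degsum f_sym f_planar f_bip (U := A :|: B); rewrite cU => /(_ AB3).
rewrite /degsum (eq_bigl [predU A & B]) => [|x]; last by rewrite !inE.
rewrite bigU //=.
have -> : \sum_(x in A) #|nbr f (A :|: B) x| = \sum_(x in A) #|nbr e B x|.
  apply: eq_bigr => x xA; congr #|pred_of_set _|; apply/setP => y.
  rewrite !inE /f xA (disjointFr dAB xA) /= orbF.
  by case: (y \in B); rewrite ?andbF ?orbT //= andbT.
have -> : \sum_(x in B) #|nbr f (A :|: B) x| = \sum_(x in A) #|nbr e B x|.
  transitivity (\sum_(x in B) \sum_(y in A) (e x y : nat)).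
    apply: eq_bigr => x xB; rewrite -sum1_card big_mkcond [RHS]big_mkcond /=.
    apply: eq_bigr => y _; rewrite !inE /f xB (disjointFl dAB xB) /=.
    by case: (y \in A); rewrite ?andbF //= andbT; case: (e x y).
  rewrite exchange_big /=; apply: eq_bigr => y yA.
  rewrite -sum1_card big_mkcond [RHS]big_mkcond /=.
  by apply: eq_bigr => x _; rewrite inE e_sym; case: (x \in B) => //=; case: (e y x).
by slia.
Qed.
End BipartiteBound.

(** * Edges between the neighbourhoods of two adjacent vertices *)

Section CrossEdges.
Variables (T : finType) (e : rel T).
Hypotheses (e_sym : symmetric e) (e_irr : irreflexive e) (e_planar : z2_planar e).
Implicit Types (X Y D : {set T}).

Definition cross_pairs X Y : {set T * T} :=
  [set p | [&& p.1 \in X, p.2 \in Y & e p.1 p.2]].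

(** An edge inside [X :&: Y] gives two cross pairs but is counted once here. *)
Definition cross_edges X Y : {set {set T}} :=
  [set [set p.1; p.2] | p in cross_pairs X Y].

Lemma card_cross_pairs X Y : #|cross_pairs X Y| = \sum_(x in X) #|nbr e Y x|.
Proof.
rewrite -sum1_card (eq_bigl (fun p => (p.1 \in X) && (p.2 \in nbr e Y p.1))); last first.
  by move=> p; rewrite !inE.
rewrite -(pair_big_dep (mem X) (fun x y => y \in nbr e Y x) (fun _ _ => 1)) /=.
by apply: eq_bigr => x _; rewrite sum1_card.
Qed.

Lemma card_inner_edges D : 2 * #|cross_edges D D| <= degsum e D.
Proof.
rewrite /degsum -card_cross_pairs mulnC -sum_nat_const -sum1_card.
rewrite (partition_big_imset (fun p : T * T => [set p.1; p.2])) /=.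
apply: leq_sum => f /imsetP[[x y]]; rewrite inE /= => /and3P[xD yD exy] ->.
have xy : x != y by apply: contraTneq exy => ->; rewrite e_irr.
rewrite sum1dep_card; apply: leq_trans (_ : #|[set (x, y); (y, x)]| <= _).
  by rewrite cards2 xpair_eqE (negPf xy).
apply: subset_leq_card; apply/subsetP => p; rewrite !inE.
by move=> /orP[]/eqP-> /=; rewrite ?xD ?yD ?exy 1?e_sym ?exy 1?setUC ?eqxx.
Qed.

(** Adding [v] to the side of [X] and [u] to the side of [Y] keeps the graph bipartite and adds |X|
    + |Y| + 1 edges, so the bound 2n - 4 leaves at most |X| + |Y| - 1 for the others. *)
Lemma forest_bound u v X Y : e u v -> [disjoint X & Y] ->
    (forall x, x \in X -> e u x /\ x != v) -> (forall y, y \in Y -> e v y /\ y != u) ->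
    0 < #|X| + #|Y| ->
  #|cross_pairs X Y| < #|X| + #|Y|.
Proof.
move=> euv dXY Xu Yv XY0; rewrite card_cross_pairs.
have uv : u != v by apply: contraTneq euv => ->; rewrite e_irr.
have vX : v \notin X by apply/negP => /Xu[_]; rewrite eqxx.
have uX : u \notin X by apply/negP => /Xu[]; rewrite e_irr.
have uY : u \notin Y by apply/negP => /Yv[_]; rewrite eqxx.
have vY : v \notin Y by apply/negP => /Yv[]; rewrite e_irr.
have dAB : [disjoint v |: X & u |: Y].
  rewrite -setI_eq0; apply/eqP/setP => z; rewrite !inE.
  case: (eqVneq z v) => [->|_] /=; first by rewrite eq_sym (negPf uv) (negPf vY).
  case: (eqVneq z u) => [->|_] /=; first by rewrite (negPf uX).
  by case zX: (z \in X); rewrite //= (disjointFr dXY zX).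
have := bipartite_bound e_sym e_planar dAB.
rewrite !cardsU1 vX uY !add1n big_setU1 //=.
have nv : #|Y| < #|nbr e (u |: Y) v|.
  apply: leq_trans (_ : #|u |: Y| <= _); first by rewrite cardsU1 uY.
  apply: subset_leq_card; apply/subsetP => y; rewrite in_nbr => yuY; rewrite yuY /=.
  by move: yuY; rewrite !inE => /orP[/eqP->|/Yv[]//]; rewrite e_sym.
have nX : #|X| + \sum_(x in X) #|nbr e Y x| <= \sum_(x in X) #|nbr e (u |: Y) x|.
  rewrite -sum1_card -big_split /=; apply: leq_sum => x xX.
  rewrite (cardsD1 u (nbr e (u |: Y) x)) in_nbr setU11 e_sym; have [-> _] := Xu _ xX.
  rewrite leq_add2l; apply: subset_leq_card; apply/subsetP => y.
  by rewrite !inE => /andP[yY ->]; rewrite yY orbT !andbT; case: (Yv _ yY).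
by move=> /(_ ltac:(slia)); slia.
Qed.

(** Let D be the intersection of X and Y. If D is nonempty, the edges from X to Y - X and from X - Y
    to D are bounded by [forest_bound], those inside D by Euler's bound on D with u and v added. The
    three strict inequalities produce the 3. *)
Lemma cross_edges_bound u v X Y : e u v -> X != set0 ->
    (forall x, x \in X -> e u x /\ x != v) -> (forall y, y \in Y -> e v y /\ y != u) ->
  #|cross_edges X Y| < #|X| + #|Y| \/ #|cross_edges X Y| + 3 <= 2 * #|X| + #|Y|.
Proof.
move=> euv X0 Xu Yv; have cX : 0 < #|X| by rewrite card_gt0.
have [D0|D0] := eqVneq (X :&: Y) set0.
  left; apply: leq_ltn_trans (leq_imset_card _ _) _.
  apply: (@forest_bound u v) => //; [by rewrite -setI_eq0 D0|by rewrite addn_gt0 cX].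
have [D DE] : exists D, D = X :&: Y by exists (X :&: Y).
rewrite -DE in D0; right; have cD : 0 < #|D| by rewrite card_gt0.
have DX x : x \in D -> x \in X by rewrite DE inE => /andP[].
have DY x : x \in D -> x \in Y by rewrite DE inE => /andP[].
have h1 : #|cross_pairs X (Y :\: X)| < #|X| + #|Y :\: X|.
  apply: (@forest_bound u v) => //; last by rewrite addn_gt0 cX.
    by rewrite -setI_eq0 setIDA setDIl setDv set0I.
  by move=> y; rewrite inE => /andP[_ /Yv].
have h2 : #|cross_pairs (X :\: Y) D| < #|X :\: Y| + #|D|.
  apply: (@forest_bound u v) => //; last by rewrite addn_gt0 cD orbT.
  - by rewrite -setI_eq0 DE; apply/eqP/setP => z; rewrite !inE; case: (z \in Y); rewrite ?andbF.
  - by move=> x; rewrite inE => /andP[_ /Xu].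
  by move=> y /DY/Yv.
have h3 : #|cross_edges D D| < #|D|.
  have uv : u != v by apply: contraTneq euv => ->; rewrite e_irr.
  have uD : u \notin D by apply/negP => /DX/Xu[]; rewrite e_irr.
  have vD : v \notin D by apply/negP => /DX/Xu[_]; rewrite eqxx.
  have uvD : u \notin v |: D by rewrite in_setU1 negb_or uv uD.
  have := @euler_bound T e (u |: (v |: D)) e_sym e_irr e_planar.
  rewrite (degsumD1 e_sym e_irr (setU11 u _)) setU1K // (degsumD1 e_sym e_irr (setU11 v _)) setU1K //.
  rewrite !cardsU1 uvD vD /=.
  have nv : #|D| <= #|nbr e (v |: D) v|.
    apply: subset_leq_card; apply/subsetP => x xD; rewrite in_nbr inE xD orbT.
    by case: (Yv _ (DY _ xD)).
  have nu : #|D| < #|nbr e (u |: (v |: D)) u|.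
    apply: leq_trans (_ : #|v |: D| <= _); first by rewrite cardsU1 vD.
    apply: subset_leq_card; apply/subsetP => x xD; rewrite in_nbr inE xD orbT /=.
    by move: xD; rewrite in_setU1 => /orP[/eqP->//|/DX/Xu[]].
  by have := card_inner_edges D; move=> h /(_ ltac:(slia)); slia.
have sub : cross_edges X Y \subset [set [set p.1; p.2] | p in cross_pairs X (Y :\: X)] :|:
    [set [set p.1; p.2] | p in cross_pairs (X :\: Y) D] :|: cross_edges D D.
  apply/subsetP => f /imsetP[[x y]]; rewrite inE /= => /and3P[xX yY exy] ->.
  rewrite !in_setU -orbA; have [yX|yX] := boolP (y \in X); last first.
    by apply/or3P/Or31; apply/imsetP; exists (x, y); rewrite // !inE /= xX yX yY.
  have [xY|xY] := boolP (x \in Y); last first.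
    by apply/or3P/Or32; apply/imsetP; exists (x, y); rewrite // ?DE !inE /= xX xY yX yY.
  by apply/or3P/Or33; apply/imsetP; exists (x, y); rewrite // ?DE !inE /= xX xY yX yY.
have := subset_leq_card sub.
have [+ _] := leq_card_setU ([set [set p.1; p.2] | p in cross_pairs X (Y :\: X)] :|:
    [set [set p.1; p.2] | p in cross_pairs (X :\: Y) D]) (cross_edges D D).
have [+ _] := leq_card_setU [set [set p.1; p.2] | p in cross_pairs X (Y :\: X)]
    [set [set p.1; p.2] | p in cross_pairs (X :\: Y) D].
have := leq_imset_card (fun p => [set p.1; p.2]) (cross_pairs X (Y :\: X)).
have := leq_imset_card (fun p => [set p.1; p.2]) (cross_pairs (X :\: Y) D).
have := cardsID Y X; have := cardsID X Y; rewrite (setIC Y X) -DE.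
by slia.
Qed.

(** Contract every [c] with its partner [p c]. Each of the resulting vertices has three neighbours
    in [L], and 3|C| + 4 <= 2(|C| + |L|). *)
Lemma paired_bound (C L : {set T}) (p : T -> T) :
    {in C &, injective p} ->
    (forall c, c \in C -> [/\ p c \notin C, c \notin L, p c \notin L & e (p c) c]) ->
    (forall c, c \in C -> 3 <= #|L :&: (nbr e setT c :|: nbr e setT (p c))|) ->
  #|C| <= 2 * #|L|.
Proof.
move=> p_inj Cp C3.
have [->|[c0 c0C]] := set_0Vmem C; first by rewrite cards0.
have L3 : 3 <= #|L| by apply: leq_trans (C3 _ c0C) (subset_leq_card (subsetIl _ _)).
pose g x y := e x y || e (p x) y.
pose f x y := (x \in C) && (y \in L) && g x y || (y \in C) && (x \in L) && g y x.
have f_sym : symmetric f by move=> x y; rewrite /f orbC.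
pose w x y := if e x y then [:: y] else if x \in C then [:: p x; y] else [:: p y; y].
have f_planar : z2_planar f.
  apply: (z2_planar_minor e_irr (w := w)) e_planar _ _.
    move=> x y fxy; rewrite /w; case: ifP => [exy|nexy]; first by rewrite /= exy.
    move: fxy; rewrite /f /g (e_sym y x) nexy /=; case/orP=> /andP[/andP[xC yL] pxy].
      by rewrite xC /= pxy andbT e_sym; have [_ _ _ ->] := Cp _ xC.
    have [_ _ _ epy] := Cp _ xC; have [xC'|_] /= := boolP (x \in C).
      by have [_ xL _ _] := Cp _ xC'; rewrite yL in xL.
    by rewrite epy e_sym pxy.
  move=> x y z u /= U4 fxy fzu v.
  pose top x y := if x \in C then x else y.
  have wv x1 y1 b : f x1 y1 -> b \in x1 :: w x1 y1 ->
      (b \in [:: x1; y1]) || (b == p (top x1 y1)).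
    by rewrite /w /top => _; case: ifP => _; case: ifP => _; rewrite !inE; do 4!case: (b == _).
  have topC x1 y1 : f x1 y1 -> (top x1 y1 \in C) /\ top x1 y1 \in [:: x1; y1].
    rewrite /f /top; case: ifP => [xC _|_ /=]; rewrite !inE eqxx ?orbT //.
    by move=> /andP[/andP[-> _] _].
  have pnot x1 y1 c : f x1 y1 -> c \in C -> p c \notin [:: x1; y1].
    move=> fxy1 cC; have [pcC _ pcL _] := Cp _ cC.
    have CL b : b \in [:: x1; y1] -> (b \in C) || (b \in L).
      by rewrite !inE => /orP[]/eqP->; case/orP: fxy1 => /andP[/andP[h1 h2] _]; rewrite ?h1 ?h2 ?orbT.
    by apply: contra pcC => /CL; rewrite (negPf pcL) orbF.
  have dis b : b \in [:: x; y] -> b \in [:: z; u] -> False.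
    move=> bxy bzu; move: U4; rewrite !inE !negb_or => /and4P[/and3P[_ xz xu] /andP[yz yu] _ _].
    move: bxy bzu xz xu yz yu; rewrite !inE.
    by move=> /orP[]/eqP-> /orP[]/eqP->; rewrite eqxx.
  have [t1 t1in] := topC _ _ fxy; have [t2 t2in] := topC _ _ fzu.
  move=> /(wv _ _ _ fxy) h1; apply/negP => /(wv _ _ _ fzu).
  case/orP: h1 => [h1|/eqP Ev].
    case/orP=> [h2|/eqP Ev]; first exact: (dis v).
    by move: h1; rewrite Ev (negPf (pnot _ _ _ fxy t2)).
  rewrite Ev (negPf (pnot _ _ _ fzu t1)) /= => /eqP/p_inj E.
  by move: t2in; rewrite -E // => /(dis _ t1in).
have dCL : [disjoint C & L].
  by rewrite -setI_eq0; apply/eqP/setP => c; rewrite !inE; apply/negP => /andP[/Cp[_ /negPf->]].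
have := bipartite_bound f_sym f_planar dCL.
have : #|C| * 3 <= \sum_(x in C) #|nbr f L x|.
  rewrite -sum_nat_const; apply: leq_sum => c cC; apply: leq_trans (C3 _ cC) (subset_leq_card _).
  apply/subsetP => y; rewrite !inE /f /g cC => /andP[yL /orP[]/= ey]; rewrite yL ey ?orbT //.
by move=> h /(_ ltac:(slia)); slia.
Qed.
End CrossEdges.

(** * Conflicts between edges and reducible configurations *)

Lemma set2_eqP (T : finType) (u v u1 v1 : T) :
  u != v -> [set u; v] = [set u1; v1] -> (u1 = u /\ v1 = v) \/ (u1 = v /\ v1 = u).
Proof.
move=> uv E; have := set21 u1 v1; have := set22 u1 v1; rewrite -E !inE.
move=> /orP[]/eqP Ev /orP[]/eqP Eu; [|by right|by left|].
  by have := set22 u v; rewrite E Ev Eu !inE orbb eq_sym (negPf uv).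
by have := set21 u v; rewrite E Ev Eu !inE orbb (negPf uv).
Qed.

Section Conflicts.
Variables (T : finType) (e : rel T).
Hypotheses (e_sym : symmetric e) (e_irr : irreflexive e).
Implicit Types (f g : {set T}) (S : {set {set T}}).

(** For disjoint [f] and [g] the second clause says that they are opposite in a 4-cycle. *)
Definition conflict f g : bool :=
  (f != g) && ((f :&: g != set0) ||
    [exists p : T * T, exists q : T * T,
      [&& f == [set p.1; p.2], g == [set q.1; q.2], e p.1 q.1 & e p.2 q.2]]).

Lemma conflict_sym f g : conflict f g = conflict g f.
Proof.
suff imp f1 g1 : conflict f1 g1 -> conflict g1 f1 by apply/idP/idP; apply: imp.
rewrite /conflict eq_sym setIC => /andP[-> /orP[->|]] //=.
move=> /existsP[p /existsP[q /and4P[fp gq e1 e2]]]; apply/orP; right.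
by apply/existsP; exists q; apply/existsP; exists p; rewrite fp gq e_sym e1 e_sym e2.
Qed.

Definition conflicts S f : {set {set T}} := [set g in S | conflict f g].

Definition conflict_colorable K S : Prop :=
  exists c : {set T} -> nat, {in S, forall f, c f < K} /\
    {in S &, forall f g, conflict f g -> c f != c g}.

Lemma sub_conflict_colorable K S S' :
  S' \subset S -> conflict_colorable K S -> conflict_colorable K S'.
Proof.
move=> /subsetP sS [c [cK cS]]; exists c; split=> [f /sS/cK //|f g /sS fS /sS gS].
exact: cS.
Qed.

Lemma extend_coloring K S f : conflict_colorable K S -> #|conflicts S f| < K ->
  conflict_colorable K (f |: S).
Proof.
have [/setUidPr -> //|fS] := boolP ([set f] \subset S).
rewrite sub1set in fS.
move=> [c [cK cS]] deg.
have [k kP] : exists k : 'I_K, k \notin [set k : 'I_K | [exists g in conflicts S f, c g == k]].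
  apply/existsP; rewrite -negb_forall; apply: contraL deg => /forallP all_k.
  pose h g : option 'I_K := insub (c g).
  have EK : #|[set Some k | k : 'I_K]| = K.
    by rewrite card_imset ?card_ord //; exact: Some_inj.
  rewrite -leqNgt -[X in X <= _]EK; apply: (leq_trans _ (leq_imset_card h _)).
  apply: subset_leq_card; apply/subsetP => _ /imsetP[k _ ->].
  have := all_k k; rewrite inE => /exists_inP[g gC /eqP cg].
  by apply/imsetP; exists g; rewrite // /h cg valK.
exists (fun g => if g == f then nat_of_ord k else c g); split=> [g|g1 g2].
  by rewrite !inE; case: eqVneq => [_ _|_ /= /cK //]; exact: ltn_ord.
have nk g : g \in S -> conflict f g -> k != c g :> nat.
  move=> gS fg; apply: contra kP => /eqP Ek; rewrite inE; apply/exists_inP.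
  by exists g; rewrite ?inE ?gS // eq_sym; apply/eqP.
rewrite !inE; case: (eqVneq g1 f) => [->|g1f] /=; case: (eqVneq g2 f) => [->|g2f] /= h1 h2 cf.
- by rewrite /conflict eqxx in cf.
- exact: nk.
- by rewrite eq_sym; apply: nk => //; rewrite conflict_sym.
- exact: cS.
Qed.

Lemma extend_coloring_light K S S' : S \subset S' -> conflict_colorable K S ->
    {in S' :\: S, forall f, #|conflicts S' f| < K} -> conflict_colorable K S'.
Proof.
move: {2}#|S' :\: S| (leqnn #|S' :\: S|) => n; elim: n S => [|n IH] S Sn sub colS light.
  move: Sn; rewrite leqn0 cards_eq0 setD_eq0 => sub'.
  by have -> : S' = S by apply/eqP; rewrite eqEsubset sub sub'.
have [/eqP|[f]] := set_0Vmem (S' :\: S).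
  rewrite setD_eq0 => sub'; by have -> : S' = S by apply/eqP; rewrite eqEsubset sub sub'.
move=> fS; have := fS; rewrite inE => /andP[nfS fS'].
apply: (IH (f |: S)).
- have -> : S' :\: (f |: S) = (S' :\: S) :\ f.
    by apply/setP => g; rewrite !inE negb_or andbA.
  by have := cardsD1 f (S' :\: S); rewrite fS; slia.
- by rewrite subUset sub1set fS' sub.
- apply: extend_coloring => //; apply: leq_ltn_trans (light _ fS).
  by apply: subset_leq_card; apply/subsetP => g; rewrite !inE => /andP[/(subsetP sub)-> ->].
- by move=> g; rewrite !inE negb_or -andbA => /and3P[_ gS gS']; apply: light; rewrite inE gS.
Qed.

Lemma mem_edges x y : ([set x; y] \in edges e) = e x y.
Proof.
apply/imsetP/idP => [[[u v]]|exy]; last by exists (x, y); rewrite ?inE.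
rewrite inE /= => euv E; have uv : u != v by apply: contraTneq euv => ->; rewrite e_irr.
by have [[-> ->]|[-> ->]] := set2_eqP uv (esym E); rewrite ?euv // e_sym euv.
Qed.

Lemma edgesP f : f \in edges e -> exists x y, e x y /\ f = [set x; y].
Proof. by move=> /imsetP[[x y]]; rewrite inE; exists x, y. Qed.

Lemma edge_neq x y : e x y -> x != y.
Proof. by move=> exy; apply: contraTneq exy => ->; rewrite e_irr. Qed.

(** A conflicting edge meets [u], meets [v], or joins their neighbourhoods. A smaller [S] restricts
    the count to edges already colored. *)
Lemma conflicts_bound S u v : S \subset edges e -> e u v ->
  #|conflicts S [set u; v]| <= #|[set z in nbhd e u :\ v | [set u; z] \in S]| +
     #|[set z in nbhd e v :\ u | [set v; z] \in S]| +
     #|cross_edges (fun x y => [set x; y] \in S) (nbhd e u :\ v) (nbhd e v :\ u)|.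
Proof.
move=> /subsetP sS euv; have uv := edge_neq euv.
set A := [set z in _ | _]; set B := [set z in _ | _]; set C := cross_edges _ _ _.
apply: (@leq_trans #|[set [set u; z] | z in A] :|: [set [set v; z] | z in B] :|: C|); last first.
  apply: leq_trans (leq_card_setU _ _) _; rewrite leq_add2r.
  apply: leq_trans (leq_card_setU _ _) _; exact: leq_add (leq_imset_card _ _) (leq_imset_card _ _).
apply/subset_leq_card/subsetP => g; rewrite inE => /andP[gS /andP[fg conf]].
have inA z : g = [set u; z] -> g \in [set [set u; z] | z in A].
  move=> E; apply/imsetP; exists z => //; rewrite !inE -E gS andbT.
  by rewrite -mem_edges -E sS // andbT; apply: contraNneq fg => zv; rewrite E zv.
have inB z : g = [set v; z] -> g \in [set [set v; z] | z in B].
  move=> E; apply/imsetP; exists z => //; rewrite !inE -E gS andbT.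
  by rewrite -mem_edges -E sS // andbT; apply: contraNneq fg => zu; rewrite E zu setUC.
rewrite !in_setU; have [x [y [exy Eg]]] := edgesP (sS _ gS).
case/orP: conf => [/set0Pn[z]|/existsP[[p1 p2] /existsP[[q1 q2]] /= /and4P[/eqP Ef /eqP Eq e1 e2]]].
  rewrite {1}Eg !inE => /andP[/orP[]/eqP-> /orP[]/eqP E].
  - by apply/orP; left; apply/orP; left; apply: (inA y); rewrite Eg E.
  - by apply/orP; left; apply/orP; left; apply: (inA x); rewrite Eg E setUC.
  - by apply/orP; left; apply/orP; right; apply: (inB y); rewrite Eg E.
  - by apply/orP; left; apply/orP; right; apply: (inB x); rewrite Eg E setUC.
wlog : p1 p2 q1 q2 Ef Eq e1 e2 / p1 = u /\ p2 = v => [W|[Ep1 Ep2]].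
  have [E|[E1 E2]] := set2_eqP uv Ef; first exact: (W p1 p2 q1 q2).
  by apply: (W p2 p1 q2 q1); rewrite // [RHS]setUC.
move: e1 e2; rewrite Ep1 Ep2 => e1 e2.
have [E|q1v] := eqVneq q1 v; first by rewrite (inB q2) ?orbT // Eq E.
have [E|q2u] := eqVneq q2 u; first by rewrite (inA q1) // Eq E setUC.
apply/orP; right; apply/imsetP; exists (q1, q2) => //.
by rewrite !inE /= q1v q2u e1 e2 -Eq.
Qed.

End Conflicts.

(** * Heavy edges in a minimal counterexample *)

Section Reduction.
Variables (T : finType) (e : rel T).
Hypotheses (e_sym : symmetric e) (e_irr : irreflexive e).
Implicit Types (f g : {set T}) (S : {set {set T}}).
Variables (D m : nat).
Hypotheses (deg_le : forall x, #|nbhd e x| <= D).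
Hypothesis codeg_le : forall x y, x != y -> #|nbhd e x :&: nbhd e y| <= m.
Hypotheses (m38 : 38 <= m) (e_planar : z2_planar e).

Definition heavy x y := e x y && (D + m <= #|conflicts e (edges e) [set x; y]|).

Definition heavy_edges : {set {set T}} := [set f in edges e | D + m <= #|conflicts e (edges e) f|].

Definition del v : rel T := fun x y => [&& x != v, y != v & e x y].

Definition opposite v a : {set {set T}} := cross_edges heavy (nbhd e v :\ a) (nbhd e a :\ v).

Lemma heavy_sym : symmetric heavy.
Proof. by move=> x y; rewrite /heavy e_sym setUC. Qed.

(** If d(u) <= 2, then [u] has at most one neighbour w besides [v], and w shares at most m - 1
    further vertices with [v]. This leaves at most 1 + (D - 1) + (m - 1) conflicts. *)
Lemma heavy_degree u v : heavy u v -> 3 <= #|nbhd e u|.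
Proof.
move=> /andP[euv]; apply: contraLR; rewrite -!ltnNge ltnS => du.
apply: leq_ltn_trans (conflicts_bound e_sym e_irr (subxx _) euv) _.
have [X EX] : exists X, X = nbhd e u :\ v by eexists.
have uX : #|X|.+1 = #|nbhd e u| by rewrite (cardsD1 v (nbhd e u)) inE euv EX.
have vX : #|nbhd e v :\ u|.+1 = #|nbhd e v|.
  by rewrite (cardsD1 u (nbhd e v)) inE e_sym euv.
have h1 : #|[set z in nbhd e u :\ v | [set u; z] \in edges e]| <= #|X|.
  by rewrite EX; apply: subset_leq_card; apply/subsetP => z; rewrite !inE => /andP[].
have h2 : #|[set z in nbhd e v :\ u | [set v; z] \in edges e]| <= #|nbhd e v :\ u|.
  by apply: subset_leq_card; apply/subsetP => z; rewrite !inE => /andP[].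
have h3 : #|cross_edges (fun x y => [set x; y] \in edges e) (nbhd e u :\ v) (nbhd e v :\ u)| <= #|X| * m.-1.
  rewrite -EX; apply: leq_trans (leq_imset_card _ _) _; rewrite card_cross_pairs -sum_nat_const.
  apply: leq_sum => w wX; have wv : v != w by move: wX; rewrite EX !inE eq_sym => /andP[].
  have := codeg_le wv; rewrite (cardsD1 u) !inE e_sym euv /=.
  have -> : e w u by move: wX; rewrite EX !inE e_sym => /andP[].
  move=> /= le; suff : #|nbr (fun x y => [set x; y] \in edges e) (nbhd e v :\ u) w| <=
      #|(nbhd e v :&: nbhd e w) :\ u| by slia.
  apply: subset_leq_card; apply/subsetP => z; rewrite in_nbr mem_edges // !inE.
  by move=> /andP[/andP[-> ->] ->].
have h4 : #|X| * m.-1 <= m.-1.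
  have : #|X| <= 1 by slia.
  by case: #|X| => [|[|]] // _; rewrite mul1n.
by have := deg_le v; have := leq_trans h3 h4; slia.
Qed.

(** Combine [conflicts_bound] with [cross_edges_bound]. The alternative 2|X| + |Y| - 3 gives D + 38
    <= 3 d(u) + 2 d(v) - 8; the other one gives D + 43 <= 2 d(u) + 2 d(v), to which d(u) >= 3 is
    added. *)
Lemma heavy_degree_sum u v : heavy u v -> D + 46 <= 3 * #|nbhd e u| + 2 * #|nbhd e v|.
Proof.
move=> huv; have du := heavy_degree huv; case/andP: huv => euv heavy_uv.
have dv : 0 < #|nbhd e v| by rewrite card_gt0; apply/set0Pn; exists u; rewrite inE e_sym.
move: heavy_uv => /leq_trans/(_ (conflicts_bound e_sym e_irr (subxx _) euv)).
have uX : #|nbhd e u :\ v|.+1 = #|nbhd e u| by rewrite (cardsD1 v (nbhd e u)) inE euv.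
have vX : #|nbhd e v :\ u|.+1 = #|nbhd e v|.
  by rewrite (cardsD1 u (nbhd e v)) inE e_sym euv.
have h1 : #|[set z in nbhd e u :\ v | [set u; z] \in edges e]| <= #|nbhd e u :\ v|.
  by apply: subset_leq_card; apply/subsetP => z; rewrite !inE => /andP[].
have h2 : #|[set z in nbhd e v :\ u | [set v; z] \in edges e]| <= #|nbhd e v :\ u|.
  by apply: subset_leq_card; apply/subsetP => z; rewrite !inE => /andP[].
have -> : cross_edges (fun x y => [set x; y] \in edges e) (nbhd e u :\ v) (nbhd e v :\ u)
   = cross_edges e (nbhd e u :\ v) (nbhd e v :\ u).
  rewrite /cross_edges; suff -> : cross_pairs (fun x y => [set x; y] \in edges e) (nbhd e u :\ v)
    (nbhd e v :\ u) = cross_pairs e (nbhd e u :\ v) (nbhd e v :\ u) by [].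
  by apply/setP => p; rewrite !inE mem_edges //.
have := @cross_edges_bound T e e_sym e_irr e_planar u v (nbhd e u :\ v) (nbhd e v :\ u) euv.
have -> : nbhd e u :\ v != set0 by rewrite -card_gt0; slia.
move=> /(_ isT) h3.
have {h3} := h3 ltac:(by move=> x; rewrite !inE => /andP[]) ltac:(by move=> x; rewrite !inE => /andP[]).
by slia.
Qed.

Lemma del_sym v : symmetric (del v).
Proof. by move=> x y; rewrite /del andbCA e_sym. Qed.

Lemma del_irr v : irreflexive (del v).
Proof. by move=> x; rewrite /del e_irr !andbF. Qed.

(** Edges avoiding [v] that conflict in [e] also conflict in [del v]. Heaviness still refers to
    [e]. *)
Lemma colorable_without v K : conflict_colorable (del v) K (edges (del v)) ->
  conflict_colorable e K [set f in heavy_edges | v \notin f].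
Proof.
have sub f : f \in edges e -> v \notin f -> f \in edges (del v).
  move=> /edgesP[x [y [exy ->]]]; rewrite !inE negb_or => /andP[vx vy].
  by rewrite (mem_edges (@del_sym v) (@del_irr v)) /del eq_sym vx eq_sym vy.
move=> [c [cK cE]]; exists c; split=> [f|f g]; rewrite !inE.
  by move=> /andP[/andP[fe _] vf]; apply: cK; apply: sub.
move=> /andP[/andP[fe _] vf] /andP[/andP[ge _] vg] /andP[fg conf].
apply: cE; rewrite ?sub // /conflict fg; case/orP: conf => [-> //|].
move=> /existsP[[p1 p2] /existsP[[q1 q2] /= /and4P[Ef Eg e1 e2]]].
apply/orP; right; apply/existsP; exists (p1, p2); apply/existsP; exists (q1, q2).
rewrite Ef Eg /del e1 e2; move: vf vg; rewrite (eqP Ef) (eqP Eg) !inE !negb_or.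
by rewrite !(eq_sym v) => /andP[-> ->] /andP[-> ->].
Qed.

(** No edge of the set meets [v], at most D - 1 of them meet [a], and the other conflicting ones are
    opposite. *)
Lemma conflicts_opposite v a : e v a ->
  #|conflicts e [set f in heavy_edges | v \notin f] [set v; a]| < D + #|opposite v a|.
Proof.
move=> eva; set S := finset _.
have sS : S \subset edges e by apply/subsetP => f; rewrite !inE => /andP[/andP[]].
apply: leq_ltn_trans (conflicts_bound e_sym e_irr sS eva) _.
set A := finset _; set B := finset _; set C := cross_edges _ _ _.
have -> : A = set0.
  by apply/setP => z; rewrite !inE eqxx !andbF.
have hB : #|B| < #|nbhd e a|.
  rewrite (cardsD1 v (nbhd e a)) inE e_sym eva ltnS.
  by apply: subset_leq_card; apply/subsetP => z; rewrite inE => /andP[].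
have hC : #|C| <= #|opposite v a|.
  apply/subset_leq_card/subsetP => f /imsetP[[x y]]; rewrite !inE /= => /and3P[xv ya h] ->.
  apply/imsetP; exists (x, y) => //; rewrite !inE xv ya /heavy /=.
  by move: h => /andP[]; rewrite mem_edges.
by rewrite cards0; have := deg_le a; slia.
Qed.

Section Minimal.
Hypothesis not_colorable : ~ conflict_colorable e (D + m) (edges e).
Variable v : T.
Hypothesis del_colorable : conflict_colorable (del v) (D + m) (edges (del v)).

Lemma heavy_not_colorable : ~ conflict_colorable e (D + m) heavy_edges.
Proof.
move=> col; apply: not_colorable; apply: extend_coloring_light col _ => //.
  by apply/subsetP => f; rewrite inE => /andP[].
by move=> f; rewrite !inE => /andP[+ fe]; rewrite fe -ltnNge.
Qed.

Lemma heavy_at f : f \in heavy_edges -> v \in f -> exists a, heavy v a /\ f = [set v; a].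
Proof.
rewrite inE => /andP[fe hf]; have [x [y [exy Ef]]] := edgesP fe.
rewrite Ef !inE => /orP[]/eqP E; [exists y|exists x]; rewrite /heavy.
  by rewrite E exy -Ef.
by rewrite E setUC -Ef e_sym exy.
Qed.

Lemma reducible0 : exists a, heavy v a.
Proof.
apply/existsP; rewrite -[[exists _, _]]negbK negb_exists; apply/negP => /forallP nh.
apply: heavy_not_colorable; apply: sub_conflict_colorable (colorable_without del_colorable).
apply/subsetP => f fh; rewrite inE fh; apply/negP => /(heavy_at fh)[a [va _]].
by have := nh a; rewrite va.
Qed.

Lemma reducible1 a : heavy v a -> (forall b, heavy v b -> b = a) -> m < #|opposite v a|.
Proof.
move=> hva uniq_a; rewrite ltnNge; apply/negP => le; apply: heavy_not_colorable.
have col : conflict_colorable e (D + m) ([set v; a] |: [set f in heavy_edges | v \notin f]).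
  apply: extend_coloring; rewrite //; first exact: colorable_without.
  apply: leq_trans (conflicts_opposite _) _; first by case/andP: hva.
  by rewrite leq_add2l.
apply: sub_conflict_colorable col; apply/subsetP => f fh; rewrite in_setU1 inE fh /=.
have [vf|_] := boolP (v \in f); last by rewrite orbT.
by have [b [/uniq_a -> ->]] := heavy_at fh vf; rewrite eqxx.
Qed.

(** Color [va] before [va']. The latter then has one more conflict than [conflicts_opposite] counts,
    so the second bound is weaker by one. *)
Lemma reducible2 a a' : a != a' -> heavy v a -> heavy v a' ->
    (forall b, heavy v b -> b \in [set a; a']) ->
  m < #|opposite v a| \/ m <= #|opposite v a'|.
Proof.
move=> aa' hva hva' uniq_a; have [le|] := leqP; last by left.
right; rewrite leqNgt; apply/negP => lt; apply: heavy_not_colorable.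
pose S := [set f in heavy_edges | v \notin f].
have col : conflict_colorable e (D + m) ([set v; a] |: S).
  apply: extend_coloring; rewrite //; first exact: colorable_without.
  apply: leq_trans (conflicts_opposite _) _; first by case/andP: hva.
  by rewrite leq_add2l.
have col' : conflict_colorable e (D + m) ([set v; a'] |: ([set v; a] |: S)).
  apply: extend_coloring => //.
  have : #|conflicts e S [set v; a']| < D + #|opposite v a'|.
    by apply: conflicts_opposite; case/andP: hva'.
  have : #|conflicts e ([set v; a] |: S) [set v; a']| <= (#|conflicts e S [set v; a']|).+1.
    apply: leq_trans (_ : #|[set v; a] |: conflicts e S [set v; a']| <= _).
      apply/subset_leq_card/subsetP => f; rewrite !inE => /andP[/orP[->//|h ->]].
      by move: h => /andP[-> ->]; rewrite !orbT.
    by rewrite cardsU1; case: (_ \notin _); slia.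
  by slia.
apply: sub_conflict_colorable col'; apply/subsetP => f fh; rewrite !in_setU1 /S inE fh /=.
have [vf|_] := boolP (v \in f); last by rewrite !orbT.
have [b [/uniq_a + ->]] := heavy_at fh vf; rewrite !inE => /orP[]/eqP->; by rewrite eqxx ?orbT.
Qed.
End Minimal.
End Reduction.

(** * Discharging *)

(* Bollobas and Cockayne: every smallest dominating set that maximizes the    *)
(* number of its members outside [D] and of its internal edges has an         *)
(* external private neighbour for each member.                                *)
Lemma private_domination (T : finType) (g : rel T) (D : {set T}) :
    symmetric g -> irreflexive g -> (forall x, x \in D -> exists y, g x y) ->
  exists (C : {set T}) (p : T -> T),
    [/\ forall x, x \in D -> x \in C \/ exists2 c, c \in C & g x c,
        {in C &, injective p} &
        forall c, c \in C -> [/\ p c \in D, p c \notin C & g (p c) c]].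
Proof.
move=> g_sym g_irr D_nbr.
pose dom (C : {set T}) := [forall x in D, (x \in C) || [exists c in C, g x c]].
pose pairs (C : {set T}) := [set z : T * T | [&& z.1 \in C, z.2 \in C & g z.1 z.2]].
pose pot (C : {set T}) := #|C :\: D| + #|pairs C|.
have domD : dom D by apply/forall_inP => x ->.
have [C0 domC0 minC0] := arg_minnP (fun C : {set T} => #|C|) domD.
have dC0 : dom C0 && (#|C0| <= #|C0|) by rewrite domC0 /=.
have [C] := arg_maxnP pot (P := fun C => dom C && (#|C| <= #|C0|)) dC0.
move=> /andP[domC leC] maxC.
have privP c : c \in C -> exists x, [/\ x \in D, x \notin C, g x c & forall c', c' \in C -> g x c' -> c' = c].
  move=> cC; have lt : #|C :\ c| < #|C0| by rewrite (cardsD1 c C) cC in leC.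
  have : ~~ dom (C :\ c) by apply: contraL lt => /minC0; rewrite -leqNgt.
  rewrite negb_forall => /existsP[x]; rewrite negb_imply => /andP[xD].
  rewrite negb_or negb_exists => /andP[xCc /forallP x_nbr].
  have x_only c' : c' \in C -> g x c' -> c' = c.
    move=> c'C gxc'; apply/eqP; have := x_nbr c'; rewrite gxc' andbT !inE c'C andbT negbK.
    by [].
  have [xC|xC] := boolP (x \in C); last first.
    exists x; split=> //; have /forall_inP/(_ _ xD) := domC.
    by rewrite (negPf xC) => /exists_inP[c' c'C gxc']; rewrite -(x_only _ c'C gxc').
  have xc : x = c by move: xCc; rewrite !inE xC andbT negbK => /eqP.
  rewrite {}xc {xCc xC} in xD x_nbr x_only *.
  have [/existsP[y /and4P[yD yC gyc /forallP y_only]]|none] :=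
      boolP [exists y, [&& y \in D, y \notin C, g y c & [forall c', (c' \in C) && g y c' ==> (c' == c)]]].
    exists y; split=> // c' c'C gyc'; apply/eqP; have := y_only c'.
    by rewrite c'C gyc'.
  have other y : y \in D -> y \notin C -> exists2 c', c' \in C :\ c & g y c'.
    move=> yD yC; apply/exists_inP; move: none; apply: contraNT; rewrite negb_exists => /forallP y_nbr.
    have y_only c' : c' \in C -> g y c' -> c' = c.
      move=> c'C gyc'; apply/eqP; have := y_nbr c'; rewrite gyc' andbT !inE c'C andbT negbK.
      by [].
    apply/existsP; exists y; rewrite yD yC /=; apply/andP; split.
      have /forall_inP/(_ _ yD) := domC.
      by rewrite (negPf yC) => /exists_inP[c' c'C gyc']; rewrite -(y_only _ c'C gyc').
    by apply/forallP => c'; apply/implyP => /andP[c'C /(y_only _ c'C) ->].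
  (* Here [c] is isolated in [C] and has no external private neighbour. Replacing it by a neighbour
     [z] keeps domination and size but raises [pot]: through [z] itself if it lies outside [D],
     otherwise through an edge from [z] to [C :\ c]. *)
  have [z gcz] := D_nbr _ xD.
  have zc : z != c by apply: contraTneq gcz => ->; rewrite g_irr.
  have zC : z \notin C by apply: contra zc => zC; rewrite (x_only _ zC gcz).
  have zCc : z \notin C :\ c by rewrite !inE negb_and zC orbT.
  have domC' : dom (z |: (C :\ c)).
    apply/forall_inP => x' x'D; have [->|x'c] := eqVneq x' c.
      by apply/orP; right; apply/exists_inP; exists z; rewrite ?setU11.
    rewrite !inE x'c /=; have [x'C|x'C] := boolP (x' \in C); first by rewrite orbT.
    have [c' c'C gx'] := other _ x'D x'C.
    by apply/orP; right; apply/exists_inP; exists c'; rewrite // in_setU1 c'C orbT.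
  have cardC' : #|z |: (C :\ c)| <= #|C0|.
    by rewrite cardsU1 zCc add1n.
  have := maxC (z |: (C :\ c)); rewrite domC' cardC' => /(_ isT).
  have h1 : (z \notin D) + #|C :\: D| <= #|(z |: (C :\ c)) :\: D|.
    have sub : C :\: D \subset (z |: (C :\ c)) :\: D.
      apply/subsetP => x'; rewrite !inE => /andP[x'D ->]; rewrite x'D /= andbT.
      by apply/orP; right; apply: contraNneq x'D => ->.
    have [zD|zD] := boolP (z \in D); first exact: subset_leq_card.
    rewrite add1n; apply: proper_card; apply/properP; split=> //.
    by exists z; rewrite !inE ?eqxx ?zD // (negPf zC) andbF.
  have subp : pairs C \subset pairs (z |: (C :\ c)).
    apply/subsetP => -[u v]; rewrite !inE /= => /and3P[uC vC guv]; rewrite uC vC guv !andbT.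
    have uc : u != c.
      apply: contraTneq guv => uc; rewrite uc; apply/negP => gcv.
      by have := x_only _ vC gcv => vc; rewrite vc g_irr in gcv.
    have vc : v != c.
      apply: contraTneq guv => vc; rewrite vc g_sym; apply/negP => gcu.
      by have := x_only _ uC gcu => uc'; rewrite uc' eqxx in uc.
    by rewrite uc vc !orbT.
  have h2 : (z \in D) + #|pairs C| <= #|pairs (z |: (C :\ c))|.
    have [zD|zD] := boolP (z \in D); last exact: subset_leq_card.
    rewrite add1n; apply: proper_card; apply/properP; split=> //.
    have [c' c'C gzc'] := other _ zD zC.
    exists (z, c'); last by rewrite inE /= (negPf zC).
    by rewrite inE /= gzc' setU11 in_setU1 c'C orbT.
  rewrite /pot; move: h1 h2; case: (z \in D) => /=; slia.
pose p c := odflt c [pick x | [&& x \in D, x \notin C, g x c & [forall c' in C, g x c' ==> (c' == c)]]].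
have pP c : c \in C -> [/\ p c \in D, p c \notin C, g (p c) c & forall c', c' \in C -> g (p c) c' -> c' = c].
  move=> cC; rewrite /p; case: pickP => [x /and4P[xD xC gxc /forall_inP x_only]|none] /=.
    by split=> // c' c'C gxc'; apply/eqP; have := x_only _ c'C; rewrite gxc'.
  have [x [xD xC gxc x_only]] := privP _ cC; have := none x.
  rewrite xD xC gxc /= => /negP[]; apply/forall_inP => c' c'C; apply/implyP => gxc'.
  by rewrite (x_only _ c'C gxc').
exists C, p; split=> [x xD|c c' cC c'C E|c /pP[]//].
  have /forall_inP/(_ _ xD)/orP[|/exists_inP[c cC gxc]] := domC; first by left.
  by right; exists c.
have [_ _ gc _] := pP _ cC; have [_ _ _ only] := pP _ c'C.
by apply: only; rewrite -?E.
Qed.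

Lemma leq_card_cover (I T : finType) (S : {set T}) (R : {set I}) (F : I -> {set T}) :
  (forall x, x \in S -> exists2 i, i \in R & x \in F i) -> #|S| <= \sum_(i in R) #|F i|.
Proof.
move=> SF; apply: (@leq_trans #|\bigcup_(i in R) F i|).
  by apply/subset_leq_card/subsetP => x /SF[i iR xF]; apply/bigcupP; exists i.
elim/big_rec2: _ => [|i n A _ le]; first by rewrite cards0.
by apply: leq_trans (leq_card_setU _ _) _; rewrite leq_add2l.
Qed.

Lemma sum_indicator (T : finType) (S : {set T}) (P : pred T) :
  \sum_(x in S) (P x : nat) = #|[set x in S | P x]|.
Proof.
rewrite -sum1_card big_mkcond [RHS]big_mkcond; apply: eq_bigr => x _.
by rewrite inE; case: (x \in S); case: (P x).
Qed.

Section Discharging.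
Variables (T : finType) (e hv : rel T) (D m : nat).
Hypotheses (e_sym : symmetric e) (e_irr : irreflexive e) (e_planar : z2_planar e).
Local Notation N x := [set y | e x y].
Local Notation d x := #|[set y | e x y]|.
Local Notation opp v a := (cross_edges hv (N v :\ a) (N a :\ v)).
Hypotheses (hv_sym : symmetric hv) (hv_e : forall x y, hv x y -> e x y).
Hypotheses (m38 : 38 <= m) (deg_le : forall x, d x <= D).
Hypothesis codeg_le : forall x y, x != y -> #|N x :&: N y| <= m.
Hypothesis hv_deg : forall x y, hv x y -> 3 <= d x.
Hypothesis hv_degs : forall x y, hv x y -> D + 46 <= 3 * d x + 2 * d y.
Hypothesis has_hv : forall x, 0 < d x -> exists y, hv x y.
Hypothesis only_hv : forall v a, hv v a -> (forall b, hv v b -> b = a) -> m < #|opp v a|.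
Hypothesis only_hv2 : forall v a a', a != a' -> hv v a -> hv v a' ->
  (forall b, hv v b -> b \in [set a; a']) -> m < #|opp v a| \/ m <= #|opp v a'|.
Hypothesis has_edge : exists x, 0 < d x.

Definition big k := [set y | k <= d y].
(** For d(x) <= 11 this bounds from below the degree of the other end y of a heavy edge at x. It
    solves D + 46 <= 3 d(x) + 2 d(y), with D >= d(y) for 31 and D >= 31 for 27 and 22. *)
Definition thr x := if d x <= 5 then 31 else if d x <= 8 then 27 else 22.
Definition bigN x := N x :&: big 12.

Let e_neq x y : e x y -> x != y.
Proof. by move=> exy; apply: contraTneq exy => ->; rewrite e_irr. Qed.

Let deg3 x y : e x y -> 3 <= d x.
Proof.
move=> exy; have [|z] := @has_hv x; last exact: hv_deg.
by rewrite card_gt0; apply/set0Pn; exists y; rewrite inE.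
Qed.

Let U := [set x | 0 < d x].

Let nbrU x : nbr e U x = N x.
Proof.
apply/setP => y; rewrite in_nbr !inE; case exy: (e x y); rewrite ?andbF // andbT.
by rewrite card_gt0; apply/set0Pn; exists x; rewrite inE e_sym.
Qed.

Let d3 x : x \in U -> 3 <= d x.
Proof. by rewrite inE card_gt0 => /set0Pn[y]; rewrite inE => /deg3. Qed.

Let euler : \sum_(x in U) d x + 12 <= 6 * #|U|.
Proof.
have U3 : 3 <= #|U|.
  have [x0 x0U] := has_edge; apply: leq_trans (@d3 x0 _) (subset_leq_card _); first by rewrite inE.
  by rewrite -nbrU; apply/subsetP => y; rewrite in_nbr => /andP[].
apply: leq_trans _ (euler_bound e_sym e_irr e_planar U3).
by rewrite leq_add2r; apply: leq_sum => x _; rewrite nbrU.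
Qed.

Lemma max_degree_ge31 : 31 <= D.
Proof.
have [/existsP[x /andP[xU x5]]|none] := boolP [exists x, (x \in U) && (d x <= 5)].
  have [y hxy] : exists y, hv x y by apply: has_hv; move: xU; rewrite inE.
  by have := hv_degs hxy; have := deg_le y; slia.
have : \sum_(x in U) 6 <= \sum_(x in U) d x.
  apply: leq_sum => x xU; rewrite ltnNge; apply: contra none => x5; apply/existsP; exists x.
  by rewrite xU.
by rewrite sum_nat_const; move: euler; set s := \sum_(x in _) _; clearbody s; slia.
Qed.

Lemma sub_big k l : k <= l -> big l \subset big k.
Proof. by move=> kl; apply/subsetP => y; rewrite !inE; apply: leq_trans. Qed.

Lemma thr_ge x : 22 <= thr x.
Proof. by rewrite /thr; do 2?case: ifP. Qed.

Lemma hv_thr b y : hv b y -> b \notin big 12 -> y \in big (thr b).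
Proof.
move=> hby; rewrite !inE -ltnNge => db; have := hv_degs hby; have := hv_deg hby.
by have := max_degree_ge31; rewrite /thr; case: ifP => h1; [|case: ifP => h2]; slia.
Qed.

Lemma opp_le v a : #|opp v a| <= \sum_(b in N v :\ a) #|nbr hv (N a :\ v) b|.
Proof. by apply: leq_trans (leq_imset_card _ _) _; rewrite card_cross_pairs. Qed.

Definition crowded := [set b | (b \notin big 12) && (9 <= #|nbr e (big 22) b|)].

(** At least 39 heavy edges are opposite to the only heavy edge [va]. They start at the at most four
    other neighbours of [v], each of which sends at most 10, since its degree is at most 11 and [v]
    is not big. So there are four, and each sends at least 9. *)
Lemma one_big_nbr v : 0 < d v -> d v <= 5 -> #|bigN v| = 1 -> 4 <= #|nbr e crowded v|.
Proof.
move=> v0 v5 /eqP/cards1P[a va].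
have hv_a b : hv v b -> b = a.
  move=> hvb; apply/set1P; rewrite -va !inE (hv_e hvb) /=.
  have := hv_thr hvb; rewrite !inE -ltnNge => /(_ ltac:(slia)).
  by have := thr_ge v; slia.
have [a1 hva1] := has_hv v0; have hva : hv v a by rewrite -(hv_a _ hva1).
have := leq_trans (only_hv hva hv_a) (opp_le v a).
have av : a \in N v by rewrite inE hv_e.
have dS : #|N v :\ a|.+1 = d v by rewrite (cardsD1 a (N v)) av.
have nb b : b \in N v :\ a -> b \notin big 12.
  rewrite in_setD1 => /andP[ba bv]; apply: contraNN ba => bA.
  by rewrite -in_set1 -va in_setI bv bA.
have sub b : b \in N v :\ a -> #|nbr hv (N a :\ v) b| <= #|nbr e (big 22) b|.
  move=> /nb bA; apply/subset_leq_card/subsetP => y; rewrite !in_nbr => /andP[_ hby].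
  by rewrite hv_e // andbT (subsetP (sub_big (thr_ge b))) // hv_thr.
have le10 b : b \in N v :\ a -> #|nbr e (big 22) b| <= 10.
  move=> bS; have := nb _ bS; rewrite inE -ltnNge.
  suff : #|nbr e (big 22) b| < d b by slia.
  rewrite (cardsD1 v (N b)) inE e_sym; have -> : e v b by move: bS; rewrite !inE => /andP[].
  rewrite add1n ltnS; apply/subset_leq_card/subsetP => y; rewrite !inE => /andP[y22 ->].
  by rewrite andbT; apply: contraTneq y22 => ->; slia.
move=> m_lt; have all9 b : b \in N v :\ a -> b \in crowded.
  move=> bS; rewrite inE nb //=; rewrite leqNgt; apply/negP => b8.
  move: m_lt; rewrite (big_setD1 b bS) /=.
  have : \sum_(i in (N v :\ a) :\ b) #|nbr hv (N a :\ v) i| <= #|(N v :\ a) :\ b| * 10.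
    rewrite -sum_nat_const; apply: leq_sum => i; rewrite in_setD1 => /andP[_ iS].
    exact: leq_trans (sub _ iS) (le10 _ iS).
  have := cardsD1 b (N v :\ a); rewrite bS.
  by have := sub _ bS; set s := \sum_(i in _) _; clearbody s; slia.
have : \sum_(i in N v :\ a) #|nbr hv (N a :\ v) i| <= #|N v :\ a| * 10.
  rewrite -sum_nat_const; apply: leq_sum => i iS; exact: leq_trans (sub _ iS) (le10 _ iS).
move: m_lt; set s := \sum_(i in _) _ => m_lt s_le.
have : 3 < #|N v :\ a| by clearbody s; slia.
move=> /leq_trans -> //; apply/subset_leq_card/subsetP => b bS.
by rewrite in_nbr all9 //=; move: bS; rewrite !inE => /andP[].
Qed.

Definition one_big := [set v | [&& 0 < d v, d v <= 5 & #|bigN v| == 1]].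

(** With Q = [one_big], X = [crowded] and L = [big 22], two bipartite bounds give |Q| < |X| and 7|X|
    < 2|L|. *)
Lemma card_one_big : 3 * #|one_big| <= #|big 22|.
Proof.
have [->|[v0 v0Q]] := set_0Vmem one_big; first by rewrite cards0 muln0.
have Q4 v : v \in one_big -> 4 <= #|nbr e crowded v|.
  by rewrite inE => /and3P[v1 v5 /eqP v2]; apply: one_big_nbr.
have [x0 x0X] : exists x, x \in crowded.
  have : 0 < #|nbr e crowded v0| by apply: leq_trans (Q4 _ v0Q).
  by rewrite card_gt0 => /set0Pn[x]; rewrite in_nbr => /andP[xX _]; exists x.
have dQX : [disjoint one_big & crowded].
  apply/pred0P => v /=; apply/negP => /andP[]; rewrite !inE => /and3P[_ v5 _] /andP[_ v9].
  have : #|nbr e (big 22) v| <= d v by apply/subset_leq_card/subsetP => y; rewrite !inE => /andP[].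
  by slia.
have dXL : [disjoint crowded & big 22].
  apply/pred0P => v /=; apply/negP => /andP[]; rewrite inE => /andP[vA _].
  by move=> /(subsetP (sub_big (isT : 12 <= 22))); rewrite (negPf vA).
have X4 : 4 <= #|crowded|.
  apply: leq_trans (Q4 _ v0Q) (subset_leq_card _).
  by apply/subsetP => y; rewrite in_nbr => /andP[].
have := bipartite_bound e_sym e_planar dQX; have := bipartite_bound e_sym e_planar dXL.
have : #|crowded| * 9 <= \sum_(x in crowded) #|nbr e (big 22) x|.
  by rewrite -sum_nat_const; apply: leq_sum => x; rewrite inE => /andP[].
have : #|one_big| * 4 <= \sum_(x in one_big) #|nbr e crowded x|.
  by rewrite -sum_nat_const; apply: leq_sum => x /Q4.
set s1 := \sum_(x in crowded) _; set s2 := \sum_(x in one_big) _; clearbody s1 s2.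
move=> h1 h2 /(_ ltac:(slia)) h3 /(_ ltac:(slia)) h4; slia.
Qed.

(** If [v b] is an edge, contracting it gives a vertex with three neighbours of degree at least
    [thr b]. *)
Definition rich v b := 3 <= #|big (thr b) :&: (N v :|: N b)|.

Definition two_big_rich :=
  [set v | [&& 0 < d v, d v <= 5, #|bigN v| == 2 & [exists b in N v :\: big 12, rich v b]]].

Lemma paired_bigN (C : {set T}) (p : T -> T) k : 12 <= k -> {in C &, injective p} ->
    (forall c, c \in C -> [/\ p c \in two_big_rich, p c \notin C, e (p c) c, c \notin big 12 &
       rich (p c) c \/ rich c (p c)]) ->
    (forall c, c \in C -> k <= thr c) -> #|C| <= 2 * #|big k|.
Proof.
move=> k12 p_inj Cp Ck.
apply: (paired_bound e_sym e_irr e_planar p_inj) => c cC; have [pQ pC epc cA richc] := Cp _ cC.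
  split=> //; apply: contra (subsetP (sub_big k12) _) _ => //.
  by move: pQ; rewrite !inE -ltnNge => /and4P[_ p5 _ _]; slia.
have kp : k <= thr (p c).
  apply: leq_trans (Ck _ cC) _; move: pQ; rewrite inE /thr => /and4P[_ -> _ _].
  by case: ifP => _; [|case: ifP].
have nbrT x : nbr e setT x = N x by apply/setP => y; rewrite !inE.
rewrite !nbrT; case: richc => h; apply: leq_trans h (subset_leq_card _).
  by rewrite [N c :|: _]setUC; apply/setSI/sub_big/Ck.
exact/setSI/sub_big.
Qed.

(** [C] dominates in the graph of rich pairs, each member having a private neighbour. Contracting
    these pairs bounds the number of members of each threshold ([paired_bigN]). The weight 12 - d(c)
    is what [c] lacks in order to pay like a vertex of degree 12. *)
Lemma rich_domination : exists C : {set T},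
  [/\ forall v, v \in two_big_rich -> v \in C \/ exists2 c, c \in C & e v c,
      forall c, c \in C -> 0 < d c, forall c, c \in C -> c \notin big 12 &
      \sum_(c in C) (12 - d c) <= 6 * (#|big 22| + #|big 27| + #|big 31|)].
Proof.
pose g x y := [&& e x y, x \notin big 12, y \notin big 12 &
  (x \in two_big_rich) && rich x y || (y \in two_big_rich) && rich y x].
have g_sym : symmetric g by move=> x y; rewrite /g e_sym orbC; do 2!bool_congr; rewrite andbCA.
have g_irr : irreflexive g by move=> x; rewrite /g e_irr.
have g_nbr x : x \in two_big_rich -> exists y, g x y.
  move=> xQ; have := xQ; rewrite inE => /and4P[_ x5 _ /exists_inP[b]].
  rewrite in_setD inE => /andP[bA exb] h; exists b.
  by rewrite /g exb bA xQ h inE -ltnNge /= andbT; slia.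
have [C [p [C_dom p_inj Cp]]] := private_domination g_sym g_irr g_nbr.
have {}Cp c : c \in C -> [/\ p c \in two_big_rich, p c \notin C, e (p c) c, c \notin big 12 &
       rich (p c) c \/ rich c (p c)].
  move=> /Cp[pQ pC /and4P[epc pA cA /orP[]/andP[_ h]]]; split=> //; by [left|right].
have Cbound k : 12 <= k -> #|[set c in C | k <= thr c]| <= 2 * #|big k|.
  move=> k12; apply: (@paired_bigN _ p) => //.
  - by move=> x y; rewrite !inE => /andP[xC _] /andP[yC _]; apply: p_inj.
  - move=> c; rewrite inE => /andP[/Cp[pQ pC epc cA richc] _]; split=> //.
    by rewrite inE (negPf pC).
  by move=> c; rewrite inE => /andP[].
exists C; split.
- move=> v /C_dom[|[c cC /and4P[evc _ _ _]]]; [by left|right; by exists c].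
- by move=> c /Cp[_ _ epc _ _]; rewrite card_gt0; apply/set0Pn; exists (p c); rewrite inE e_sym.
- by move=> c /Cp[].
(* 12 - d(c) is at most 3, 6, 9 when d(c) is at least 9, 6, 3, that is, when [thr c] is 22, 27,
   31. *)
have cost c : c \in C -> 12 - d c <= 3 * (22 <= thr c) + 3 * (27 <= thr c) + 3 * (31 <= thr c).
  move=> cC; have [_ _ epc _ _] := Cp _ cC; have := @deg3 c (p c); rewrite e_sym epc => /(_ isT).
  by rewrite /thr; case: (leqP (d c) 5) => h1; [|case: (leqP (d c) 8) => h2] => /=; slia.
apply: (@leq_trans (\sum_(c in C)
    (3 * (22 <= thr c) + 3 * (27 <= thr c) + 3 * (31 <= thr c)))); first exact: leq_sum.
have sumE k : \sum_(c in C) 3 * (k <= thr c) = 3 * #|[set c in C | k <= thr c]|.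
  by rewrite -sum1_card big_distrr big_mkcond [RHS]big_mkcond; apply: eq_bigr => c _;
    rewrite inE; case: (c \in C); case: (k <= _).
rewrite 2!big_split !sumE /=.
have := Cbound 22 isT; have := Cbound 27 isT; have := Cbound 31 isT; slia.
Qed.

(** * Small vertices with two big neighbours and no rich pair *)

Definition two_big_poor := [set v | [&& 0 < d v, d v <= 5, #|bigN v| == 2 & v \notin two_big_rich]].

(* If [v] is in [two_big_poor], then [o] is the only heavy neighbour of each   *)
(* vertex in [owned v o].                                                     *)
Definition owned v o := [set b in N v :\: big 12 | hv b o && (N b :&: bigN v == [set o])].

Section Poor.
Variable v : T.
Hypothesis v_poor : v \in two_big_poor.

Let v0 : 0 < d v. Proof. by move: v_poor; rewrite inE => /and4P[]. Qed.
Let v5 : d v <= 5. Proof. by move: v_poor; rewrite inE => /and4P[]. Qed.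
Let v2 : #|bigN v| = 2. Proof. by move: v_poor; rewrite inE => /and4P[_ _ /eqP-> _]. Qed.
Let poor b : b \in N v -> b \notin big 12 -> #|big (thr b) :&: (N v :|: N b)| <= 2.
Proof.
move=> bv bA; have := v_poor; rewrite inE => /and4P[_ _ _]; rewrite inE v0 v5 v2 eqxx /=.
move=> /exists_inP none; rewrite leqNgt; apply/negP => h; apply: none; exists b => //.
by rewrite in_setD bA bv.
Qed.
Let vA : v \notin big 12. Proof. by rewrite inE -ltnNge; slia. Qed.

Lemma hv_bigN y : hv v y -> y \in bigN v.
Proof.
move=> hvy; rewrite in_setI inE hv_e //=.
by apply: (subsetP (sub_big _)) (hv_thr hvy vA); have := thr_ge v; slia.
Qed.

Lemma thr_le b : thr b <= 31.
Proof. by rewrite /thr; do 2?case: ifP. Qed.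

(** If d(o) <= 30, the other big neighbour [a] carries the only heavy edge at [v]. Opposite to it
    are at most 29 heavy edges at [o] and one at each of at most three small neighbours, as each of
    these sees at most one sufficiently big vertex besides [a]. These are fewer than 39. *)
Lemma poor_big o : o \in bigN v -> 31 <= d o.
Proof.
move=> oA; rewrite leqNgt; apply/negP => o30.
have [a hva] := has_hv v0; have aA := hv_bigN hva.
have big31 y : hv v y -> 31 <= d y.
  by move=> hvy; have := hv_thr hvy vA; rewrite inE /thr v5.
have a31 := big31 _ hva; have ao : a != o by apply: contraTneq o30 => <-; rewrite -leqNgt.
have bigE : bigN v = [set a; o].
  by apply/esym/eqP; rewrite eqEcard subUset !sub1set aA oA v2 cards2 ao.
have only b : hv v b -> b = a.
  move=> hvb; have := hv_bigN hvb; rewrite bigE !inE => /orP[]/eqP // bo.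
  by move: o30; rewrite -bo ltnNge big31.
have ov : o \in N v by move: oA; rewrite in_setI => /andP[].
have av : a \in N v by move: aA; rewrite in_setI => /andP[].
have oS : o \in N v :\ a by rewrite in_setD1 eq_sym ao ov.
have := leq_trans (only_hv hva only) (opp_le v a); rewrite (big_setD1 o oS) /=.
have ho : #|nbr hv (N a :\ v) o| < d o.
  rewrite (cardsD1 v (N o)) inE e_sym; have -> : e v o by move: ov; rewrite inE.
  rewrite add1n ltnS; apply/subset_leq_card/subsetP => y; rewrite !inE => /andP[/andP[-> _]].
  exact: hv_e.
have : \sum_(b in (N v :\ a) :\ o) #|nbr hv (N a :\ v) b| <= #|(N v :\ a) :\ o| * 1.
  rewrite -sum_nat_const; apply: leq_sum => b; rewrite !in_setD1 => /and3P[bo ba bv].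
  have bA : b \notin big 12.
    by apply/negP => bA; move: bo ba; rewrite -in_set1 -[b != a]negbK -in_set1;
       have : b \in bigN v by [rewrite in_setI bv bA]; rewrite bigE !inE => /orP[]->.
  have := poor bv bA; rewrite (cardsD1 a) in_setI in_setU av /= inE.
  rewrite (leq_trans (thr_le b) a31) /= add1n ltnS; apply: leq_trans.
  apply/subset_leq_card/subsetP => y; rewrite in_nbr in_setD1 => /andP[/andP[yv ya] hby].
  rewrite in_setD1 in_setI (hv_thr hby bA) in_setU !inE (hv_e hby) orbT !andbT.
  by rewrite inE in ya; rewrite eq_sym e_neq.
have := cardsD1 a (N v); rewrite av; have := cardsD1 o (N v :\ a); rewrite oS.
by set s := \sum_(b in _) _; clearbody s; slia.
Qed.

Lemma poor_nbrs b : b \in N v -> b \notin big 12 -> big (thr b) :&: (N v :|: N b) = bigN v.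
Proof.
move=> bv bA; apply/esym/eqP; rewrite eqEcard v2 poor // andbT.
apply/subsetP => o oA; rewrite in_setI in_setU; move: (oA); rewrite in_setI => /andP[-> _].
by rewrite andbT inE (leq_trans (thr_le b)) // poor_big.
Qed.

Lemma poor_hv b y : b \in N v -> b \notin big 12 -> hv b y -> y \in bigN v.
Proof.
move=> bv bA hby; rewrite -(poor_nbrs bv bA) in_setI (hv_thr hby bA) in_setU.
by rewrite !inE (hv_e hby) orbT.
Qed.

(** By [poor_hv] every opposite heavy edge ends at [a']. Its other end is a common neighbour of [a]
    and [a'] different from [v], or else misses [a] and is owned by [a']. *)
Lemma poor_opp a a' : a != a' -> bigN v = [set a; a'] ->
  #|opp v a| < #|N a :&: N a'| + e a a' * #|owned v a'|.
Proof.
move=> aa' bigE.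
have av : a \in bigN v by rewrite bigE set21.
have a'v : a' \in bigN v by rewrite bigE set22.
have vN : v \in N a :&: N a'.
  by move: av a'v; rewrite !inE e_sym => /andP[-> _]; rewrite e_sym => /andP[-> _].
pose S1 := [set [set a'; y] | y in (N a :&: N a') :\ v].
pose S2 := if e a a' then [set [set b; a'] | b in owned v a'] else set0.
apply: (@leq_ltn_trans #|S1 :|: S2|).
  apply/subset_leq_card/subsetP => f /imsetP[[b y] byP ->].
  have /and3P[/andP[ba evb] /andP[yv eay] hby] : [&& (b != a) && e v b, (y != v) && e a y & hv b y].
    by move: byP; rewrite !inE.
  rewrite in_setU; have [Eb|ba'] := eqVneq b a'.
    apply/orP; left; apply/imsetP; exists y; last by rewrite Eb.
    by rewrite !inE yv eay /= -Eb hv_e.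
  have bA : b \notin big 12.
    apply/negP => bA; have : b \in bigN v by rewrite in_setI bA inE evb.
    by rewrite bigE !inE (negPf ba) (negPf ba').
  have bv : b \in N v by rewrite inE.
  have := poor_hv bv bA hby; rewrite bigE !inE => /orP[]/eqP Ey.
    by rewrite Ey e_irr in eay.
  rewrite Ey in hby eay yv *; have [eba|neba] := boolP (e b a).
    apply/orP; left; apply/imsetP; exists b; last by rewrite setUC.
    by rewrite !inE e_sym eba (e_sym a') hv_e // andbT; rewrite eq_sym e_neq.
  apply/orP; right; rewrite /S2 eay; apply/imsetP; exists b => //.
  rewrite in_set in_setD bA bv hby /= bigE; apply/eqP/setP => z; rewrite !inE.
  have [->|za'] := eqVneq z a'; first by rewrite hv_e // orbT.
  by have [->|za] := eqVneq z a; rewrite ?(negPf neba) ?andbF.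
have h1 : #|S1| < #|N a :&: N a'|.
  by rewrite (cardsD1 v (N a :&: N a')) vN add1n ltnS leq_imset_card.
have h2 : #|S2| <= e a a' * #|owned v a'|.
  by rewrite /S2; case: (e a a'); rewrite ?cards0 // mul1n leq_imset_card.
have := leq_card_setU S1 S2; move=> [+ _].
by move: h2; set q := _ * _; clearbody q; slia.
Qed.

Definition deltas := [set b in N v :\: big 12 | [exists o in bigN v, b \in owned v o]].

(** Reducibility demands more than m opposite heavy edges at one of the two big neighbours or at
    least m at both. As they share at most m vertices, [poor_opp] forces them to be adjacent and to
    own two small neighbours of [v]; and as at most three can be owned, they share almost m
    vertices. *)
Lemma poor_structure : exists a a',
  [/\ bigN v = [set a; a'], a != a', e a a', 36 <= #|N a :&: N a'| & 2 <= #|deltas|].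
Proof.
have [a [a' [aa' bigE]]] : exists a a', a != a' /\ bigN v = [set a; a'].
  by apply/cards2P; rewrite v2.
exists a, a'.
have a'a : a' != a by rewrite eq_sym.
have bigE' : bigN v = [set a'; a] by rewrite setUC.
have h1 := poor_opp aa' bigE; have h2 := poor_opp a'a bigE'.
rewrite [N a' :&: _]setIC (e_sym a') in h2.
have [R1 R2] : (m < #|opp v a| \/ m <= #|opp v a'|) /\ (m < #|opp v a'| \/ m <= #|opp v a|).
  have hvE y : hv v y -> y = a \/ y = a'.
    by move/hv_bigN; rewrite bigE !inE => /orP[]/eqP; [left|right].
  have [h|nh] := boolP (hv v a); have [h'|nh'] := boolP (hv v a').
  - by split; apply: only_hv2 => // y /hvE[]->; rewrite !inE eqxx ?orbT.
  - have lt : m < #|opp v a|.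
      apply: only_hv => // y hy; have [//|E] := hvE _ hy; by rewrite E (negPf nh') in hy.
    by split; [left|right; apply: ltnW].
  - have lt : m < #|opp v a'|.
      apply: only_hv => // y hy; have [E|//] := hvE _ hy; by rewrite E (negPf nh) in hy.
    by split; [right; apply: ltnW|left].
  have [y hy] := has_hv v0.
  by have [E|E] := hvE _ hy; move: hy; rewrite E ?(negPf nh) ?(negPf nh').
have ownE o b : b \in owned v o -> o \in bigN v -> b \in deltas.
  move=> bo oA; have := bo; rewrite in_set => /andP[bS _].
  by rewrite in_set bS; apply/exists_inP; exists o.
have dis : [disjoint owned v a & owned v a'].
  apply/pred0P => b /=; apply/negP => /andP[]; rewrite !in_set => /and3P[_ _ /eqP E] /and3P[_ _ /eqP E'].
  by have := set11 a; rewrite -E E' inE (negPf aa').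
have sub : owned v a :|: owned v a' \subset deltas.
  apply/subsetP => b; rewrite in_setU => /orP[]/ownE; apply; by rewrite bigE !inE eqxx ?orbT.
have small : #|N v :\: big 12| <= 3.
  by have := cardsID (big 12) (N v); rewrite -/(bigN v) v2; slia.
have sub' : deltas \subset N v :\: big 12 by apply/subsetP => b; rewrite in_set => /andP[].
have := subset_leq_card sub; have := subset_leq_card sub'.
move: dis; rewrite -leq_card_setU => /eqP ->.
have := codeg_le aa'.
move=> c1 c2 c3; case: (e a a') h1 h2; rewrite ?mul1n ?mul0n => h1 h2.
  by split=> //; move: R1 R2; slia.
by exfalso; move: R1 R2; slia.
Qed.
End Poor.

Lemma poor_le5 v : v \in two_big_poor -> d v <= 5.
Proof. by rewrite inE => /and4P[]. Qed.

Lemma poor_not_big v : v \in two_big_poor -> v \notin big 12.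
Proof. by move=> /poor_le5 v5; rewrite inE -ltnNge; slia. Qed.

(** * Final count of the charges *)

Section Count.
Variable C : {set T}.
Hypothesis C_dom : forall v, v \in two_big_rich -> v \in C \/ exists2 c, c \in C & e v c.
Hypotheses (C_nbr : forall c, c \in C -> 0 < d c) (C_big : forall c, c \in C -> c \notin big 12).

Definition triples := [set v | [&& 0 < d v, d v <= 5, v \notin C & 3 <= #|nbr e (big 12 :|: C) v|]].
(** By [small_cover], these are the vertices of degree at most 5 not handled by [C], [triples] or
    [one_big]. *)
Definition rest := [set v in two_big_poor | (v \notin C) && (v \notin triples)].
Definition owners := \bigcup_(v in rest) bigN v.
Definition all_deltas := \bigcup_(v in rest) deltas v.

Lemma card_triples : #|triples| <= 2 * (#|big 12| + #|C|).
Proof.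
have [->|[v0 v0T]] := set_0Vmem triples; first by rewrite cards0.
have dis : [disjoint triples & big 12 :|: C].
  apply/pred0P => v /=; apply/negP; rewrite inE => /andP[/and4P[_ v5 vC _]].
  by rewrite in_setU (negPf vC) orbF inE; slia.
have T3 v : v \in triples -> 3 <= #|nbr e (big 12 :|: C) v| by rewrite inE => /and4P[].
have := bipartite_bound e_sym e_planar dis; have : 3 <= #|big 12 :|: C|.
  apply: leq_trans (T3 _ v0T) (subset_leq_card _).
  by apply/subsetP => x; rewrite in_nbr => /andP[].
have : #|triples| * 3 <= \sum_(x in triples) #|nbr e (big 12 :|: C) x|.
  by rewrite -sum_nat_const; apply: leq_sum => x /T3.
have := leq_card_setU (big 12) C => -[+ _].
set s := \sum_(x in _) _; clearbody s => h1 h2 h3 /(_ ltac:(slia)); slia.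
Qed.

Lemma small_cover v : 0 < d v -> d v <= 5 -> [|| v \in C, v \in triples, v \in one_big | v \in rest].
Proof.
move=> v0 v5; have [//|vC] := boolP (v \in C); have [//|vT] := boolP (v \in triples).
have [hvy|] := ltnP 0 #|bigN v|; last first.
  have [y hvy] := has_hv v0; rewrite leqn0 cards_eq0 => /eqP v_none.
  suff : y \in bigN v by rewrite v_none inE.
  rewrite in_setI inE hv_e //=; apply: (subsetP (sub_big _)) (hv_thr hvy _).
    by have := thr_ge v; slia.
  by rewrite inE -ltnNge; slia.
have [|v1] := eqVneq #|bigN v| 1; first by rewrite !inE v0 v5 => ->.
have := vT; rewrite inE v0 v5 vC /= -ltnNge => vT3.
have sub : bigN v \subset nbr e (big 12 :|: C) v.
  by apply/subsetP => y; rewrite in_setI in_nbr in_setU inE => /andP[-> ->].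
have v2 : #|bigN v| == 2 by have := subset_leq_card sub; move: v1 => /eqP; slia.
rewrite /=; apply/orP; right; rewrite in_set vC vT andbT in_set v0 v5 v2.
rewrite !andbT /=; apply/negP => /C_dom[vC'|[c cC evc]]; first by rewrite vC' in vC.
have : c |: bigN v \subset nbr e (big 12 :|: C) v.
  by rewrite subUset sub1set sub in_nbr in_setU cC orbT evc.
move=> /subset_leq_card; rewrite cardsU1 in_setI (negPf (C_big cC)) andbF.
by rewrite (eqP v2); slia.
Qed.

Lemma rest_no_nbr v c : v \in rest -> c \in C -> e v c = false.
Proof.
rewrite inE => /and3P[vQ vC vT] cC; apply/negP => evc; move: vT; rewrite inE vC.
have := vQ; rewrite inE => /and4P[-> -> /eqP v2 _] /=.
have : c |: bigN v \subset nbr e (big 12 :|: C) v.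
  rewrite subUset sub1set in_nbr in_setU cC orbT evc /=.
  by apply/subsetP => y; rewrite in_setI in_nbr in_setU inE => /andP[-> ->].
move=> /subset_leq_card; rewrite cardsU1 in_setI (negPf (C_big cC)) andbF v2.
by move=> ->.
Qed.

Lemma rest_poor v : v \in rest -> v \in two_big_poor.
Proof. by rewrite inE => /andP[]. Qed.

Lemma owner_big v o : v \in rest -> o \in bigN v -> 31 <= d o.
Proof. by move=> /rest_poor/poor_big; apply. Qed.

Lemma owned_unique v o b : v \in rest -> b \in owned v o ->
  big (thr b) :&: N b = [set o].
Proof.
move=> /rest_poor vP; rewrite in_set => /andP[]; rewrite in_setD => /andP[bA bv] /andP[_ /eqP <-].
rewrite -(poor_nbrs vP bv bA); apply/setP => y; rewrite !in_setI in_setU.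
by case: (y \in N b); rewrite ?orbT ?andbF ?andbT.
Qed.

Lemma all_deltasP b : b \in all_deltas -> exists v o,
  [/\ v \in rest, o \in bigN v, b \in owned v o, b \notin big 12
      & e v b /\ big (thr b) :&: N b = [set o]].
Proof.
move=> /bigcupP[v vR]; rewrite in_set in_setD => /andP[/andP[bA bv] /exists_inP[o oA bo]].
exists v, o; split=> //; split; last exact: (owned_unique vR).
by rewrite inE in bv.
Qed.

(** A vertex of [rest] has two neighbours of degree at least 31, a delta only one neighbour reaching
    its threshold. *)
Lemma rest_deltas : [disjoint rest & all_deltas].
Proof.
apply/pred0P => v /=; apply/negP => /andP[vR /all_deltasP[w [o [_ _ _ _ [_ E]]]]].
have : bigN v \subset [set o].
  rewrite -E; apply/subsetP => y yv; have y31 := owner_big vR yv.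
  by have /setIP[yN _] := yv; rewrite in_setI yN andbT inE (leq_trans (thr_le v)).
have := rest_poor vR; rewrite inE => /and4P[_ _ /eqP v2 _].
by move/subset_leq_card; rewrite v2 cards1.
Qed.

Lemma rest_nbrs v (B : {set T}) : v \in rest -> deltas v \subset B ->
  4 <= #|nbr e (owners :|: B) v|.
Proof.
move=> vR sub; have [a [a' [bigE aa' _ _ d2]]] := poor_structure (rest_poor vR).
have v2 : #|bigN v| = 2 by rewrite bigE cards2 aa'.
have dis : [disjoint bigN v & deltas v].
  by apply/pred0P => y /=; apply/negP => /andP[/setIP[_ yA]]; rewrite in_set in_setD yA.
apply: (@leq_trans #|bigN v :|: deltas v|).
  by move: dis; rewrite -leq_card_setU => /eqP ->; slia.
apply/subset_leq_card/subsetP => y; rewrite in_setU => yvd.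
have evy : e v y.
  case/orP: yvd => [/setIP[yv _]|]; first by rewrite inE in yv.
  by rewrite in_set => /andP[/setDP[yv _] _]; rewrite inE in yv.
rewrite in_nbr evy andbT in_setU; case/orP: yvd => [yv|/(subsetP sub)-> //]; last by rewrite orbT.
by apply/orP; left; apply/bigcupP; exists v.
Qed.

Lemma owners_big : owners \subset big 31.
Proof. by apply/subsetP => o /bigcupP[v vR ov]; rewrite inE (owner_big vR). Qed.

(** Each vertex of [R] sees two owners and two deltas, so 4|R| + 4 <= 2(|R| + |owners| + |B|). *)
Lemma card_rest (R B : {set T}) : R \subset rest -> (forall v, v \in R -> deltas v \subset B) ->
  B \subset all_deltas -> #|R| <= #|owners| + #|B|.
Proof.
move=> RV RB /subsetP sB; have [->|[v0 v0R]] := set_0Vmem R; first by rewrite cards0.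
have R4 v : v \in R -> 4 <= #|nbr e (owners :|: B) v|.
  by move=> vR; apply: rest_nbrs (RB _ vR); apply: (subsetP RV).
have dis : [disjoint R & owners :|: B].
  apply/pred0P => v /=; apply/negP; rewrite in_setU => /andP[/(subsetP RV) vR].
  case/orP=> [/(subsetP owners_big)|/sB vB].
    by have := rest_poor vR; rewrite !inE => /and4P[_ v5 _ _]; slia.
  by rewrite (disjointFr rest_deltas vR) in vB.
have := bipartite_bound e_sym e_planar dis; have : 3 <= #|owners :|: B|.
  apply: leq_trans (leq_trans _ (R4 _ v0R)) (subset_leq_card _) => //.
  by apply/subsetP => x; rewrite in_nbr => /andP[].
have : #|R| * 4 <= \sum_(x in R) #|nbr e (owners :|: B) x|.
  by rewrite -sum_nat_const; apply: leq_sum => x /R4.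
have := leq_card_setU owners B => -[+ _].
set s := \sum_(x in _) _; clearbody s => h1 h2 h3 /(_ ltac:(slia)); slia.
Qed.

Definition owned_rest o := [set v in rest | (o \in bigN v) && [exists b in owned v o, d b <= 6]].
Definition small_deltas o := [set b in all_deltas | (o \in big (thr b) :&: N b) && (d b <= 7)].

(** It suffices to find 33 neighbours of [o] in neither set. If [o] owns a delta [b] of degree at
    most 6, then [b o] is the only heavy edge at [b], and the opposite heavy edges end in such
    neighbours. Otherwise [owned_rest o] is empty, and the common neighbours of [o] and an adjacent
    vertex [a] of degree at least 31 are not deltas owned by [o]. *)
Lemma owner_bound o : o \in owners -> #|owned_rest o| + #|small_deltas o| + 33 <= d o.
Proof.
move=> oO; suff [Y [YN Y33 Yrest Ydelta]] : exists Y : {set T}, [/\ Y \subset N o, 33 <= #|Y|,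
    forall y, y \in Y -> y \notin owned_rest o & forall y, y \in Y -> y \notin small_deltas o].
  have sub : Y :|: (owned_rest o :|: small_deltas o) \subset N o.
    rewrite !subUset YN /=; apply/andP; split; apply/subsetP => x /setIdP[_ /andP[]].
      by move=> /setIP[+ _] _; rewrite !inE e_sym.
    by move=> /setIP[_ +] _; rewrite !inE e_sym.
  have dis1 : [disjoint Y & owned_rest o :|: small_deltas o].
    apply/pred0P => y /=; apply/negP => /andP[yY]; rewrite in_setU.
    by rewrite (negPf (Yrest _ yY)) (negPf (Ydelta _ yY)).
  have dis2 : [disjoint owned_rest o & small_deltas o].
    apply/pred0P => y /=; apply/negP => /andP[]; rewrite in_set => /andP[yR _].
    by rewrite in_set => /andP[]; rewrite (disjointFr rest_deltas yR).
  have := subset_leq_card sub; move: dis1 dis2; rewrite -leq_card_setU => /eqP->.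
  by rewrite -leq_card_setU => /eqP->; slia.
have [/exists_inP[b bD b6]|none] := boolP [exists b in small_deltas o, d b <= 6].
  have := bD; rewrite in_set => /andP[/all_deltasP[v [o1 [vR o1v bo1 bA [evb bE]]]] /andP[+ _]].
  rewrite bE in_set1 => /eqP oo1; rewrite -{o1}oo1 in o1v bo1 bE.
  have bv : b \in N v by rewrite inE.
  have /setIP[ov oA] := o1v; have eob : e b o.
    by have := set11 o; rewrite -bE in_setI => /andP[_]; rewrite inE.
  have hbo : hv b o by move: bo1; rewrite in_set => /andP[_ /andP[]].
  have only b' : hv b b' -> b' = o.
    by move=> hbb'; apply/set1P; rewrite -bE in_setI (hv_thr hbb' bA) inE hv_e.
  pose X := (N b :\ o) :\ v.
  pose Y := [set y in N o :\ b | [exists x in X, hv x y]].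
  have vA := poor_not_big (rest_poor vR).
  have vo : v != o by apply: contraNneq vA => ->.
  have cX : #|X| + 2 = d b.
    rewrite (cardsD1 o (N b)) inE eob (cardsD1 v (N b :\ o)) !inE vo e_sym evb /= /X; slia.
  (* The opposite heavy edges at [v] end in the single vertex of [bigN v :\ o]; all others join [X]
     to [Y]. *)
  have opp_sub : opp b o \subset [set [set v; y] | y in bigN v :\ o] :|: cross_edges e X Y.
    apply/subsetP => f /imsetP[[x y] xy ->].
    have /and3P[/andP[xo ebx] /andP[yb eoy] hxy] : [&& (x != o) && e b x, (y != b) && e o y & hv x y].
      by move: xy; rewrite !inE.
    rewrite in_setU /=; have [xv|xv] := eqVneq x v.
      rewrite xv in hxy *; apply/orP; left; apply/imsetP; exists y => //.
      rewrite in_setD1 (hv_bigN (rest_poor vR) hxy) andbT.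
      by apply: contraTneq eoy => ->; rewrite e_irr.
    have xX : x \in X by rewrite !inE xv xo ebx.
    apply/orP; right; apply/imsetP; exists (x, y) => //=; rewrite in_set /= xX hv_e // andbT /=.
    by rewrite !inE yb eoy /=; apply/exists_inP; exists x.
  have cD : #|bigN v :\ o| = 1.
    have := rest_poor vR; rewrite inE => /and4P[_ _ /eqP + _].
    by rewrite (cardsD1 o (bigN v)) o1v; slia.
  have XY : 38 <= #|cross_edges e X Y|.
    have := leq_trans (only_hv hbo only) (subset_leq_card opp_sub).
    have := leq_card_setU [set [set v; y] | y in bigN v :\ o] (cross_edges e X Y) => -[+ _].
    by have := leq_imset_card (fun y => [set v; y]) (bigN v :\ o); rewrite cD; slia.
  have X0 : X != set0.
    apply: contraTneq XY => X0; rewrite -ltnNge; apply: leq_ltn_trans (leq_imset_card _ _) _.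
    by rewrite card_cross_pairs X0 big_set0.
  (* Here |X| <= 4, so 38 cross edges require 41 <= 2 * 4 + |Y| in the weaker alternative. *)
  have Y33 : 33 <= #|Y|.
    have := @cross_edges_bound _ _ e_sym e_irr e_planar b o X Y eob X0.
    move=> /(_ ltac:(by move=> x; rewrite !inE => /and3P[_ -> ->])).
    move=> /(_ ltac:(by move=> y; rewrite in_set !in_setD1 inE => /andP[/andP[-> ->] _])).
    by slia.
  have Yx y : y \in Y -> exists2 x, hv y x & x != o /\ x \in N b.
    rewrite in_set => /andP[_ /exists_inP[x xX hxy]]; exists x; first by rewrite hv_sym.
    by move: xX; rewrite !inE => /and3P[_ -> ->].
  exists Y; split=> //.
  - by apply/subsetP => y /setIdP[/setD1P[]].
  - move=> y /Yx[x hyx [xo xb]]; apply/negP => /setIdP[yR _].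
    have x31 := owner_big yR (hv_bigN (rest_poor yR) hyx).
    suff : x \in [set o] by rewrite in_set1 (negPf xo).
    by rewrite -bE in_setI xb andbT inE (leq_trans (thr_le b)).
  - move=> y /Yx[x hyx [xo xb]]; apply/negP => /setIdP[/all_deltasP].
    move=> [w [o2 [_ _ _ yA [_ yE]]]]; rewrite yE in_set1 => /andP[/eqP oo2 _].
    suff : x \in [set o2] by rewrite in_set1 -oo2 (negPf xo).
    by rewrite -yE in_setI (hv_thr hyx yA) inE hv_e.
have [v vR ov] := bigcupP oO.
have [a [ao eoa av ca]] : exists a, [/\ a != o, e o a, a \in bigN v & 36 <= #|N o :&: N a|].
  have [a [a' [bigE aa' eaa' c36 _]]] := poor_structure (rest_poor vR).
  move: ov; rewrite bigE !inE => /orP[]/eqP->.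
    by exists a'; rewrite eq_sym aa' eaa' !inE eqxx orbT.
  by exists a; rewrite aa' e_sym eaa' !inE eqxx setIC.
exists (N o :&: N a); split; [exact: subsetIl|by slia| |].
- move=> y /setIP[yo ya]; apply: contraNN none => /setIdP[yR /andP[oy /exists_inP[b byo b6]]]; apply/exists_inP; exists b => //.
  rewrite in_set (leq_trans b6) // (owned_unique yR byo) in_set1 eqxx !andbT.
  apply/bigcupP; exists y => //; rewrite in_set; move: (byo); rewrite in_set => /andP[-> _].
  by apply/exists_inP; exists o.
- move=> b /setIP[_ ba]; apply/negP => /setIdP[/all_deltasP[w [o2 [_ _ _ bA [_ bE]]]]].
  rewrite bE in_set1 => /andP[/eqP oo2 _].
  suff : a \in [set o2] by rewrite in_set1 -oo2 (negPf ao).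
  rewrite -bE in_setI !inE in ba *; rewrite e_sym ba andbT.
  exact: leq_trans (thr_le b) (owner_big vR av).
Qed.

(* The bipartite bound is applied twice, to [rest] and to those of its         *)
(* members all of whose [deltas] have degree at least 7: the latter [deltas]  *)
(* can pay one or two units themselves, the other members of [rest] and the   *)
(* small [deltas] are charged to their owner through [owner_bound].           *)
Lemma double_rest : 2 * #|rest| <=
  \sum_(o in owners) (d o - 31) + \sum_(b in all_deltas) (d b - 6).
Proof.
have [G GE] : exists G, G = [set b | 7 <= d b] by eexists.
have [P PE] : exists P, P = [set v | deltas v \subset G] by eexists.
have D1 := cardsID P rest; have D2 := cardsID G all_deltas.
have sub v : v \in rest -> deltas v \subset all_deltas.
  by move=> vR; apply: (bigcup_max v).
have h1 : #|rest| <= #|owners| + #|all_deltas| by apply: card_rest.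
have h2 : #|rest :&: P| <= #|owners| + #|all_deltas :&: G|.
  apply: card_rest; rewrite ?subsetIl // => v /setIP[/sub sv]; rewrite PE inE => vG.
  by rewrite subsetI sv.
have h3 : #|rest :\: P| <= \sum_(o in owners) #|owned_rest o|.
  apply: leq_card_cover => v /setDP[vR]; rewrite PE inE => /subsetPn[b bd].
  rewrite GE inE -ltnNge => b6; move: bd; rewrite in_set => /andP[_ /exists_inP[o ov bo]].
  exists o; first by apply/bigcupP; exists v.
  by rewrite in_set vR ov; apply/exists_inP; exists b.
have h4 : #|[set b in all_deltas | d b <= 7]| <= \sum_(o in owners) #|small_deltas o|.
  apply: leq_card_cover => b /setIdP[bD b7]; have [v [o [vR ov bo _ [_ bE]]]] := all_deltasP bD.
  by exists o; [apply/bigcupP; exists v|rewrite in_set bD bE set11 b7].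
have h5 : \sum_(o in owners) #|owned_rest o| + \sum_(o in owners) #|small_deltas o| + #|owners| * 2 <=
    \sum_(o in owners) (d o - 31).
  by rewrite -sum_nat_const -!big_split; apply: leq_sum => o /owner_bound /=; slia.
have h6 : #|all_deltas :\: G| + 2 * #|all_deltas :&: G| <=
    #|[set b in all_deltas | d b <= 7]| + \sum_(b in all_deltas) (d b - 6).
  have -> : all_deltas :\: G = [set b in all_deltas | ~~ (7 <= d b)].
    by rewrite GE; apply/setP => b; rewrite !inE andbC.
  have -> : all_deltas :&: G = [set b in all_deltas | 7 <= d b].
    by rewrite GE; apply/setP => b; rewrite !inE.
  rewrite mul2n -addnn -!sum_indicator -!big_split; apply: leq_sum => b _ /=.
  by rewrite -ltnNge; case: (leqP (d b) 7); case: (ltnP 6 (d b)) => /=; slia.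
move: D1 D2 h1 h2 h3 h4 h5 h6.
set s1 := \sum_(o in _) _; set s2 := \sum_(o in _) _; set s3 := \sum_(o in _) _; set s4 := \sum_(o in _) _.
by clearbody s1 s2 s3 s4; slia.
Qed.

Lemma count_contradiction :
    \sum_(c in C) (12 - d c) <= 6 * (#|big 22| + #|big 27| + #|big 31|) ->
  False.
Proof.
move=> C_cost.
have := euler.
have mk (S : {set T}) (f : T -> nat) : \sum_(x in S) f x = \sum_x if x \in S then f x else 0.
  by rewrite big_mkcond.
(* A vertex of [rest] has degree at least 4 by [rest_nbrs] and lacks at most 2. *)
have upper : \sum_(x in U) (6 - d x) <=
    \sum_(c in C) (6 - d c) + #|triples| * 3 + #|one_big| * 3 + #|rest| * 2.
  rewrite -!sum_nat_const !mk -!big_split; apply: leq_sum => x _ /=.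
  have [xU|//] := boolP (x \in U); have [x6|x5] := ltnP 5 (d x); first by slia.
  have := d3 xU; move: xU; rewrite inE => xU x3.
  have := small_cover xU x5; have [_ _|_] := boolP (x \in C); first by slia.
  have [_ _|_] := boolP (x \in triples); first by slia.
  have [_ _|_ /= xR] := boolP (x \in one_big); first by slia.
  have := rest_nbrs xR (bigcup_max x xR (subxx _)).
  have : #|nbr e (owners :|: all_deltas) x| <= d x.
    by apply/subset_leq_card/subsetP => y; rewrite in_nbr inE => /andP[].
  by rewrite xR; slia.
(* The three sets are disjoint: deltas and members of [C] are not big, and a delta has a neighbour
   in [rest], which no member of [C] has. *)
have lower : \sum_(x in big 12) (d x - 6) + \sum_(c in C) (d c - 6) + \sum_(b in all_deltas) (d b - 6)
   <= \sum_(x in U) (d x - 6).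
  rewrite !mk -!big_split; apply: leq_sum => x _ /=.
  have [xD|_] := boolP (x \in all_deltas).
    have [v [o [vR _ _ /negPf-> [evx _]]]] := all_deltasP xD.
    have /negPf-> : x \notin C by apply: contraTN evx => /(rest_no_nbr vR)->.
    have -> : x \in U by rewrite inE card_gt0; apply/set0Pn; exists v; rewrite inE e_sym.
    by slia.
  have [xC|_] := boolP (x \in C).
    by rewrite (negPf (C_big xC)) inE C_nbr //; slia.
  have [xA|_] := boolP (x \in big 12); last by slia.
  by move: xA; rewrite !inE => x12; rewrite (leq_trans _ x12) //; slia.
have balance : \sum_(x in U) d x + \sum_(x in U) (6 - d x) = 6 * #|U| + \sum_(x in U) (d x - 6).
  by rewrite mulnC -sum_nat_const -!big_split; apply: eq_bigr => x _ /=; lia.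
(* A member of [C] has to cover its own deficit and 6 units for [triples]. *)
have balC : \sum_(c in C) (6 - d c) + 6 * #|C| = \sum_(c in C) (12 - d c) + \sum_(c in C) (d c - 6).
  rewrite mulnC -sum_nat_const -!big_split; apply: eq_bigr => c cC /=.
  by have := C_big cC; rewrite inE -ltnNge; lia.
(* Tight from degree 31 on: 6 + 7 + 6 + 6 = 31 - 6. *)
have final : 6 * #|big 12| + 7 * #|big 22| + 6 * #|big 27| + 6 * #|big 31| +
    \sum_(o in owners) (d o - 31) <= \sum_(x in big 12) (d x - 6).
  rewrite ![_ * #|_|]mulnC -!sum_nat_const !mk -!big_split; apply: leq_sum => x _ /=.
  have : x \in owners -> 31 <= d x by move/(subsetP owners_big); rewrite inE.
  rewrite !inE; case: (x \in owners) => [/(_ isT) h|_].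
    by rewrite !(leq_trans _ h) //; slia.
  by case: (leqP 12 (d x)); case: (leqP 22 (d x)); case: (leqP 27 (d x)); case: (leqP 31 (d x)); slia.
have := card_triples; have := card_one_big; have := double_rest.
move: C_cost upper lower balance balC final.
set s1 := \sum_(o in _) _; set s2 := \sum_(o in _) _; set s3 := \sum_(o in _) _; set s4 := \sum_(o in _) _.
set s5 := \sum_(o in _) _; set s6 := \sum_(o in _) _; set s7 := \sum_(o in _) _; set s8 := \sum_(o in _) _.
clearbody s1 s2 s3 s4 s5 s6 s7 s8.
slia.
Qed.
End Count.

Lemma discharging_contradiction : False.
Proof. by have [C [C_dom C_nbr C_big C_cost]] := rich_domination; exact: (count_contradiction C_dom). Qed.
End Discharging.

(** Induction on the number of non-isolated vertices, since [del] keeps the vertex type. *)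
Lemma conflict_colorable_planar (T : finType) (D m : nat) (e : rel T) :
    symmetric e -> irreflexive e -> z2_planar e -> (forall x, #|nbhd e x| <= D) ->
    (forall x y, x != y -> #|nbhd e x :&: nbhd e y| <= m) -> 38 <= m ->
  conflict_colorable e (D + m) (edges e).
Proof.
move: {2}#|[set x | 0 < #|nbhd e x|]| (leqnn #|[set x | 0 < #|nbhd e x|]|) => n.
elim: n e => [|n IH] e en e_sym e_irr e_planar deg_le codeg_le m38; apply: boolp.contrapT => not_col.
all: have has_edge : exists x, 0 < #|nbhd e x| by
  apply: boolp.contrapT => none; apply: not_col; exists (fun=> 0);
  split=> [f|f g] /edgesP[x [y [exy _]]]; case: none; exists x;
  rewrite card_gt0; apply/set0Pn; exists y; rewrite inE.
  by have [x x0] := has_edge; move: en; rewrite leqNgt card_gt0 => /set0Pn[]; exists x; rewrite inE.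
have del_col v : 0 < #|nbhd e v| -> conflict_colorable (del e v) (D + m) (edges (del e v)).
  move=> v0; have subN x : nbhd (del e v) x \subset nbhd e x.
    by apply/subsetP => y; rewrite !inE => /and3P[].
  apply: IH => //.
  - rewrite -ltnS; apply: leq_trans en; apply: proper_card; apply/properP; split.
      apply/subsetP => x; rewrite !inE => /leq_trans; apply; exact: subset_leq_card.
    exists v; rewrite !inE // -leqNgt leqn0 cards_eq0; apply/eqP/setP => y.
    by rewrite !inE /del eqxx.
  - exact: del_sym.
  - exact: del_irr.
  - by apply: sub_z2_planar e_planar => x y /and3P[].
  - by move=> x; apply: leq_trans (subset_leq_card (subN x)) _.
  - by move=> x y xy; apply: leq_trans (subset_leq_card (setISS (subN x) (subN y))) (codeg_le _ _ xy).
have deg_gt0 v a : heavy e D m v a -> 0 < #|nbhd e v|.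
  by move=> /andP[eva _]; rewrite card_gt0; apply/set0Pn; exists a; rewrite inE.
apply: (@discharging_contradiction T e (heavy e D m) D m) => //.
- exact: heavy_sym.
- by move=> x y /andP[].
- by move=> x y; apply: heavy_degree.
- by move=> x y; apply: heavy_degree_sum.
- by move=> v v0; apply: reducible0 => //; exact: del_col.
- by move=> v a hva; apply: reducible1 => //; apply: del_col; apply: deg_gt0 hva.
- by move=> v a a' aa' hva hva'; apply: reducible2 => //; apply: del_col; apply: deg_gt0 hva.
Qed.

Lemma conflict_colorable_B_colorable (T : finType) (K : nat) (e : rel T) :
  symmetric e -> irreflexive e -> conflict_colorable e K (edges e) -> B_colorable e K.
Proof.
move=> e_sym e_irr [c [cK c_neq]]; exists c; split=> // A B /andP[_ /forall_inP AB] _.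
have ab a b : a \in A -> b \in B -> e a b by move=> aA bB; have /forall_inP := AB _ aA; apply.
move=> f g /imset2P[a b aA bB Ef] /imset2P[a' b' a'A b'B Eg] Ec; apply/eqP.
have fE : f \in edges e by rewrite Ef mem_edges ?ab.
have gE : g \in edges e by rewrite Eg mem_edges ?ab.
apply: contraT => fg; have := c_neq _ _ fE gE; rewrite Ec eqxx; apply.
(* Any two edges [a b] and [a' b'] of a biclique conflict, because [a b'] and [b a'] are edges. *)
rewrite /conflict fg; apply/orP; right; apply/existsP; exists (a, b).
by apply/existsP; exists (b', a'); rewrite Ef Eg /= (setUC [set b']) !eqxx ab // e_sym ab.
Qed.

From HB Require Import structures.
From mathcomp Require Import all_boot all_order all_algebra.
From mathcomp Require Import all_classical all_reals all_analysis.
From mathcomp Require Import lra.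
Import Order.TTheory GRing.Theory Num.Theory numFieldNormedType.Exports.

(** * Drawings and crossing parities *)

Section Crossings.
Variable R : realType.
Local Open Scope ring_scope.
Implicit Types (u v : R * R) (a b : nat -> R * R).

(** A half-plane with one half of its boundary line, so that exactly one of u and -u lies in it when
    u is nonzero; no general position is required. *)
Definition lexneg u : bool := (u.2 < 0) || (u.2 == 0) && (u.1 < 0).

Lemma lexnegN u : u != 0 -> lexneg (- u) = ~~ lexneg u.
Proof.
case: u => x y; rewrite /lexneg /= -[_ != _]/(~~ ((x == 0) && (y == 0))).
rewrite !oppr_lt0 oppr_eq0; case: (ltgtP y 0) => //= _; rewrite andbT.
by case: (ltgtP x 0).
Qed.

(** For a short step away from the origin: whether it passes the ray of positive first
    coordinates. *)
Definition crosses u v : bool := (lexneg u (+) lexneg v) && (0 < u.1).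

Definition away (d : R) u : bool := (d <= `|u.1|) || (d <= `|u.2|).
Definition close (d : R) u v : bool := (`|u.1 - v.1| < d) && (`|u.2 - v.2| < d).

Lemma close_lexneg d u v : close d u v -> lexneg u != lexneg v ->
  (`|u.2| < d) && (`|v.2| < d).
Proof.
case: u v => [x y] [z t]; rewrite /close /lexneg /= => /andP[_].
rewrite !ltr_norml => /andP[h1 h2].
case: (ltgtP y 0) => hy; case: (ltgtP t 0) => ht //= _; apply/andP; split; apply/andP; split; lra.
Qed.

Lemma close_sign d u v : close d u v -> d <= `|u.1| -> (0 < u.1) = (0 < v.1).
Proof.
case: u v => [x y] [z t]; rewrite /close /= => /andP[+ _].
rewrite ltr_norml => /andP[h1 h2].
by case: (ltgtP x 0) => hx; [rewrite ltr0_norm|rewrite gtr0_norm|rewrite hx normr0] => // h;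
  apply/esym; try apply/negbTE; rewrite -?leNgt; lra.
Qed.

(* A closed polygon which stays close to a point far from the origin does not *)
(* wind around the origin.                                                    *)
Lemma crosses_cell d u1 u2 u3 u4 :
    away d u1 -> close d u1 u2 -> close d u1 u3 -> close d u1 u4 ->
    close d u2 u1 -> close d u2 u3 -> close d u4 u1 -> close d u4 u3 ->
  crosses u1 u2 (+) crosses u4 u3 = crosses u1 u4 (+) crosses u2 u3.
Proof.
move=> A c12 c13 c14 c21 c23 c41 c43.
(* If the half-planes differ, the points are near the horizontal axis, hence on one side of the
   origin, and the four crossings telescope. *)
have [E|] := boolP ((lexneg u1 == lexneg u2) && (lexneg u1 == lexneg u3)
  && (lexneg u1 == lexneg u4)).
  have /andP[/andP[/eqP E2 /eqP E3] /eqP E4] := E.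
  by rewrite /crosses -E2 -E3 -E4 !addbb.
rewrite !negb_and => H.
have {H} y1 : `|u1.2| < d.
  by case/orP: H => [/orP[]|] => /close_lexneg => [/(_ _ c12)|/(_ _ c13)|/(_ _ c14)] /andP[].
have {A} A : d <= `|u1.1| by case/orP: A => //; rewrite leNgt y1.
rewrite /crosses -(close_sign c12 A) -(close_sign c14 A).
by case: (0 < u1.1); rewrite ?andbT ?andbF //; move: (lexneg u1) (lexneg u2) (lexneg u3) (lexneg u4); do 4!case.
Qed.

(** A short step away from the origin which changes the half-plane crosses exactly one of the two
    opposite rays. *)
Lemma crossesN d u v : away d u -> close d u v -> u != 0 -> v != 0 ->
  crosses (- u) (- v) = crosses u v (+) (lexneg u (+) lexneg v).
Proof.
move=> A c u0 v0; rewrite /crosses !lexnegN // oppr_gt0.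
have [<-|Euv] := eqVneq (lexneg u) (lexneg v); first by rewrite !addbb.
have /andP[y1 _] := close_lexneg c Euv.
have {A} A : d <= `|u.1| by case/orP: A => //; rewrite leNgt y1.
have d0 : 0 < d by apply: le_lt_trans y1.
have: u.1 != 0 by rewrite -normr_gt0 (lt_le_trans d0).
case: (ltgtP u.1 0) => // _ _; move: Euv; case: (lexneg u); case: (lexneg v) => //.
Qed.

Definition parity (N : nat) a u : bool :=
  \big[addb/false]_(i < N) crosses (a i - u) (a i.+1 - u).

(** The differences a(i) - b(j) form a grid avoiding the origin. Its cells do not wind around the
    origin by [crosses_cell], hence neither does its boundary. Two sides of the boundary give the
    parities of [a]; the other two give those of [b] with signs reversed, corrected by
    [crossesN]. *)
Lemma parity_cells N d a b : 
    0 < d ->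
    (forall i j, (i <= N)%N -> (j <= N)%N -> away d (a i - b j)) ->
    (forall i i' j j', (i <= N)%N -> (i' <= N)%N -> (j <= N)%N -> (j' <= N)%N ->
      (i' <= i.+1)%N -> (i <= i'.+1)%N -> (j' <= j.+1)%N -> (j <= j'.+1)%N ->
      close d (a i - b j) (a i' - b j')) ->
  parity N a (b 0) (+) parity N a (b N) (+) (parity N b (a 0) (+) parity N b (a N))
  = lexneg (a 0 - b 0) (+) lexneg (a 0 - b N)
    (+) (lexneg (a N - b 0) (+) lexneg (a N - b N)).
Proof.
move=> d0 aw cl.
pose V i j := \big[addb/false]_(k < j) crosses (a i - b k) (a i - b k.+1).
have cell i j : (i < N)%N -> (j < N)%N ->
    crosses (a i - b j) (a i.+1 - b j) (+) crosses (a i - b j.+1) (a i.+1 - b j.+1)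
    = crosses (a i - b j) (a i - b j.+1) (+) crosses (a i.+1 - b j) (a i.+1 - b j.+1).
  by move=> iN jN; apply: (@crosses_cell d); [apply: aw|apply: cl ..]; lia.
have row j : (j < N)%N -> forall i, (i <= N)%N ->
    \big[addb/false]_(k < i) crosses (a k - b j) (a k.+1 - b j) (+)
    \big[addb/false]_(k < i) crosses (a k - b j.+1) (a k.+1 - b j.+1)
    = crosses (a 0 - b j) (a 0 - b j.+1) (+) crosses (a i - b j) (a i - b j.+1).
  move=> jN; elim=> [|i IH] iN; first by rewrite !big_ord0 !addbb.
  rewrite !big_ord_recr /= addbACA IH; last lia.
  by rewrite cell // -addbA addKb.
have all_rows j : (j <= N)%N -> parity N a (b 0) (+) parity N a (b j) = V 0 j (+) V N j.
  rewrite /V; elim: j => [|j IH] jN; first by rewrite !big_ord0 !addbb.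
  rewrite !big_ord_recr /= addbACA -(row j) // -IH; last lia.
  by rewrite -addbA addKb.
have col i : (i <= N)%N ->
    V i N = parity N b (a i) (+) (lexneg (a i - b 0) (+) lexneg (a i - b N)).
  move=> iN; rewrite /V /parity.
  suff H j : (j <= N)%N -> \big[addb/false]_(k < j) crosses (a i - b k) (a i - b k.+1)
    = \big[addb/false]_(k < j) crosses (b k - a i) (b k.+1 - a i)
      (+) (lexneg (a i - b 0) (+) lexneg (a i - b j)) by exact: H.
  have nz k : (k <= N)%N -> a i - b k != 0.
    move=> kN; apply: contraTneq (aw _ _ iN kN) => ->.
    by rewrite /away /= normr0 orbb -ltNge d0.
  elim: j => [|j IH] jN; first by rewrite !big_ord0 !addbb.
  rewrite !big_ord_recr /= IH; last lia.
  rewrite -[b j - a i]opprB -[b j.+1 - a i]opprB (@crossesN d) ?nz ?aw //; try lia; last first.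
    by apply: cl; lia.
  move: (crosses _ _) (lexneg _) (lexneg _) (lexneg _) (\big[_/_]_(_ < _) _).
  by do 5!case.
rewrite all_rows // !col //.
move: (parity N b (a 0)) (parity N b (a N)) (lexneg _) (lexneg _) (lexneg _) (lexneg _).
by do 6!case.
Qed.
End Crossings.

(** * Compactness of arcs *)

Section Arcs.
Variable R : realType.
Local Open Scope classical_set_scope.
Local Open Scope ring_scope.

(** Uniform continuity, stated for all large N so that finitely many arcs can share one N. *)
Lemma arc_uniform (g : R -> R * R) (d : R) : 0 < d ->
    {within `[0, 1], continuous g} ->
  \forall N \near \oo, forall x y : R, x \in `[0, 1] -> y \in `[0, 1] ->
    `|x - y| <= N.+1%:R^-1 -> `|g x - g y| < d.
Proof.
move=> d0 cg.
pose P (N : nat) (x : R) := forall y : R, y \in `[0, 1] ->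
  `|x - y| <= N.+1%:R^-1 -> `|g x - g y| < d.
suff H : \forall N \near \oo, `[0, 1] `<=` P N.
  by apply: filterS H => N H x y x01; apply: H; rewrite inE in x01.
have /compact_near_coveringP/near_covering_withinP cov := @segment_compact R 0 1.
apply: cov => x x01.
have /subspace_continuousP/(_ x x01) := cg.
move=> /cvgrPdist_lt /(_ (d / 2)); rewrite divr_gt0 // => /(_ isT).
rewrite near_withinE => /nbhs_ballP[eta /= eta0 etaP].
have eta2 : 0 < eta / 2 by rewrite divr_gt0.
have small : \forall N \near \oo, N.+1%:R^-1 < eta / 2.
  by have := near_infty_natSinv_lt (PosNum eta2).
near=> x' N => x'01 y y01 xy.
have hN : N.+1%:R^-1 < eta / 2 by near: N.
have hx' : `|x - x'| < eta / 2.
  by near: x'; apply: nbhsx_ballx.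
rewrite /= in xy x'01; have gx' : `|g x - g x'| < d / 2.
  by apply: etaP x'01; apply: lt_trans hx' _; rewrite ltr_pdivrMr // ltr_pMr // ltr1n.
have gy : `|g x - g y| < d / 2.
  apply: etaP y01; apply: le_lt_trans (ler_distD x' _ _) _.
  by rewrite (splitr eta) ltrD // (le_lt_trans xy hN).
apply: le_lt_trans (ler_distD (g x) _ _) _.
by rewrite (splitr d) ltrD // distrC.
Unshelve. all: by end_near.
Qed.

Lemma arcs_apart (g h : R -> R * R) :
    {within `[0, 1], continuous g} -> {within `[0, 1], continuous h} ->
    (forall s t, s \in `[0, 1] -> t \in `[0, 1] -> g s != h t) ->
  exists2 d, 0 < d & forall s t, s \in `[0, 1] -> t \in `[0, 1] ->
    d <= `|g s - h t|.
Proof.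
move=> cg ch gh; pose K := (g @` `[0, 1]) `*` (h @` `[0, 1]).
have zero01 : (0 : R) \in `[0, 1] by rewrite in_itv /= lexx ler01.
have KP s t : s \in `[0, 1] -> t \in `[0, 1] -> (g s, h t) \in K.
  move=> s01 t01; rewrite inE; split => /=; [exists s|exists t] => //; exact/set_mem.
have cK : compact K.
  by apply: compact_setX; apply: continuous_compact => //; apply: segment_compact.
pose D (z : (R * R) * (R * R)) := `|z.1 - z.2|.
have cD : {within K, continuous D}.
  apply: continuous_subspaceT => z; apply: cvg_norm; apply: cvgB.
    exact: cvg_fst.
  exact: cvg_snd.
have [c cK' cmin] := compact_EVT_min (ex_intro _ _ (set_mem (KP _ _ zero01 zero01))) cK cD.
exists (D c); last by move=> s t s01 t01; apply: cmin (KP _ _ s01 t01).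
move/set_mem: cK' => [[s s01 gs] [t t01 ht]].
rewrite normr_gt0 subr_eq0 -gs -ht; apply: gh; [exact: s01|exact: t01].
Qed.

End Arcs.

Section Drawing.
Variable R : realType.
Local Open Scope ring_scope.

(** Disjoint edges have arcs at positive distance. All arcs are sampled at equally many points,
    finely enough for every such pair, and [parity_cells] gives the identity. *)
Lemma planar_z2_planar (T : finType) (e : rel T) :
  symmetric e -> irreflexive e -> planar R e -> z2_planar e.
Proof.
move=> e_sym e_irr [p [g [p_inj g_cont _ g_ends g_vert g_cross]]].
have end01 : ((0 : R) \in `[0, 1]) * ((1 : R) \in `[0, 1]).
  by rewrite !in_itv /= !lexx ler01.
have g01 f s : f \in edges e -> s \in `[0, 1] ->
    (exists2 x, x \in f & g f s = p x) \/ (s \in `]0, 1[).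
  move=> fe; rewrite !in_itv /= => /andP[s0 s1].
  have [x [y [-> gx gy]]] := g_ends _ fe.
  have [->|sn0] := eqVneq s 0; first by left; exists x; rewrite ?inE ?eqxx.
  have [->|sn1] := eqVneq s 1; first by left; exists y; rewrite ?inE ?eqxx ?orbT.
  by right; rewrite !lt_neqAle eq_sym sn0 s0 sn1 s1.
have apart f f' s t : f \in edges e -> f' \in edges e -> [disjoint f & f']%B ->
    s \in `[0, 1] -> t \in `[0, 1] -> g f s != g f' t.
  move=> fe fe' dff s01 t01; apply/eqP => E.
  have [[x xf gx]|si] := g01 _ _ fe s01; have [[y yf gy]|ti] := g01 _ _ fe' t01.
  - move: E; rewrite gx gy => /p_inj Exy; move: yf; rewrite -Exy.
    by rewrite (disjointFr dff xf).
  - by apply: (g_vert f' x t) => //; rewrite -E.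
  - by apply: (g_vert f y s) => //; rewrite E.
  - apply: (g_cross f f' s t) => //; apply: contraTneq dff => <-.
    rewrite -setI_eq0 finset.setIid; apply/set0Pn.
    by have [x [y [-> _ _]]] := g_ends _ fe; exists x; rewrite !inE eqxx.
(* The samples with indices 0 and N + 1 are the ends of the arc. *)
pose smp (N : nat) f i := g f (i%:R / N.+1%:R).
have smp01 (N i : nat) : (i <= N.+1)%N -> (i%:R / N.+1%:R : R) \in `[0, 1].
  move=> iN; rewrite in_itv /= divr_ge0 //= ler_pdivrMr ?ltr0n // mul1r ler_nat //.
pose good N (ff : {set T} * {set T}) := ff.1 \in edges e -> ff.2 \in edges e ->
  [disjoint ff.1 & ff.2]%B -> exists2 d : R, 0 < d &
    (forall i j, (i <= N.+1)%N -> (j <= N.+1)%N -> away d (smp N ff.1 i - smp N ff.2 j)) /\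
    (forall i i' j j', (i <= N.+1)%N -> (i' <= N.+1)%N -> (j <= N.+1)%N -> (j' <= N.+1)%N ->
      (i' <= i.+1)%N -> (i <= i'.+1)%N -> (j' <= j.+1)%N -> (j <= j'.+1)%N ->
      close d (smp N ff.1 i - smp N ff.2 j) (smp N ff.1 i' - smp N ff.2 j')).
have : (\forall N \near \oo, forall ff, good N ff)%classic.
  apply: filter_forall => -[f f']; rewrite /good /=.
  have [fe|] := boolP (f \in edges e); last by move=> _; apply: nearW.
  have [fe'|] := boolP (f' \in edges e); last by move=> _; apply: nearW.
  have [dff|] := boolP [disjoint f & f']%B; last by move=> _; apply: nearW.
  have [d d0 dP] := arcs_apart (g_cont _ fe) (g_cont _ fe') (fun s t => apart f f' s t fe fe' dff).
  (* With half the distance for each arc, one step changes the difference of samples by less than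
     [d]. *)
  have d2 : 0 < d / 2 by rewrite divr_gt0.
  apply: filterS2 (arc_uniform d2 (g_cont _ fe)) (arc_uniform d2 (g_cont _ fe')).
  move=> N U U' _ _ _; exists d => //.
  have step (i i' : nat) : (i' <= i.+1)%N -> (i <= i'.+1)%N ->
      `|i%:R / N.+1%:R - i'%:R / N.+1%:R| <= N.+1%:R^-1 :> R.
    move=> h1 h2; rewrite -mulrBl normrM (ger0_norm (_ : 0 <= N.+1%:R^-1)) ?invr_ge0 //.
    rewrite ler_piMl ?invr_ge0 // ler_norml.
    have := h1; rewrite -(ler_nat R) => {}h1; have := h2; rewrite -(ler_nat R) => {}h2.
    rewrite -!natr1 in h1 h2; apply/andP; split; lra.
  split=> [i j iN jN|i i' j j' iN iN' jN jN' h1 h2 h3 h4].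
    have := dP _ _ (smp01 _ _ iN) (smp01 _ _ jN).
    by rewrite /away prod_normE le_max.
  have := U _ _ (smp01 _ _ iN) (smp01 _ _ iN') (step _ _ h1 h2).
  have := U' _ _ (smp01 _ _ jN) (smp01 _ _ jN') (step _ _ h3 h4).
  rewrite -/(smp N f i) -/(smp N f i') -/(smp N f' j) -/(smp N f' j').
  move: (smp N f i) (smp N f i') (smp N f' j) (smp N f' j') => [a b] [a' b'] [u v] [u' v'].
  rewrite !prod_normE /close /= !gt_max !ltr_norml.
  move=> /andP[/andP[c1 c2] /andP[c3 c4]] /andP[/andP[c5 c6] /andP[c7 c8]].
  by apply/andP; split; apply/andP; split; lra.
move=> /filter_ex[N goodN].
exists (fun x y => lexneg (p x - p y)), (fun x y k => parity N.+1 (smp N [set x; y]) (p k)).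
split=> [x y xy|x y z w U exy ezw].
  rewrite -opprB lexnegN //; apply: contraNneq xy => /eqP.
  by rewrite subr_eq0 => /eqP/p_inj ->.
have inE2 x1 y1 : e x1 y1 -> [set x1; y1] \in edges e.
  by move=> exy1; apply/imsetP; exists (x1, y1); rewrite ?inE.
have dff : [disjoint [set x; y] & [set z; w]]%B.
  move: U; rewrite /= !inE !negb_or => /and4P[/and3P[_ xz xw] /andP[yz yw] _ _].
  rewrite finset.disjoints_subset; apply/fintype.subsetP => v; rewrite !inE => /orP[]/eqP->; by apply/norP.
have [d d0 [aw cl]] := goodN ([set x; y], [set z; w]) (inE2 _ _ exy) (inE2 _ _ ezw) dff.
have := parity_cells d0 aw cl; rewrite /= /smp !mul0r !divff ?pnatr_eq0 //.
have [x1 [y1 [Exy -> ->]]] := g_ends _ (inE2 _ _ exy).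
have [z1 [w1 [Ezw -> ->]]] := g_ends _ (inE2 _ _ ezw).
have xy : x != y by apply: contraTneq exy => ->; rewrite e_irr.
have zw : z != w by apply: contraTneq ezw => ->; rewrite e_irr.
(* An arc may run from either end of its edge; the identity is symmetric in the ends. *)
have [[-> ->]|[-> ->]] := set2_eqP xy Exy; have [[-> ->]|[-> ->]] := set2_eqP zw Ezw;
move: (parity _ _ _) (parity _ _ _) (parity _ _ _) (parity _ _ _)
  (lexneg _) (lexneg _) (lexneg _) (lexneg _); clear; do 8!case => //.
Qed.
End Drawing.

Theorem theorem2 (R : realType) (T : finType) (e : rel T)
    (e_sym : symmetric e) (e_irr : irreflexive e) (e_planar : planar R e) :
  (B_coloring_number e <= max_degree e + maxn (max_codegree e) 38)%N.
Proof.
rewrite /B_coloring_number; case: ex_minnP => k _; apply; apply/asboolP.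
apply: conflict_colorable_B_colorable => //.
apply: conflict_colorable_planar => //; first exact: planar_z2_planar e_planar.
- by move=> x; apply: (leq_bigmax (F := fun x => #|nbhd e x|)).
- move=> x y xy; apply: leq_trans (leq_maxl _ _).
  apply: leq_trans (leq_bigmax x); apply: (leq_bigmax_cond (F := fun w => #|nbhd e x :&: nbhd e w|)).
  by rewrite eq_sym.
- exact: leq_maxr.
Qed.
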